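(* Let $m,n$ be integers with $\min(m,n)\ge 3$. A non-overlapping $(m,n)$-framework $(p_1,\dots,p_m;\,q_1,\dots,q_n)$ in the hyperbolic plane $H^2$ is flexible if and only if one of the following conditions holds. (D1) The points $p_1,\dots,p_m$ lie on a (geodesic) line $P$, the points $q_1,\dots,q_n$ lie on another line $Q$, and these two lines are orthogonal to each other. (D2) There are two orthogonal lines and two quadrilaterals symmetric with respect to each of these lines and with vertices not belonging to these lines such that $p_1,\dots,p_m$ are at the vertices of one quadrilateral and $q_1,\dots,q_n$ are at the vertices of the other one.
   Context: $H^2$ is the hyperbolic plane: the complete simply connected Riemannian 2-manifold of constant curvature $-1$, with distance $d_H$; lines are geodesics. An $(m,n)$-framework in $H^2$ is a collection of points $\mathbf p=(p_1,\dots,p_m;\,q_1,\dots,q_n)$ of $H^2$ such that $p_i\ne q_j$ for all $i,j$. The points $p_i,q_j$ are called joints; the two parts are $(p_1,\dots,p_m)$ and $(q_1,\dots,q_n)$. The framework is non-overlapping if all its joints are pairwise distinct. It is flexible if it admits a flex, i.e. a continuous non-constant motion of its joints $\mathbf p(t)=(p_1(t),\dots,q_n(t))$, $t\in[0,1]$, such that $\mathbf p(0)=\mathbf p$, $d_H(p_i(t),q_j(t))$ does not depend on $t$ for each $i,j$, and some two joints from different parts do not move. *)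

(* Defs.v *)
From HB Require Import structures.
From mathcomp Require Import all_boot all_order all_algebra.
From mathcomp Require Import all_classical all_reals all_analysis.

Set Implicit Arguments.
Unset Strict Implicit.
Unset Printing Implicit Defensive.

Import Order.TTheory GRing.Theory Num.Theory.
Import numFieldNormedType.Exports.

Local Open Scope classical_set_scope.
Local Open Scope ring_scope.

(* The hyperbolic plane is the upper sheet of the hyperboloid u.u = -1 in the
   Lorentzian space R^{2,1}. *)

Definition lorentz (R : realType) (u v : 'rV[R]_3) : R :=
  u 0 0 * v 0 0 + u 0 1 * v 0 1 - u 0 2%:R * v 0 2%:R.

Record hplane (R : realType) := HPlane {
  hval :> 'rV[R]_3;
  _ : (lorentz hval hval == -1) && (0 < hval 0 2%:R)
}.

HB.instance Definition _ (R : realType) := [isSub for @hval R].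
HB.instance Definition _ (R : realType) := [Choice of hplane R by <:].

Definition cosh (R : realType) (s : R) : R := (expR s + expR (- s)) / 2%:R.
Definition sinh (R : realType) (s : R) : R := (expR s - expR (- s)) / 2%:R.
Definition arcosh (R : realType) (c : R) : R := ln (c + Num.sqrt (c ^+ 2 - 1)).

Definition dH (R : realType) (x y : hplane R) : R := arcosh (- lorentz x y).

(* The tangent plane at o is the Lorentz-orthogonal complement of o, on which
   the Lorentz form restricts to the Riemannian metric. *)
Definition unit_tangent (R : realType) (o : hplane R) (v : 'rV[R]_3) : Prop :=
  lorentz o v = 0 /\ lorentz v v = 1.

(* The complete geodesic s |-> exp_o (s v), as a set of points. *)
Definition geodesic (R : realType) (o : hplane R) (v : 'rV[R]_3) :
    set (hplane R) :=
  [set x | exists s : R, hval x = cosh s *: hval o + sinh s *: v].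

Definition is_line (R : realType) (L : set (hplane R)) : Prop :=
  exists (o : hplane R) (v : 'rV[R]_3), unit_tangent o v /\ L = geodesic o v.

Definition orthogonal_lines (R : realType) (P Q : set (hplane R)) : Prop :=
  exists (o : hplane R) (v w : 'rV[R]_3),
    [/\ unit_tangent o v, unit_tangent o w, lorentz v w = 0,
        P = geodesic o v & Q = geodesic o w].

Definition is_reflection (R : realType) (L : set (hplane R))
    (f : hplane R -> hplane R) : Prop :=
  (forall x y, dH (f x) (f y) = dH x y) /\ (forall x, f x = x <-> L x).

(* A quadrilateral is given by its four vertices in cyclic order: its sides
   are {A i, A (i + 1)}, with indices taken in Z/4. *)
Definition is_quadrilateral (R : realType) (A : 'I_4 -> hplane R) : Prop :=
  injective A.

Definition symmetric_wrt (R : realType) (A : 'I_4 -> hplane R)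
    (L : set (hplane R)) : Prop :=
  exists f : hplane R -> hplane R, is_reflection L f /\
    forall i : 'I_4, exists j : 'I_4,
      [set f (A i); f (A (i + 1))] = [set A j; A (j + 1)].

Definition is_framework (R : realType) (m n : nat)
    (p : 'I_m -> hplane R) (q : 'I_n -> hplane R) : Prop :=
  forall i j, p i <> q j.

Definition non_overlapping (R : realType) (m n : nat)
    (p : 'I_m -> hplane R) (q : 'I_n -> hplane R) : Prop :=
  [/\ injective p, injective q & forall i j, p i <> q j].

(* The topology of the plane is the one induced from R^3. *)
Definition continuous_path (R : realType) (x : R -> hplane R) : Prop :=
  {within `[0, 1], continuous (fun t => hval (x t))}.

(* Motions are functions on all of R of which only the values on [0, 1]
   matter. *)
Definition is_flex (R : realType) (m n : nat)
    (p : 'I_m -> hplane R) (q : 'I_n -> hplane R)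
    (pt : R -> 'I_m -> hplane R) (qt : R -> 'I_n -> hplane R) : Prop :=
  [/\ (forall i, continuous_path (pt ^~ i)) /\
        (forall j, continuous_path (qt ^~ j)),
      (forall i, pt 0 i = p i) /\ (forall j, qt 0 j = q j),
      exists2 t : R, 0 <= t <= 1 &
        (exists i, pt t i <> p i) \/ (exists j, qt t j <> q j),
      forall t : R, 0 <= t <= 1 ->
        forall i j, dH (pt t i) (qt t j) = dH (p i) (q j) &
      exists i j, forall t : R, 0 <= t <= 1 -> pt t i = p i /\ qt t j = q j].

Definition flexible (R : realType) (m n : nat)
    (p : 'I_m -> hplane R) (q : 'I_n -> hplane R) : Prop :=
  exists (pt : R -> 'I_m -> hplane R) (qt : R -> 'I_n -> hplane R),
    is_flex p q pt qt.

Definition condition_D1 (R : realType) (m n : nat)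
    (p : 'I_m -> hplane R) (q : 'I_n -> hplane R) : Prop :=
  exists P Q : set (hplane R),
    [/\ is_line P, is_line Q, orthogonal_lines P Q,
        (forall i, P (p i)) & (forall j, Q (q j))].

Definition condition_D2 (R : realType) (m n : nat)
    (p : 'I_m -> hplane R) (q : 'I_n -> hplane R) : Prop :=
  exists (K L : set (hplane R)) (A B : 'I_4 -> hplane R),
    [/\ [/\ is_line K, is_line L & orthogonal_lines K L],
        [/\ is_quadrilateral A, symmetric_wrt A K, symmetric_wrt A L &
            forall k, ~ K (A k) /\ ~ L (A k)],
        [/\ is_quadrilateral B, symmetric_wrt B K, symmetric_wrt B L &
            forall k, ~ K (B k) /\ ~ L (B k)],
        (forall i, exists k, p i = A k) &
        (forall j, exists k, q j = B k)].

(* Main.v *)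
(* On the hyperboloid a distance d becomes the product H = cosh d, and along a
   flex the matrix C with entries H(p_i, q_j), of rank at most 3, is constant.
   Rank 1 is condition (D1).  In rank 2, one of the two parts is collinear at
   each time; C then determines its distances, and leaves finitely many values
   for those of the other part, so nothing moves.

   In rank 3, choose three independent p's and three independent q's such that
   a = H(p1, p2) takes infinitely many values near the start of the motion.
   The heights of the q's over the line p1 p2 are given by volumes s_j with
   s_j^2 = - D_j(a), where D_j is a monic quadratic with simple real roots,
   and eliminating p3 leaves
     P0(a) + P12(a) s1 s2 + P13(a) s1 s3 + P23(a) s2 s3 = 0.
   Since sqrt(D_j D_k) is irrational unless D_j = D_k, comparing coefficients
   shows that exactly two of the D_j coincide and, after a finite case
   analysis, that H(p2, p3) = H(p1, p2) + H(p1, p3) - 1 up to renaming: the p's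
   are three vertices of a "rectangle".  In its axes every q yields an equation
   u / X + v / Y + 1 = w / (1 + X + Y) between the squared half axes X and Y.
   Two such curves with infinitely many common points are equal, so all the q's
   are vertices of one rectangle with the same axes; since the curve contains
   no line, so are all the p's.  This is (D2).

   Conversely, (D1) flexes by scaling cosh along one line by a factor and along
   the other by its inverse, and (D2) flexes along the above curve, which is
   singular at the starting point only if the two rectangles coincide. *)
Require Import Defs.
From mathcomp Require Import all_boot all_order all_algebra.
From mathcomp Require Import all_classical all_reals all_analysis.
From mathcomp Require Import ring lra.

Set Implicit Arguments.
Unset Strict Implicit.
Unset Printing Implicit Defensive.

Import Order.TTheory GRing.Theory Num.Theory.
Import numFieldNormedType.Exports.

(** * Polynomial identities on infinite sets *)

(** A motion is only continuous: no branch of a square root can be followed and nothing can be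
    continued analytically. Every identity is therefore extracted from infinitely many values of a
    distance, which the intermediate value theorem supplies, and signs are fixed by passing to an
    infinite subset of times. Such a subset need not contain the starting time. For this reason the
    conclusions are cast as properties of the constant matrix C, except the rectangle equation,
    which returns to the start as a limit; this requires it for one and the same triple of joints in
    arbitrarily small neighbourhoods. The two joints at rest in a flex serve to exclude rigid
    motions. For necessity they show that some mutual distance changes; for sufficiency they are
    ignored while the motion is built, and brought to rest afterwards by composing with
    isometries. *)

Section PolynomialIdentities.
Local Open Scope classical_set_scope.
Local Open Scope ring_scope.
Variables (R : realType) (T : Type).
Implicit Types (I : set T) (a : T -> R).

Lemma poly_infinite_roots (p : {poly R}) I a :
  infinite_set (a @` I) -> (forall t, I t -> p.[a t] = 0) -> p = 0.
Proof.
move=> infa pa0; apply/eqP; apply: contraPT (infa) => p0 _.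
have [B sB leB] := infinite_set_fset (size p) infa.
have := max_poly_roots p0 (rs := finmap.enum_fset B).
rewrite finmap.fset_uniq ltnNge leB => /(_ _ isT) H.
suff /H : all (root p) (finmap.enum_fset B) by [].
by apply/allP => x xB; have [t It <-] := sB x xB; rewrite rootE pa0.
Qed.

(** Pigeonhole, used to fix the relative sign of two square roots, or which part is collinear, on an
    infinite set of values. *)
Lemma infinite_image_split I (A B : set T) a :
  infinite_set (a @` I) -> (forall t, I t -> A t \/ B t) ->
  infinite_set (a @` (I `&` A)) \/ infinite_set (a @` (I `&` B)).
Proof.
move=> infa AB; have [|finA] := pselect (infinite_set (a @` (I `&` A))); first by left.
right => finB; apply: infa; apply: (@sub_finite_set _ _ ((a @` (I `&` A)) `|` (a @` (I
  `&` B)))).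
  by move=> _ [t It <-]; have [At|Bt] := AB t It; [left|right]; exists t.
by rewrite finite_setU; split => //; apply: contrapT.
Qed.

Lemma cubic_infinite_roots I a (c0 c1 c2 c3 : R) :
  infinite_set (a @` I) ->
  (forall t, I t -> c0 + c1 * a t + c2 * a t ^+ 2 + c3 * a t ^+ 3 = 0) ->
  [/\ c0 = 0, c1 = 0, c2 = 0 & c3 = 0].
Proof.
move=> infa H; have p0 : Poly [:: c0; c1; c2; c3] = 0.
  apply: (poly_infinite_roots infa) => t /H <-.
  by rewrite horner_Poly /=; ring.
have pi0 i : (Poly [:: c0; c1; c2; c3])`_i = 0 by rewrite p0 coef0.
by split; [move: (pi0 0)|move: (pi0 1)|move: (pi0 2)|move: (pi0 3)]; rewrite coef_Poly.
Qed.

(* [- (discr_poly x y).[a]] is the squared volume of (p1, p2, q) when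
   p1, p2, q have mutual products a, x, y. *)
Definition discr_poly (x y : R) : {poly R} :=
  'X^2 - (2 * x * y)%:P * 'X + (x ^+ 2 + y ^+ 2 - 1)%:P.

Lemma horner_discr_poly (x y c : R) :
  (discr_poly x y).[c] = c ^+ 2 - 2 * x * y * c + (x ^+ 2 + y ^+ 2 - 1).
Proof. by rewrite /discr_poly !hornerE. Qed.

(** With x = cosh d and y = cosh d', the roots are cosh (d + d') and cosh (d - d'), the values of a
    for which p1, p2, q are collinear. They differ because x, y > 1. *)
Lemma discr_polyE (x y : R) : 1 < x -> 1 < y ->
  exists r s : R, [/\ r != s, discr_poly x y = ('X - r%:P) * ('X - s%:P),
     x * y = (r + s) / 2 & x ^+ 2 + y ^+ 2 = r * s + 1].
Proof.
move=> x1 y1; pose q := Num.sqrt ((x ^+ 2 - 1) * (y ^+ 2 - 1)).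
have q0 : 0 < q by rewrite sqrtr_gt0 mulr_gt0 // subr_gt0 exprn_egt1.
have qq : q ^+ 2 = (x ^+ 2 - 1) * (y ^+ 2 - 1).
  by rewrite sqr_sqrtr // mulr_ge0 // subr_ge0 exprn_ege1 // ltW.
exists (x * y + q), (x * y - q); split.
- by apply/eqP => h; move: q0; lra.
- rewrite /discr_poly.
  have -> : x ^+ 2 + y ^+ 2 - 1 = (x * y + q) * (x * y - q).
    by rewrite (mulrC (x * y + q)) -subr_sqr qq; ring.
  have -> : 2 * x * y = (x * y + q) + (x * y - q) by ring.
  rewrite polyCD polyCM; ring.
- by field.
- by rewrite (mulrC (x * y + q)) -subr_sqr qq; ring.
Qed.

(** The coefficients determine x y and x^2 + y^2, hence x + y by positivity, hence the unordered
    pair. *)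
Lemma discr_poly_eq (x y x' y' : R) : 1 < x -> 1 < y -> 1 < x' -> 1 < y' ->
  discr_poly x y = discr_poly x' y' ->
  (x = x' /\ y = y') \/ (x = y' /\ y = x').
Proof.
move=> x1 y1 x'1 y'1 e.
have e0 := congr1 (fun p => p.[0]) e; have e1 := congr1 (fun p => p.[1]) e.
rewrite !horner_discr_poly in e0 e1.
have em : x * y = x' * y' by move: e0 e1; lra.
have es : x + y = x' + y'.
  have : (x + y - x' - y') * (x + y + x' + y') = 0 by move: e0; nra.
  by move=> /eqP; rewrite mulf_eq0 => /orP[] /eqP; lra.
have : (x - x') * (x - y') = 0.
  have -> : (x - x') * (x - y') = x * (x - x' - y') + x' * y' by ring.
  by rewrite -em (_ : x - x' - y' = - y); [ring | lra].
by move=> /eqP; rewrite mulf_eq0 => /orP[] /eqP h; [left|right]; split; lra.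
Qed.

(** Parity of multiplicities: different monic quadratics with simple roots do not share both roots,
    so the first has a root z that is simple in the product. At z the left side has even
    multiplicity and the right side odd. *)
Lemma discr_poly_nonsquare (x y x' y' : R) (U V : {poly R}) :
  1 < x -> 1 < y -> 1 < x' -> 1 < y' -> discr_poly x y <> discr_poly x' y' ->
  U ^+ 2 = V ^+ 2 * (discr_poly x y * discr_poly x' y') -> U = 0 /\ V = 0.
Proof.
move=> x1 y1 x'1 y'1 D12 e.
suff V0 : V = 0.
  by split => //; move: e; rewrite V0 expr0n /= mul0r => /eqP; rewrite sqrf_eq0 => /eqP.
apply/eqP; apply: contrapT => /negP V0.
have [r [s [rs D1 _ _]]] := discr_polyE x1 y1.
have [r' [s' [rs' D2 _ _]]] := discr_polyE x'1 y'1.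
have [z [E [zE e']]] : exists z E, ~~ root E z /\
     discr_poly x y * discr_poly x' y' = E * ('X - z%:P).
  have [r2|r2] := boolP (root (discr_poly x' y') r); last first.
    exists r, (('X - s%:P) * discr_poly x' y'); rewrite rootM root_XsubC negb_or rs;
      split => //.
    by rewrite D1; ring.
  exists s, (('X - r%:P) * discr_poly x' y'); split; last by rewrite D1; ring.
  rewrite rootM root_XsubC eq_sym negb_or rs /=.
  apply/negP => s2; apply: D12; rewrite D1 D2.
  move: r2 s2; rewrite D2 !rootM !root_XsubC.
  move=> /orP[] /eqP rr /orP[] /eqP ss; rewrite rr ss // in rs *; first by rewrite eqxx
    in rs.
    by rewrite mulrC.
  by rewrite eqxx in rs.
have E0 : E != 0 by apply: contra zE => /eqP ->; rewrite root0.
have U0 : U != 0.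
  apply: contra V0 => /eqP U0; move: e; rewrite U0 expr0n /= e' => /esym/eqP.
  by rewrite !mulf_eq0 polyXsubC_eq0 (negbTE E0) !orbF /= orbb.
have := congr1 (mup z) e.
rewrite e' expr2 mupM // expr2 !mupM ?mulf_neq0 ?polyXsubC_eq0 //.
rewrite (mupNroot zE) -['X - _]expr1 mup_XsubCX eqxx add0n !addnn addn1.
by move=> /(congr1 odd); rewrite /= !odd_double.
Qed.

(** * Square roots of the discriminant quadratics *)

Section Radicals.
Variables (I : set T) (a s1 s2 s3 : T -> R) (x1 x2 x3 y1 y2 y3 : R).
Hypotheses (x1_gt1 : 1 < x1) (x2_gt1 : 1 < x2) (x3_gt1 : 1 < x3).
Hypotheses (y1_gt1 : 1 < y1) (y2_gt1 : 1 < y2) (y3_gt1 : 1 < y3).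
Hypothesis infa : infinite_set (a @` I).
Hypothesis s1E : forall t, I t -> s1 t ^+ 2 = - (discr_poly x1 y1).[a t].
Hypothesis s2E : forall t, I t -> s2 t ^+ 2 = - (discr_poly x2 y2).[a t].
Hypothesis s3E : forall t, I t -> s3 t ^+ 2 = - (discr_poly x3 y3).[a t].

(** Squaring removes the unknown sign of s1 s2, and (s1 s2)^2 is the polynomial D1 D2 because the
    two minus signs cancel. *)
Lemma radical2_indep (U V : {poly R}) :
  discr_poly x1 y1 <> discr_poly x2 y2 ->
  (forall t, I t -> U.[a t] + V.[a t] * (s1 t * s2 t) = 0) -> U = 0 /\ V = 0.
Proof.
move=> D12 H; apply: (discr_poly_nonsquare x1_gt1 y1_gt1 x2_gt1 y2_gt1 D12).
apply/eqP; rewrite -subr_eq0; apply/eqP; apply: (poly_infinite_roots infa) => t It.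
have := H t It; move: (s1E It) (s2E It).
move: (discr_poly x1 y1) (discr_poly x2 y2) => d1 d2 e1 e2 e.
rewrite !(hornerD, hornerN, hornerM, horner_exp).
have -> : d1.[a t] = - s1 t ^+ 2 by rewrite e1 opprK.
have -> : d2.[a t] = - s2 t ^+ 2 by rewrite e2 opprK.
have -> : U.[a t] = - V.[a t] * (s1 t * s2 t) by rewrite mulNr; apply/eqP; rewrite
  -addr_eq0 e.
ring.
Qed.

(** Isolating the terms with s3 and squaring leaves s1 s2 as the only radical; [radical2_indep]
    separates its coefficient from the rest. *)
Lemma radical3_elim (P0 P12 P13 P23 : {poly R}) :
  discr_poly x1 y1 <> discr_poly x2 y2 ->
  (forall t, I t -> P0.[a t] + P12.[a t] * (s1 t * s2 t) +
     P13.[a t] * (s1 t * s3 t) + P23.[a t] * (s2 t * s3 t) = 0) ->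
  P0 * P12 + discr_poly x3 y3 * (P13 * P23) = 0 /\
  P0 ^+ 2 + P12 ^+ 2 * (discr_poly x1 y1 * discr_poly x2 y2) =
    discr_poly x3 y3 * (P13 ^+ 2 * discr_poly x1 y1 + P23 ^+ 2 * discr_poly x2 y2).
Proof.
move=> D12 H.
case: (@radical2_indep
   (P0 ^+ 2 + P12 ^+ 2 * (discr_poly x1 y1 * discr_poly x2 y2) -
    discr_poly x3 y3 * (P13 ^+ 2 * discr_poly x1 y1 + P23 ^+ 2 * discr_poly x2 y2))
   (2%:P * (P0 * P12 + discr_poly x3 y3 * (P13 * P23))) D12); last first.
- move=> h /eqP; rewrite mulf_eq0 polyC_eq0 pnatr_eq0 /=.
  by move=> /eqP h2; split => //; apply/eqP; rewrite -subr_eq0 h.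
move=> t It; have := H t It; move: (s1E It) (s2E It) (s3E It).
move: (discr_poly x1 y1) (discr_poly x2 y2) (discr_poly x3 y3) => d1 d2 d3 e1 e2 e3 e.
rewrite !(hornerD, hornerN, hornerM, hornerC, horner_exp).
have -> : d1.[a t] = - s1 t ^+ 2 by rewrite e1 opprK.
have -> : d2.[a t] = - s2 t ^+ 2 by rewrite e2 opprK.
have -> : d3.[a t] = - s3 t ^+ 2 by rewrite e3 opprK.
have -> : P0.[a t] = - (P12.[a t] * (s1 t * s2 t) +
     P13.[a t] * (s1 t * s3 t) + P23.[a t] * (s2 t * s3 t)).
  by apply/eqP; rewrite -addr_eq0 !addrA e.
ring.
Qed.
End Radicals.

End PolynomialIdentities.

(** * Rectangles from the algebra of the distances *)

Section RectangleAlgebra.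
Local Open Scope ring_scope.
Variable R : realFieldType.
Implicit Types x y z p q : R.

Lemma mulIr0 (k u : R) : k != 0 -> k * u = 0 -> u = 0.
Proof. by move=> k0 /eqP; rewrite mulf_eq0 (negbTE k0) => /eqP. Qed.

Lemma sqr_eq_pos (u v : R) : 0 < u -> 0 < v -> u ^+ 2 = v ^+ 2 -> u = v.
Proof.
move=> u0 v0 /eqP; rewrite eqf_sqr => /orP[] /eqP // e.
by move: u0; rewrite e oppr_gt0 => /(lt_trans v0); rewrite ltxx.
Qed.

(** Here q1 and q2 are mirror images in the line p1 p2, so p1 q1 p2 q2 is a kite, and it turns out
    to be a rhombus. A, B, C are the coefficients of s2, and a3, b3 those of s3, in the determinants
    of [volume_equation] for s1 = - s2; d is the determinant of the matrix once p = q. The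
    hypotheses say that coefficients of powers of a vanish. *)
Lemma kite_case p q x3 y3 z1 z2 z3 :
  1 < p -> 1 < q -> 1 < x3 -> 1 < y3 -> 1 < z1 -> 1 < z2 -> 1 < z3 -> z1 != z2 ->
  let A := y3 * (z1 + z2) - 2 * q * z3 in
  let B := 2 * p * z3 - x3 * (z1 + z2) in
  let C := 2 * (x3 * q - p * y3) in
  let a3 := q * (z2 - z1) in let b3 := - (p * (z2 - z1)) in
  let E := A ^+ 2 + B ^+ 2 - C ^+ 2 in
  let F := a3 ^+ 2 + b3 ^+ 2 in
  let d := p * (x3 - y3) * (z2 - z1) in
  b3 * A + a3 * B = 0 -> a3 * A + b3 * B = 0 -> A * B + a3 * b3 = 0 ->
  p * q * E - (p ^+ 2 + q ^+ 2 - 1) * (A * B) + x3 * y3 * F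
    - (x3 ^+ 2 + y3 ^+ 2 - 1) * (a3 * b3) = 0 ->
  (p = q -> - E + 4 * (p * q) * (A * B) - F + 4 * (x3 * y3) * (a3 * b3) - d ^+ 2 = 0) ->
  p = q /\ z1 + z2 = 2 * p.
Proof.
move=> p1 q1 x31 y31 z11 z21 z31 z12 A B C a3 b3 E F d hi hii c3 c1 c2.
have D0 : z2 - z1 != 0 by rewrite subr_eq0 eq_sym.
have p0 : 0 < p := lt_trans ltr01 p1.
have q0 : 0 < q := lt_trans ltr01 q1.
have e1 : q * B - p * A = 0 by apply: (mulIr0 D0); rewrite -[RHS]hi /a3 /b3; ring.
have e2 : q * A - p * B = 0 by apply: (mulIr0 D0); rewrite -[RHS]hii /a3 /b3; ring.
have A0 : A != 0.
  apply/eqP => A0; move: c3; rewrite A0 mul0r add0r => /eqP.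
  by rewrite /a3 /b3 mulrN oppr_eq0 !mulf_eq0 (negbTE D0) !gt_eqF.
(* Eliminating B from e1 and e2 gives (p^2 - q^2) A = 0. *)
have pq : p = q.
  apply: sqr_eq_pos => //; apply/eqP; rewrite -subr_eq0; apply/eqP; apply: (mulIr0 A0).
  transitivity (- (p * (q * B - p * A) + q * (q * A - p * B))); first by ring.
  by rewrite e1 e2; ring.
subst q; split => //; move: {c2}(c2 erefl) => c2.
have AB : A = B.
  by apply/eqP; rewrite -subr_eq0; apply/eqP/(mulIr0 (lt0r_neq0 p0)); rewrite mulrBr.
have zz : (x3 + y3) * (z1 + z2) = 4 * p * z3.
  by move/eqP: AB; rewrite -subr_eq0 /A /B => /eqP h; apply/eqP; rewrite -subr_eq0;
    apply/eqP; rewrite -[RHS]h; ring.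
have A2 : 2 * A = (y3 - x3) * (z1 + z2) by rewrite mulr2n mulrDl !mul1r {2}AB /A /B; ring.
have AA : A ^+ 2 = p ^+ 2 * (z2 - z1) ^+ 2.
  by apply/eqP; rewrite -subr_eq0; apply/eqP; rewrite -[RHS]c3 -AB /a3 /b3; ring.
have xy : x3 - y3 != 0.
  apply/eqP => h; move/eqP: A0; apply; have : 2 * A = 0 by rewrite A2 -opprB h oppr0
    mul0r.
  by move=> h2; apply: (@mulIr0 2).
have h1 : A ^+ 2 * (x3 + y3) ^+ 2 = p ^+ 2 * C ^+ 2.
  apply/eqP; rewrite -subr_eq0; apply/eqP; rewrite -[RHS]c1 /E /F -AB /a3 /b3.
  transitivity (A ^+ 2 * (x3 + y3) ^+ 2 - p ^+ 2 * C ^+ 2 +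
     ((2 * x3 * y3 + x3 ^+ 2 + y3 ^+ 2 - 1) * (p ^+ 2 * (z2 - z1) ^+ 2 - A ^+ 2)));
       last by ring.
  by rewrite -AA; ring.
have h2 : (z1 + z2) * (x3 + y3) = 4 * p ^+ 2.
  apply: sqr_eq_pos; [by nra | by nra |].
  apply/eqP; rewrite -subr_eq0; apply/eqP/(mulIr0 (mulf_neq0 xy xy)).
  transitivity ((2 * A) ^+ 2 * (x3 + y3) ^+ 2 - 4 * (p ^+ 2 * C ^+ 2)).
    by rewrite A2 /C; ring.
  by rewrite -h1; ring.
apply: sqr_eq_pos; [by nra | by nra |].
have p20 : p ^+ 2 - 1 != 0 by rewrite gt_eqF // subr_gt0 exprn_egt1.
apply/eqP; rewrite -subr_eq0; apply/eqP/(mulIr0 p20).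
have k0 : p ^+ 2 * (z2 - z1) ^+ 2 != 0 by rewrite mulf_neq0 ?(expf_neq0, D0) ?lt0r_neq0.
apply: (mulIr0 k0).
have c2' : (z2 - z1) ^+ 2 * p ^+ 2 * (4 * p ^+ 2 - 4 - 4 * x3 * y3) + 4 * p ^+ 2 * (x3
  - y3) ^+ 2 - d ^+ 2 = 0.
  rewrite -[RHS]c2 /E /F -AB /a3 /b3 /C.
  transitivity ((4 * p ^+ 2 - 2) * (p ^+ 2 * (z2 - z1) ^+ 2) - 2 * p ^+ 2 * (z2 - z1)
    ^+ 2 - 4 * x3 * y3 * p ^+ 2 * (z2 - z1) ^+ 2 + 4 * p ^+ 2 * (x3 - y3) ^+ 2 - d ^+
    2); first by ring.
  by rewrite -AA; ring.
have h3 : (x3 - y3) ^+ 2 * (z1 + z2) ^+ 2 = 4 * p ^+ 2 * (z2 - z1) ^+ 2.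
  transitivity ((2 * A) ^+ 2); first by rewrite A2; ring.
  by rewrite exprMn AA; ring.
(* c2' is multiplied by (z1 + z2)^2 / 4, so that x3 and y3 occur only in the combinations known from
   h2 and h3. *)
transitivity ((z1 + z2) ^+ 2 * 0 / 4 : R); last by rewrite mulr0 mul0r.
rewrite -c2' /d.
have -> : 4 * x3 * y3 = (x3 + y3) ^+ 2 - (x3 - y3) ^+ 2 by ring.
transitivity (((z2 - z1) ^+ 2 * p ^+ 2 * ((4 * p ^+ 2 - 4) * (z1 + z2) ^+ 2 - ((z1 +
  z2) * (x3 + y3)) ^+ 2 + (x3 - y3) ^+ 2 * (z1 + z2) ^+ 2) + (4 * p ^+ 2 - p ^+ 2 * (z2
  - z1) ^+ 2)* ((x3 - y3) ^+ 2 * (z1 + z2) ^+ 2)) / 4); last by ring.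
rewrite h2 h3; by field.
Qed.

(** For s1 = s2, q1 and q2 are exchanged by the reflection in the perpendicular bisector of p1 p2:
    p1 q1 p2 q2 is an antiparallelogram. The difference of the two relations is the claim times (p +
    q) (x3 + y3). *)
Lemma parallelogram_case_plus p q x3 y3 z1 z2 z3 :
  1 < p -> 1 < q -> 1 < x3 -> 1 < y3 -> p != q ->
  let A := (p - q) * z3 - y3 * (z2 - z1) in
  let B := (p - q) * z3 + x3 * (z2 - z1) in
  let C := (q - p) * (x3 + y3) in
  let a3 := q * z2 - p * z1 in let b3 := q * z1 - p * z2 in
  let g3 := p ^+ 2 - q ^+ 2 in
  b3 * A + a3 * B = 0 -> a3 * A + b3 * B - g3 * C = 0 ->
  (z2 - z1) ^+ 2 = (p - q) ^+ 2.
Proof.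
move=> p1 q1 x31 y31 pq A B C a3 b3 g3 hi hii.
have k0 : (p + q) * (x3 + y3) != 0 by rewrite mulf_neq0 // gt_eqF //; lra.
apply/eqP; rewrite -subr_eq0; apply/eqP/(mulIr0 k0).
transitivity ((b3 * A + a3 * B) - (a3 * A + b3 * B - g3 * C)).
  by rewrite /A /B /C /a3 /b3 /g3; ring.
by rewrite hi hii subrr.
Qed.

(** For s1 = - s2, q1 and q2 are exchanged by the half-turn about the midpoint of p1 p2. The sum of
    the two relations factors: either the squared claim holds or x3 = y3, and it is this degenerate
    case that calls for the remaining coefficients. *)
Lemma parallelogram_case_minus p q x3 y3 z1 z2 z3 :
  1 < p -> 1 < q -> 1 < x3 -> 1 < y3 -> 1 < z1 -> 1 < z2 -> 1 < z3 -> p != q ->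
  let A := - (p + q) * z3 + y3 * (z1 + z2) in
  let B := (p + q) * z3 - x3 * (z1 + z2) in
  let C := (p + q) * (x3 - y3) in
  let a3 := q * z2 - p * z1 in let b3 := q * z1 - p * z2 in
  let g3 := p ^+ 2 - q ^+ 2 in
  let E := A ^+ 2 + B ^+ 2 - C ^+ 2 in
  let F := a3 ^+ 2 + b3 ^+ 2 - g3 ^+ 2 in
  let d := p * (p * z3 - y3 * z2) + q * (y3 * z1 - q * z3) + x3 * (q * z2 - p * z1) in
  d != 0 ->
  b3 * A + a3 * B = 0 -> a3 * A + b3 * B - g3 * C = 0 -> A * B + a3 * b3 = 0 ->
  p * q * E - (p ^+ 2 + q ^+ 2 - 1) * (A * B) + x3 * y3 * F
    - (x3 ^+ 2 + y3 ^+ 2 - 1) * (a3 * b3) = 0 ->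
  - (p ^+ 2 + q ^+ 2 - 1) * E - (x3 ^+ 2 + y3 ^+ 2 - 1) * F + d ^+ 2 = 0 ->
  - E + 4 * (p * q) * (A * B) - F + 4 * (x3 * y3) * (a3 * b3) - d ^+ 2 = 0 ->
  z1 + z2 = p + q.
Proof.
move=> p1 q1 x31 y31 z11 z21 z31 pq A B C a3 b3 g3 E F d d0 hi hii c3 c1 c0 c2.
have pq0 : p - q != 0 by rewrite subr_eq0.
have s0 : p + q != 0 by rewrite gt_eqF //; lra.
have : (x3 - y3) * ((z1 + z2) ^+ 2 - (p + q) ^+ 2) = 0.
  apply: (mulIr0 pq0).
  transitivity ((b3 * A + a3 * B) + (a3 * A + b3 * B - g3 * C)).
    by rewrite /A /B /C /a3 /b3 /g3; ring.
  by rewrite hi hii addr0.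
move/eqP; rewrite mulf_eq0 => /orP[]; last first.
  by rewrite subr_eq0 => /eqP; apply: sqr_eq_pos; lra.
rewrite subr_eq0 => /eqP xy.
have BA : B = - A by rewrite /A /B xy; ring.
have C0 : C = 0 by rewrite /C xy subrr mulr0.
have : (z2 - z1) * A = 0.
  apply: (@mulIr0 (2 * (p + q))); first by rewrite mulf_neq0.
  transitivity (- (b3 * A + a3 * B) + (a3 * A + b3 * B - g3 * C)).
    by rewrite BA C0 /a3 /b3; ring.
  by rewrite hi hii oppr0 addr0.
have x30 : x3 * y3 != 0 by rewrite mulf_neq0 // gt_eqF //; lra.
move/eqP; rewrite mulf_eq0 => /orP[]; rewrite ?subr_eq0 => /eqP; last first.
  move=> A0.
  have E0 : E = 0 by rewrite /E BA A0 C0; ring.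
  have AB0 : A * B = 0 by rewrite A0 mul0r.
  have ab0 : a3 * b3 = 0 by rewrite -[RHS]c3 AB0 add0r.
  have F0 : F = 0 by apply: (mulIr0 x30); rewrite -[RHS]c1 E0 AB0 ab0; ring.
  by move/eqP: c0; rewrite E0 F0 !mulr0 subr0 add0r sqrf_eq0 (negbTE d0).
(* Left with x3 = y3 and z1 = z2: c3 and c1 give z1 = x3, then c2 gives p + q = 2 z1. *)
move=> z12; subst y3 z2.
have AA : A ^+ 2 = z1 ^+ 2 * (p - q) ^+ 2.
  apply/eqP; rewrite -subr_eq0; apply/eqP; rewrite -[RHS]oppr0 -c3 BA /a3 /b3; ring.
have zx : z1 = x3.
  apply: sqr_eq_pos; [lra | lra |].
  apply/eqP; rewrite -subr_eq0; apply/eqP.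
  apply: (@mulIr0 ((p - q) ^+ 2 * (p + q) ^+ 2)); first by rewrite mulf_neq0 // expf_neq0.
  transitivity (z1 ^+ 2 * (p - q) ^+ 2 * ((p + q) ^+ 2) - x3 ^+ 2 * (p - q) ^+ 2 * (p +
    q) ^+ 2); first by ring.
  rewrite -[RHS]c1 /E /F BA C0 /a3 /b3 /g3.
  transitivity (z1 ^+ 2 * (p - q) ^+ 2 * ((p + q) ^+ 2 - 2 * p * q - (p ^+ 2 + q ^+ 2 -
    1)) + ((p + q) ^+ 2 - 1) * A ^+ 2 - x3 ^+ 2 * (p - q) ^+ 2 * (p + q) ^+ 2).
    by rewrite AA; ring.
  by ring.
subst x3.
have dA : d = - ((p - q) * A) by rewrite /d /A; ring.
have -> : p + q = 2 * z1; last by ring.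
apply: sqr_eq_pos; [lra | lra |].
have z20 : z1 ^+ 2 - 1 != 0 by rewrite gt_eqF // subr_gt0 exprn_egt1.
apply/eqP; rewrite -subr_eq0; apply/eqP/(mulIr0 z20).
apply: (mulIr0 (expf_neq0 2 pq0)).
rewrite -[RHS]oppr0 -[in RHS]c2 /E /F BA C0 dA /a3 /b3 /g3.
transitivity (- (- (4 + 4 * p * q + (p - q) ^+ 2) * A ^+ 2 + (p ^+ 2 - q ^+ 2) ^+ 2 + 4
  * z1 ^+ 4 * (p - q) ^+ 2 
   + 2 * (A ^+ 2 - z1 ^+ 2 * (p - q) ^+ 2))); last by ring.
by rewrite AA; ring.
Qed.

(* To be applied to the first two rows a, b of the cofactor matrix of a 3x3
   matrix with determinant d and last row z: their cross product is d z. *)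
Lemma no_orthogonal_minors (a1 a2 a3 b1 b2 b3 z1 z2 z3 d : R) :
  0 < z1 -> 0 < z2 -> 0 < z3 -> d != 0 ->
  a2 * b3 - a3 * b2 = d * z1 -> a3 * b1 - a1 * b3 = d * z2 ->
  a1 * b2 - a2 * b1 = d * z3 ->
  a1 * b2 + a2 * b1 = 0 -> a1 * b3 + a3 * b1 = 0 -> a2 * b3 + a3 * b2 = 0 -> False.
Proof.
move=> z10 z20 z30 d0 h1 h2 h3 e12 e13 e23.
have : 2 * (d ^+ 3 * (z1 * z2 * z3)) != 0.
  by rewrite mulf_neq0 ?pnatr_eq0 // mulf_neq0 ?expf_neq0 // !mulf_neq0 // gt_eqF.
have w1 : d * z1 = 2 * (a2 * b3) by rewrite -h1 -[LHS]addr0 -e23; ring.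
have w2 : d * z2 = 2 * (a3 * b1) by rewrite -h2 -[LHS]addr0 -e13; ring.
have w3 : d * z3 = 2 * (a1 * b2) by rewrite -h3 -[LHS]addr0 -e12; ring.
have v1 : d * z1 = - 2 * (a3 * b2) by rewrite -h1 -[LHS]subr0 -e23; ring.
have v2 : d * z2 = - 2 * (a1 * b3) by rewrite -h2 -[LHS]subr0 -e13; ring.
have v3 : d * z3 = - 2 * (a2 * b1) by rewrite -h3 -[LHS]subr0 -e12; ring.
(* The product of the three d z_j is 8 a1 a2 a3 b1 b2 b3 by w1, w2, w3 and its opposite by v1, v2,
   v3. *)
move/eqP; apply; transitivity ((d * z1) * (d * z2) * (d * z3) + (d * z1) * (d * z2) *
  (d * z3)).
  by ring.
by rewrite {1}w1 {1}w2 {1}w3 v1 v2 v3; ring.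
Qed.

End RectangleAlgebra.

(** * Elimination of the third p *)

Section VolumeEquation.
Local Open Scope ring_scope.
Variable R : realFieldType.

Definition det3 (x1 x2 x3 y1 y2 y3 z1 z2 z3 : R) : R :=
  x1 * (y2 * z3 - y3 * z2) + x2 * (y3 * z1 - y1 * z3) + x3 * (y1 * z2 - y2 * z1).

(** Let n be the normal to p1 and p2 whose products with the q's are s1, s2, s3. Cramer's rule reads
    d n = al p1 + be p2 + ga p3. Taking norms in ga p3 = d n - al p1 - be p2, where n is orthogonal
    to p1 and p2 and has norm 1 - a^2, gives an equation without b and c. *)
Lemma volume_equation (a b c s s1 s2 s3 x1 x2 x3 y1 y2 y3 z1 z2 z3 : R) :
  1 < a ->
  s ^+ 2 = 1 - a ^+ 2 - b ^+ 2 - c ^+ 2 + 2 * a * b * c ->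
  s * s1 = z1 * (1 - a ^+ 2) - b * x1 - c * y1 + a * (b * y1 + c * x1) ->
  s * s2 = z2 * (1 - a ^+ 2) - b * x2 - c * y2 + a * (b * y2 + c * x2) ->
  s * s3 = z3 * (1 - a ^+ 2) - b * x3 - c * y3 + a * (b * y3 + c * x3) ->
  let al := det3 s1 s2 s3 y1 y2 y3 z1 z2 z3 in
  let be := det3 x1 x2 x3 s1 s2 s3 z1 z2 z3 in
  let ga := det3 x1 x2 x3 y1 y2 y3 s1 s2 s3 in
  al ^+ 2 + be ^+ 2 - ga ^+ 2 + 2 * a * (al * be)
   + (1 - a ^+ 2) * det3 x1 x2 x3 y1 y2 y3 z1 z2 z3 ^+ 2 = 0.
Proof.
move=> a1 es e1 e2 e3 al be ga.
set d := det3 x1 x2 x3 y1 y2 y3 z1 z2 z3.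
have k0 : 1 - a ^+ 2 != 0 by rewrite subr_eq0 eq_sym gt_eqF // exprn_egt1.
set k := 1 - a ^+ 2 in k0 e1 e2 e3 es *.
have hs : s * ga = k * d.
  transitivity ((x2 * y3 - x3 * y2) * (s * s1) + (x3 * y1 - x1 * y3) * (s * s2) + (x1 *
    y2 - x2 * y1) * (s * s3)).
    by rewrite /ga /det3; ring.
  by rewrite e1 e2 e3 /d /det3; ring.
have ha : (b - a * c) * ga = - k * al.
  apply/eqP; rewrite -subr_eq0; apply/eqP.
  transitivity ((y2 * s3 - y3 * s2) * (z1 * k - b * x1 - c * y1 + a * (b * y1 + c * x1)
    - s * s1)
    * (- 1)
   + (y3 * s1 - y1 * s3) * (z2 * k - b * x2 - c * y2 + a * (b * y2 + c * x2) - s * s2)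
       * (- 1)
   + (y1 * s2 - y2 * s1) * (z3 * k - b * x3 - c * y3 + a * (b * y3 + c * x3) - s * s3)
       * (- 1)).
    by rewrite /ga /al /det3; ring.
  by rewrite e1 e2 e3; ring.
have hb : (c - a * b) * ga = - k * be.
  apply/eqP; rewrite -subr_eq0; apply/eqP.
  transitivity ((s2 * x3 - s3 * x2) * (z1 * k - b * x1 - c * y1 + a * (b * y1 + c * x1)
    - s * s1)
    * (- 1)
   + (s3 * x1 - s1 * x3) * (z2 * k - b * x2 - c * y2 + a * (b * y2 + c * x2) - s * s2)
       * (- 1)
   + (s1 * x2 - s2 * x1) * (z3 * k - b * x3 - c * y3 + a * (b * y3 + c * x3) - s * s3)
       * (- 1)).
    by rewrite /ga /be /det3; ring.
  by rewrite e1 e2 e3; ring.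
(* After multiplication by k^2 every term contains ga^2, and the remaining factor is the Gram
   determinant of p1, p2, p3. *)
apply: (mulIr0 (mulf_neq0 k0 k0)).
transitivity ((- k * al) ^+ 2 + (- k * be) ^+ 2 + 2 * a * ((- k * al) * (- k * be)) - k
  ^+ 2 * ga ^+ 2
  + k * (k * d) ^+ 2); first by ring.
rewrite -ha -hb -hs.
transitivity (k * ga ^+ 2 * (s ^+ 2 - (1 - a ^+ 2 - b ^+ 2 - c ^+ 2 + 2 * a * b * c))).
  by rewrite /k; ring.
by rewrite es; rewrite /k; ring.
Qed.

End VolumeEquation.

(** * Comparison of coefficients along the motion *)

Section RectangleFromCurve.
Local Open Scope classical_set_scope.
Local Open Scope ring_scope.
Variables (R : realType) (T : Type).
Implicit Types (I : set T).

(** Were P12 nonzero, the relations would give P0^2 = P23^2 D2 D3 if P13 is nonzero, and (P12 D1)^2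
    = P23^2 D1 D3 if P13 = 0. The zeros that [discr_poly_nonsquare] forces contradict P12 <> 0 in
    both cases. *)
Lemma radical3_coef0 (P0 P12 P13 P23 : {poly R}) (x1 x2 x3 y1 y2 y3 : R) :
  1 < x1 -> 1 < x2 -> 1 < x3 -> 1 < y1 -> 1 < y2 -> 1 < y3 ->
  let D1 := discr_poly x1 y1 in let D2 := discr_poly x2 y2 in
  let D3 := discr_poly x3 y3 in
  D2 <> D3 -> D1 <> D3 ->
  P0 * P12 + D3 * (P13 * P23) = 0 -> P0 * P13 + D2 * (P12 * P23) = 0 ->
  P0 * P23 + D1 * (P12 * P13) = 0 ->
  P0 ^+ 2 + P12 ^+ 2 * (D1 * D2) = D3 * (P13 ^+ 2 * D1 + P23 ^+ 2 * D2) ->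
  P12 = 0.
Proof.
move=> x11 x21 x31 y11 y21 y31 D1 D2 D3 D23 D13 e12 e13 e23 e.
have Dn0 (x y : R) : discr_poly x y != 0.
  apply/eqP => e0; have h u := congr1 (fun p : {poly R} => p.[u]) e0.
  by move: (h 0) (h 1) (h (-1)); rewrite /= !horner_discr_poly !horner0; lra.
apply/eqP; apply: contrapT => /negP P12n.
have P13_0 : P13 = 0.
  apply/eqP; apply: contrapT => /negP P13n.
  have h : P0 ^+ 2 = P23 ^+ 2 * (D2 * D3).
    apply: (mulIf (mulf_neq0 P12n P13n)).
    transitivity ((P0 * P12 + D3 * (P13 * P23)) * (P0 * P13) - D3 * P13 * P23 * (P0 *
      P13 + D2 * (P12 * P23)) + P23 ^+ 2 * (D2 * D3) * (P12 * P13)); first by ring.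
    by rewrite e12 e13; ring.
  have [_ P23_0] := discr_poly_nonsquare x21 y21 x31 y31 D23 h.
  move/eqP: e23; rewrite P23_0 mulr0 add0r !mulf_eq0 (negbTE P12n) (negbTE P13n).
  by rewrite !orbF (negbTE (Dn0 _ _)).
move: e12 e; rewrite P13_0 mul0r mulr0 addr0 => /eqP.
rewrite mulf_eq0 (negbTE P12n) orbF => /eqP ->.
rewrite !expr0n /= mul0r !add0r => e.
have h : (P12 * D1) ^+ 2 = P23 ^+ 2 * (D1 * D3).
  apply: (mulIf (Dn0 x2 y2)); transitivity (P12 ^+ 2 * (D1 * D2) * D1); first by
    rewrite /D2; ring.
  by rewrite e /D2; ring.
have [/eqP] := discr_poly_nonsquare x11 y11 x31 y31 D13 h.
by rewrite mulf_eq0 (negbTE P12n) (negbTE (Dn0 _ _)).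
Qed.

Definition lin_poly (u v : R) : {poly R} := u%:P + v%:P * 'X.
Lemma horner_lin_poly u v t : (lin_poly u v).[t] = u + v * t.
Proof. by rewrite /lin_poly !hornerE. Qed.
Lemma lin_poly_eq0 u v : lin_poly u v = 0 -> u = 0 /\ v = 0.
Proof.
move=> e; have := congr1 (fun p => p.[0]) e; have := congr1 (fun p => p.[1]) e.
by rewrite !horner_lin_poly !horner0 mulr0 addr0 => h1 h0; split => //; move: h1;
  rewrite h0 add0r mulr1.
Qed.

Variables (I : set T) (a b c s s1 s2 s3 : T -> R).
Variables (x1 x2 x3 y1 y2 y3 z1 z2 z3 : R).

(** The Gram determinant identities for s = vol(p1, p2, p3) and s_j = vol(p1, p2, q_j), where a, b,
    c are the products p1 p2, p1 p3, p2 p3, and x, y, z are the rows of the matrix of products with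
    the q's. *)
Definition volume_system : Prop := forall t, I t ->
  [/\ 1 < a t,
  s t ^+ 2 = 1 - a t ^+ 2 - b t ^+ 2 - c t ^+ 2 + 2 * a t * b t * c t,
  [/\ s t * s1 t = z1 * (1 - a t ^+ 2) - b t * x1 - c t * y1 + a t * (b t * y1 + c t *
    x1),
  s t * s2 t = z2 * (1 - a t ^+ 2) - b t * x2 - c t * y2 + a t * (b t * y2 + c t * x2) &
  s t * s3 t = z3 * (1 - a t ^+ 2) - b t * x3 - c t * y3 + a t * (b t * y3 + c t * x3)],
  s1 t ^+ 2 = - (discr_poly x1 y1).[a t] &
  (s2 t ^+ 2 = - (discr_poly x2 y2).[a t] /\
  s3 t ^+ 2 = - (discr_poly x3 y3).[a t])].

Hypotheses (x1_gt1 : 1 < x1) (x2_gt1 : 1 < x2) (x3_gt1 : 1 < x3).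
Hypotheses (y1_gt1 : 1 < y1) (y2_gt1 : 1 < y2) (y3_gt1 : 1 < y3).
Hypotheses (z1_gt1 : 1 < z1) (z2_gt1 : 1 < z2) (z3_gt1 : 1 < z3).
Hypothesis infa : infinite_set (a @` I).
Hypothesis vol : volume_system.
Hypothesis det_neq0 : det3 x1 x2 x3 y1 y2 y3 z1 z2 z3 != 0.

Let d := det3 x1 x2 x3 y1 y2 y3 z1 z2 z3.
(** The cofactors of the matrix, row by row: al, be, ga of [volume_equation] are the sums of a_j
    s_j, b_j s_j, g_j s_j. *)
Let a1 := y2 * z3 - y3 * z2. Let a2 := y3 * z1 - y1 * z3. Let a3 := y1 * z2 - y2 * z1.
Let b1 := z2 * x3 - z3 * x2. Let b2 := z3 * x1 - z1 * x3. Let b3 := z1 * x2 - z2 * x1.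
Let g1 := x2 * y3 - x3 * y2. Let g2 := x3 * y1 - x1 * y3. Let g3 := x1 * y2 - x2 * y1.

Let vol_eq t : I t ->
  (a1 * s1 t + a2 * s2 t + a3 * s3 t) ^+ 2 + (b1 * s1 t + b2 * s2 t + b3 * s3 t) ^+ 2
  - (g1 * s1 t + g2 * s2 t + g3 * s3 t) ^+ 2
  + 2 * a t * ((a1 * s1 t + a2 * s2 t + a3 * s3 t) * (b1 * s1 t + b2 * s2 t + b3 * s3 t))
  + (1 - a t ^+ 2) * d ^+ 2 = 0.
Proof.
move=> /vol[at1 es [e1 e2 e3] _ _].
rewrite -[RHS](volume_equation at1 es e1 e2 e3) /d /det3.
by rewrite /a1 /a2 /a3 /b1 /b2 /b3 /g1 /g2 /g3; ring.
Qed.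

(** Otherwise [radical3_coef0] kills all mixed coefficients, and their parts linear in a say that
    a_i b_j + a_j b_i = 0 for i <> j, against [no_orthogonal_minors]. *)
Lemma discr_not_all_distinct :
  discr_poly x1 y1 = discr_poly x2 y2 \/ discr_poly x1 y1 = discr_poly x3 y3 \/
  discr_poly x2 y2 = discr_poly x3 y3.
Proof.
apply: contrapT => /not_orP[D12 /not_orP[D13 D23]].
(* [L] is the coefficient of s_i s_j in [vol_eq] and [L1] that of s_i^2; in P0 the squares are
   replaced by the quadratics. *)
pose L i j k l m n := lin_poly (2 * (i * j + k * l - m * n)) (2 * (i * l + j * k)).
pose L1 i k m := lin_poly (i ^+ 2 + k ^+ 2 - m ^+ 2) (2 * (i * k)).
pose P12 := L a1 a2 b1 b2 g1 g2. pose P13 := L a1 a3 b1 b3 g1 g3.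
pose P23 := L a2 a3 b2 b3 g2 g3.
pose P0 := (1 - 'X^2) * (d ^+ 2)%:P - discr_poly x1 y1 * L1 a1 b1 g1
   - discr_poly x2 y2 * L1 a2 b2 g2 - discr_poly x3 y3 * L1 a3 b3 g3.
have s1E t : I t -> s1 t ^+ 2 = - (discr_poly x1 y1).[a t] by move=> /vol[].
have s2E t : I t -> s2 t ^+ 2 = - (discr_poly x2 y2).[a t] by move=> /vol[_ _ _ _ []].
have s3E t : I t -> s3 t ^+ 2 = - (discr_poly x3 y3).[a t] by move=> /vol[_ _ _ _ []].
have H t : I t -> P0.[a t] + P12.[a t] * (s1 t * s2 t) +
     P13.[a t] * (s1 t * s3 t) + P23.[a t] * (s2 t * s3 t) = 0.
  move=> It; rewrite /P0 /P12 /P13 /P23 /L /L1.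
  move: (s1E t It) (s2E t It) (s3E t It) (vol_eq It).
  move: (discr_poly x1 y1) (discr_poly x2 y2) (discr_poly x3 y3) => d1 d2 d3 e1 e2 e3 e.
  rewrite !(hornerD, hornerN, hornerM, horner_lin_poly, hornerC, hornerXn, hornerX).
  have -> : d1.[a t] = - s1 t ^+ 2 by rewrite e1 opprK.
  have -> : d2.[a t] = - s2 t ^+ 2 by rewrite e2 opprK.
  have -> : d3.[a t] = - s3 t ^+ 2 by rewrite e3 opprK.
  by rewrite -[RHS]e; ring.
have [f12 g12] := radical3_elim x1_gt1 x2_gt1 y1_gt1 y2_gt1 infa s1E s2E s3E D12 H.
have H' t : I t -> P0.[a t] + P13.[a t] * (s1 t * s3 t) +
     P12.[a t] * (s1 t * s2 t) + P23.[a t] * (s3 t * s2 t) = 0.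
  by move=> It; rewrite -[RHS](H t It); ring.
have [f13 g13] := radical3_elim x1_gt1 x3_gt1 y1_gt1 y3_gt1 infa s1E s3E s2E D13 H'.
have H'' t : I t -> P0.[a t] + P23.[a t] * (s2 t * s3 t) +
     P12.[a t] * (s2 t * s1 t) + P13.[a t] * (s3 t * s1 t) = 0.
  by move=> It; rewrite -[RHS](H t It); ring.
have [f23 g23] := radical3_elim x2_gt1 x3_gt1 y2_gt1 y3_gt1 infa s2E s3E s1E D23 H''.
have /lin_poly_eq0[_ /(mulIr0 (lt0r_neq0 (@ltr0n _ 2)))] : P12 = 0.
  by apply: (@radical3_coef0 P0 P12 P13 P23 x1 x2 x3 y1 y2 y3).
have /lin_poly_eq0[_ /(mulIr0 (lt0r_neq0 (@ltr0n _ 2)))] : P13 = 0.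
  apply: (@radical3_coef0 P0 P13 P12 P23 x1 x3 x2 y1 y3 y2) => //.
  by move=> h; apply: D23.
  by rewrite (mulrC P13).
have /lin_poly_eq0[_ /(mulIr0 (lt0r_neq0 (@ltr0n _ 2)))] : P23 = 0.
  apply: (@radical3_coef0 P0 P23 P12 P13 x2 x3 x1 y2 y3 y1) => //.
  by move=> h; apply: D13.
  by move=> h; apply: D12.
  by rewrite (mulrC P23).
  by rewrite (mulrC P23).
move=> h23 h13 h12.
have gt0 (u : R) : 1 < u -> 0 < u by apply: lt_trans ltr01.
apply: (@no_orthogonal_minors _ a1 a2 a3 b1 b2 b3 z1 z2 z3 d) => //; try exact: gt0.
all: by rewrite /d /det3 /a1 /a2 /a3 /b1 /b2 /b3; ring.
Qed.

Let gt0 (u : R) : 1 < u -> 0 < u. Proof. exact: lt_trans ltr01. Qed.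

(** Otherwise s1 and s3 are s2 up to sign and [vol_eq] becomes a cubic in a. Its coefficients give
    k1 = 0, then k0 = 0, then d = 0. *)
Lemma discr_not_all_equal :
  discr_poly x1 y1 = discr_poly x2 y2 -> discr_poly x2 y2 = discr_poly x3 y3 -> False.
Proof.
move=> e12 e23.
suff main J J' (e1 e3 : R) : infinite_set (a @` (I `&` J `&` J')) ->
    (forall t, (I `&` J `&` J') t -> s1 t = e1 * s2 t /\ s3 t = e3 * s2 t) -> False.
  have sgn (u v : R) : u ^+ 2 = v ^+ 2 -> u = 1 * v \/ u = - 1 * v.
    by rewrite mul1r mulN1r => /eqP; rewrite eqf_sqr => /orP[] /eqP; [left|right].
  have S1 t : I t -> s1 t = 1 * s2 t \/ s1 t = -1 * s2 t.
    by move=> /vol[_ _ _ h [h2 h3]]; apply: sgn; rewrite h h2 e12.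
  have S3 t : I t -> s3 t = 1 * s2 t \/ s3 t = -1 * s2 t.
    by move=> /vol[_ _ _ h [h2 h3]]; apply: sgn; rewrite h3 h2 e23.
  have [/infinite_image_split H|/infinite_image_split H] := infinite_image_split infa S1.
    have [t [] + _|H1|H1] := H (fun t => s3 t = 1 * s2 t) (fun t => s3 t = - 1 * s2 t).
    - exact: S3.
    - by apply: (main _ _ 1 1 H1) => t [[]].
    - by apply: (main _ _ 1 (-1) H1) => t [[]].
  have [t [] + _|H1|H1] := H (fun t => s3 t = 1 * s2 t) (fun t => s3 t = - 1 * s2 t).
  - exact: S3.
  - by apply: (main _ _ (-1) 1 H1) => t [[]].
  - by apply: (main _ _ (-1) (-1) H1) => t [[]].
move=> infJ sJ.
pose u := a1 * e1 + a2 + a3 * e3. pose v := b1 * e1 + b2 + b3 * e3.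
pose w := g1 * e1 + g2 + g3 * e3.
pose k0 := u ^+ 2 + v ^+ 2 - w ^+ 2. pose k1 := 2 * (u * v).
have [|h0 h1 h2 h3] := @cubic_infinite_roots _ _ _ _
   (- (x2 ^+ 2 + y2 ^+ 2 - 1) * k0 + d ^+ 2)
   (2 * x2 * y2 * k0 - (x2 ^+ 2 + y2 ^+ 2 - 1) * k1)
   (2 * x2 * y2 * k1 - k0 - d ^+ 2) (- k1) infJ.
  move=> t Jt; have [s1t s3t] := sJ t Jt; have [[It _] _] := Jt.
  have [_ _ _ _ [e2 _]] := vol It; rewrite horner_discr_poly in e2.
  rewrite -[RHS](vol_eq It) s1t s3t.
  transitivity (s2 t ^+ 2 * (k0 + k1 * a t) + (1 - a t ^+ 2) * d ^+ 2).
    by rewrite e2; ring.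
  by rewrite /k0 /k1 /u /v /w; ring.
have k10 : k1 = 0 by rewrite -[LHS]opprK h3 oppr0.
have d20 : d ^+ 2 != 0 by rewrite expf_neq0.
have k00 : k0 = 0.
  apply: (@mulIr0 _ (2 * x2 * y2)); last by rewrite -[RHS]h1 k10 mulr0 subr0.
  by rewrite !mulf_neq0 // gt_eqF // gt0.
by move/eqP: d20; apply; rewrite -[RHS]oppr0 -[in RHS]h2 k00 k10; ring.
Qed.

(** [discr_poly_eq] and the sign in s1 = s2 or s1 = - s2 leave four cases. Equal pairs with s1 = s2
    would give two equal columns; equal pairs with s1 = - s2 are the kite, which absorbs exchanged
    pairs with x1 = y1; the other exchanged pairs are the antiparallelogram, where p1 p2 is a side
    of the rectangle, and the parallelogram, where like in the kite it is a diagonal. *)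
Lemma rectangle_of_discr12 :
  discr_poly x1 y1 = discr_poly x2 y2 ->
  exists J : set T, [/\ J `<=` I, infinite_set (a @` J) &
    (forall t, J t -> b t = a t + c t - 1) \/ (forall t, J t -> c t = a t + b t - 1) \/
    (forall t, J t -> a t = b t + c t - 1)].
Proof.
move=> e12.
have D23 : discr_poly x2 y2 <> discr_poly x3 y3 by move/discr_not_all_equal; apply.
have s2E t : I t -> s2 t ^+ 2 = - (discr_poly x2 y2).[a t] by move=> /vol[_ _ _ _ []].
have s3E t : I t -> s3 t ^+ 2 = - (discr_poly x3 y3).[a t] by move=> /vol[_ _ _ _ []].
(* With s1 = e s2 the only radical left in [vol_eq] is s2 s3. Its coefficient V is linear in a, the
   rest U is cubic, and both vanish. *)
have main J (e : R) : infinite_set (a @` (I `&` J)) -> (forall t, J t -> s1 t = e * s2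
  t) ->
  let A := e * a1 + a2 in let B := e * b1 + b2 in let C := e * g1 + g2 in
  let E := A ^+ 2 + B ^+ 2 - C ^+ 2 in let F := a3 ^+ 2 + b3 ^+ 2 - g3 ^+ 2 in
  let n2 := x2 ^+ 2 + y2 ^+ 2 - 1 in let n3 := x3 ^+ 2 + y3 ^+ 2 - 1 in
  [/\ b3 * A + a3 * B = 0, a3 * A + b3 * B - g3 * C = 0, A * B + a3 * b3 = 0,
    x2 * y2 * E - n2 * (A * B) + x3 * y3 * F - n3 * (a3 * b3) = 0 &
    - n2 * E - n3 * F + d ^+ 2 = 0 /\
    - E + 4 * (x2 * y2) * (A * B) - F + 4 * (x3 * y3) * (a3 * b3) - d ^+ 2 = 0].
  move=> infJ s1J A B C E F n2 n3.
  pose U := (1 - 'X^2) * (d ^+ 2)%:P - discr_poly x2 y2 * lin_poly E (2 * (A * B))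
   - discr_poly x3 y3 * lin_poly F (2 * (a3 * b3)).
  pose V := lin_poly (2 * (a3 * A + b3 * B - g3 * C)) (2 * (b3 * A + a3 * B)).
  have s2J t : (I `&` J) t -> s2 t ^+ 2 = - (discr_poly x2 y2).[a t] by move=> [? _];
    apply: s2E.
  have s3J t : (I `&` J) t -> s3 t ^+ 2 = - (discr_poly x3 y3).[a t] by move=> [? _];
    apply: s3E.
  have [t IJt|U0 V0] := radical2_indep x2_gt1 x3_gt1 y2_gt1 y3_gt1 infJ s2J s3J (U :=
    U) (V := V) D23.
    have [It Jt] := IJt; rewrite /U /V.
    move: (s2J t IJt) (s3J t IJt) (vol_eq It); rewrite (s1J _ Jt).
    move: (discr_poly x2 y2) (discr_poly x3 y3) => d2 d3 h2 h3 h.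
    rewrite !(hornerD, hornerN, hornerM, horner_lin_poly, hornerC, hornerXn, hornerX).
    have -> : d2.[a t] = - s2 t ^+ 2 by rewrite h2 opprK.
    have -> : d3.[a t] = - s3 t ^+ 2 by rewrite h3 opprK.
    by rewrite -[RHS]h /E /F /A /B /C; ring.
  have [h1 h2] := lin_poly_eq0 V0.
  have two0 : (2 : R) != 0 by rewrite pnatr_eq0.
  have [|c0 c1 c2 c3] := @cubic_infinite_roots _ _ _ _
   (- n2 * E - n3 * F + d ^+ 2)
   (2 * (x2 * y2 * E - n2 * (A * B) + x3 * y3 * F - n3 * (a3 * b3)))
   (- E + 4 * (x2 * y2) * (A * B) - F + 4 * (x3 * y3) * (a3 * b3) - d ^+ 2)
   (- 2 * (A * B + a3 * b3)) infJ.
    move=> t IJt; transitivity U.[a t]; last by rewrite U0 horner0.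
    rewrite /U !(hornerD, hornerN, hornerM, horner_lin_poly, hornerC, hornerXn, hornerX).
    by rewrite /n2 /n3; ring.
  split; [exact: (mulIr0 two0 h2) | exact: (mulIr0 two0 h1) | | exact: (mulIr0 two0 c1)
    | by split].
  by apply: (mulIr0 _ c3); rewrite oppr_eq0.
have nonempty J : infinite_set (a @` J) -> exists t, J t.
  by move=> /infinite_setN0[_ [t Jt _]]; exists t.
have z12_neq : x1 = x2 -> y1 = y2 -> z1 != z2.
  move=> ex ey; apply/eqP => ez; move/eqP: det_neq0; apply.
  by rewrite /det3 ex ey ez; ring.
(* The sum of the Gram formulas for s s1 and s s2 is (x1 + x2) (1 - a) (1 + a - b - c). *)
have minus J : infinite_set (a @` (I `&` J)) -> (forall t, J t -> s1 t = - 1 * s2 t) ->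
    x1 + x2 = y1 + y2 -> z1 + z2 = x1 + x2 -> forall t, (I `&` J) t -> a t = b t + c t
      - 1.
  move=> infJ s1J exy ez t [It Jt]; have [at1 _ [h1 h2 _] _ _] := vol It.
  have at0 : (x1 + x2) * (1 - a t) != 0.
    rewrite mulf_neq0 ?subr_eq0 ?(eq_sym 1) ?(gt_eqF at1) // gt_eqF //.
    by move: (gt0 x1_gt1) (gt0 x2_gt1); lra.
  apply/eqP; rewrite -subr_eq0; apply/eqP/(mulIr0 at0).
  transitivity (s t * s1 t + s t * s2 t); last by rewrite s1J //; ring.
  rewrite h1 h2.
  transitivity ((z1 + z2) * (1 - a t ^+ 2) - b t * (x1 + x2) - c t * (y1 + y2)
     + a t * (b t * (y1 + y2) + c t * (x1 + x2))); last by ring.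
  by rewrite -exy ez; ring.
have S12 t : I t -> s1 t = 1 * s2 t \/ s1 t = -1 * s2 t.
  move=> /vol[_ _ _ h [h2 h3]].
  have /eqP : s1 t ^+ 2 = s2 t ^+ 2 by rewrite h h2 e12.
  by rewrite mul1r mulN1r eqf_sqr => /orP[] /eqP; [left|right].
have kite J : x1 = x2 -> y1 = y2 -> infinite_set (a @` (I `&` J)) ->
    (forall t, J t -> s1 t = - 1 * s2 t) -> x1 = y1 /\ z1 + z2 = 2 * x1.
  move=> ex ey infJ s1J; have [h1 h2 h3 h4 [_ h6]] := main _ _ infJ s1J.
  apply: (@kite_case _ x1 y1 x3 y3 z1 z2 z3) => //; first exact: z12_neq.
  - by rewrite -[RHS]h1 /a1 /a2 /a3 /b1 /b2 /b3 ex ey; ring.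
  - by rewrite -[RHS]h2 /a1 /a2 /a3 /b1 /b2 /b3 /g1 /g2 /g3 ex ey; ring.
  - by rewrite -[RHS]h3 /a1 /a2 /a3 /b1 /b2 /b3 /g1 /g2 /g3 ex ey; ring.
  - by rewrite -[RHS]h4 /a1 /a2 /a3 /b1 /b2 /b3 /g1 /g2 /g3 ex ey; ring.
  - move=> e; rewrite -[RHS]h6 /a1 /a2 /a3 /b1 /b2 /b3 /g1 /g2 /g3 /d /det3 -ex -ey -e.
    by ring.
have kite_plus J : x1 = x2 -> y1 = y2 -> infinite_set (a @` (I `&` J)) ->
    ~ (forall t, J t -> s1 t = 1 * s2 t).
  move=> ex ey infJ s1J; have [t [It Jt]] := nonempty _ infJ.
  have [at1 _ [h1 h2 _] _ _] := vol It.
  have at0 : 1 - a t ^+ 2 != 0 by rewrite subr_eq0 eq_sym gt_eqF // exprn_egt1.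
  move/eqP: (z12_neq ex ey); apply; apply/eqP; rewrite -subr_eq0; apply/eqP/(mulIr0 at0).
  transitivity (s t * s1 t - s t * s2 t); first by rewrite h1 h2 ex ey; ring.
  by rewrite s1J // mul1r subrr.
have [infJ|infJ] := infinite_image_split infa S12; last first.
  exists (I `&` [set t | s1 t = -1 * s2 t]); split => //; right; right.
  have [[ex ey]|[ex ey]] := discr_poly_eq x1_gt1 y1_gt1 x2_gt1 y2_gt1 e12.
    have [e ez] := kite _ ex ey infJ (fun t h => h).
    by apply: (minus _ infJ) => //; rewrite -?ex -?ey ?e //; rewrite ez e; ring.
  have [e|ne] := eqVneq x1 y1.
    have [_ ez] := kite _ (etrans e ey) (etrans (esym e) ex) infJ (fun t h => h).
    by apply: (minus _ infJ) => //; rewrite -?ey -?ex ?e //; rewrite ez e; ring.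
  apply: (minus _ infJ) => //; first by rewrite -ey -ex addrC.
  have [h1 h2 h3 h4 [h5 h6]] := main _ _ infJ (fun t h => h).
  rewrite -ey; apply: (@parallelogram_case_minus _ x1 y1 x3 y3 z1 z2 z3) => //.
  - by move: det_neq0; rewrite /det3 -ex -ey.
  - by rewrite -[RHS]h1 /a1 /a2 /a3 /b1 /b2 /b3 -ex -ey; ring.
  - by rewrite -[RHS]h2 /a1 /a2 /a3 /b1 /b2 /b3 /g1 /g2 /g3 -ex -ey; ring.
  - by rewrite -[RHS]h3 /a1 /a2 /a3 /b1 /b2 /b3 /g1 /g2 /g3 -ex -ey; ring.
  - by rewrite -[RHS]h4 /a1 /a2 /a3 /b1 /b2 /b3 /g1 /g2 /g3 -ex -ey; ring.
  - by rewrite -[RHS]h5 /d /det3 /a1 /a2 /a3 /b1 /b2 /b3 /g1 /g2 /g3 -ex -ey; ring.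
  - by rewrite -[RHS]h6 /d /det3 /a1 /a2 /a3 /b1 /b2 /b3 /g1 /g2 /g3 -ex -ey; ring.
exists (I `&` [set t | s1 t = 1 * s2 t]); split => //.
have [[ex ey]|[ex ey]] := discr_poly_eq x1_gt1 y1_gt1 x2_gt1 y2_gt1 e12.
  by have [] := kite_plus _ ex ey infJ (fun t h => h).
have [e|ne] := eqVneq x1 y1.
  by have [] := kite_plus _ (etrans e ey) (etrans (esym e) ex) infJ (fun t h => h).
have [h1 h2 _ _ _] := main _ _ infJ (fun t h => h).
have ez : (z2 - z1) ^+ 2 = (x1 - y1) ^+ 2.
  apply: (@parallelogram_case_plus _ x1 y1 x3 y3 z1 z2 z3) => //.
  - by rewrite -[RHS]h1 /a1 /a2 /a3 /b1 /b2 /b3 -ex -ey; ring.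
  - by rewrite -[RHS]h2 /a1 /a2 /a3 /b1 /b2 /b3 /g1 /g2 /g3 -ex -ey; ring.
(* The difference of the Gram formulas for s s2 and s s1 is 1 + a times the difference of the two
   sides. *)
have key t : (I `&` [set t | s1 t = 1 * s2 t]) t ->
    (z1 - z2) * (a t - 1) = (x1 - y1) * (c t - b t).
  move=> [It /= Jt]; have [at1 _ [k1 k2 _] _ _] := vol It.
  have at0 : 1 + a t != 0 by rewrite gt_eqF //; move: (gt0 at1); lra.
  apply/eqP; rewrite -subr_eq0; apply/eqP/(mulIr0 at0).
  transitivity (s t * s2 t - s t * s1 t); last by rewrite Jt; ring.
  by rewrite k1 k2 -ex -ey; ring.
have xy0 : x1 - y1 != 0 by rewrite subr_eq0.
move/eqP: ez; rewrite eqf_sqr => /orP[] /eqP ez; [left|right; left] => t /key kt.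
  apply/eqP; rewrite -subr_eq0; apply/eqP/(mulIr0 xy0).
  transitivity (- ((x1 - y1) * (a t - 1) + (x1 - y1) * (c t - b t))); first by ring.
  by rewrite -kt -ez; ring.
apply/eqP; rewrite -subr_eq0; apply/eqP/(mulIr0 xy0).
transitivity ((x1 - y1) * (c t - b t) - (x1 - y1) * (a t - 1)); first by ring.
by rewrite -kt -[x1 - y1]opprK -ez; ring.
Qed.

End RectangleFromCurve.

Section Rectangle.
Local Open Scope classical_set_scope.
Local Open Scope ring_scope.

Theorem rectangle_of_curve (R : realType) (T : Type) (I : set T)
  (a b c s s1 s2 s3 : T -> R) (x1 x2 x3 y1 y2 y3 z1 z2 z3 : R) :
  1 < x1 -> 1 < x2 -> 1 < x3 -> 1 < y1 -> 1 < y2 -> 1 < y3 ->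
  1 < z1 -> 1 < z2 -> 1 < z3 -> infinite_set (a @` I) ->
  volume_system I a b c s s1 s2 s3 x1 x2 x3 y1 y2 y3 z1 z2 z3 ->
  det3 x1 x2 x3 y1 y2 y3 z1 z2 z3 != 0 ->
  exists J : set T, [/\ J `<=` I, infinite_set (a @` J) &
    (forall t, J t -> b t = a t + c t - 1) \/ (forall t, J t -> c t = a t + b t - 1) \/
    (forall t, J t -> a t = b t + c t - 1)].
Proof.
move=> x11 x21 x31 y11 y21 y31 z11 z21 z31 infa vol d0.
have [e|[e|e]] := discr_not_all_distinct x11 x21 x31 y11 y21 y31 z11 z21 z31 infa vol d0.
- exact: (rectangle_of_discr12 x11 x21 x31 y11 y21 y31 z11 z21 z31 infa vol d0 e).
- apply: (@rectangle_of_discr12 R T I a b c s s1 s3 s2 x1 x3 x2 y1 y3 y2 z1 z3 z2) => //.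
    by move=> t It; have [? ? [? ? ?] ? [? ?]] := vol t It; do ![split].
  by apply: contra d0 => /eqP d0; rewrite -oppr_eq0 -d0 /det3; apply/eqP; ring.
- apply: (@rectangle_of_discr12 R T I a b c s s2 s3 s1 x2 x3 x1 y2 y3 y1 z2 z3 z1) => //.
    by move=> t It; have [? ? [? ? ?] ? [? ?]] := vol t It; do ![split].
  by apply: contra d0 => /eqP d0; rewrite -d0 /det3; apply/eqP; ring.
Qed.

End Rectangle.

(** * The curve of the second Dixon flex *)

Section DixonCurve.
Local Open Scope classical_set_scope.
Local Open Scope ring_scope.

Lemma infinite_image_fiber (T U V : Type) (I : set T) (f : T -> U) (g : T -> V) :
  infinite_set (f @` I) -> finite_set (g @` I) ->
  exists v, infinite_set (f @` (I `&` [set t | g t = v])).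
Proof.
move=> inff fing; apply: contrapT => /forallNP H; apply: inff.
apply: (@sub_finite_set _ _ (\bigcup_(v in g @` I) (f @` (I `&` [set t | g t = v])))).
  by move=> _ [t It <-]; exists (g t); [exists t | exists t].
by apply: bigcup_finite => // v _; apply: contrapT.
Qed.

Variables (R : realType) (T : Type) (I : set T) (X Y : T -> R).
Hypothesis X_gt0 : forall t, I t -> 0 < X t.
Hypothesis Y_gt0 : forall t, I t -> 0 < Y t.

(* The positions of the rectangles carrying the p's along the second Dixon
   flex: half axes sqrt X, sqrt Y, in terms of the squares u, v, w of the
   products of one of the q's with the axes. *)
Definition on_dixon_curve (u v w : R) := forall t, I t ->
  u * Y t * (1 + X t + Y t) + v * X t * (1 + X t + Y t) + X t * Y t * (1 + X t + Y t)
  = w * (X t * Y t).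

(** On a ray Y = m X the curve is quadratic in X. A second relation, linear in X, then allows X to
    be eliminated, leaving a cubic in m. *)
Let slope t := Y t / X t.

Let slope_gt0 t : I t -> 0 < slope t.
Proof. by move=> It; rewrite divr_gt0 ?X_gt0 ?Y_gt0. Qed.

Let YE t : I t -> Y t = slope t * X t.
Proof. by move=> It; rewrite /slope divfK // gt_eqF // X_gt0. Qed.

Lemma dixon_slope u v w t : on_dixon_curve u v w -> I t ->
  (u * slope t + v) * (1 + (1 + slope t) * X t) + slope t * X t * (1 + (1 + slope t) *
    X t)
   = w * slope t * X t.
Proof.
move=> /[swap] It /(_ t It); rewrite (YE It) => h.
have X0 := lt0r_neq0 (X_gt0 It).
apply/eqP; rewrite -subr_eq0; apply/eqP/(mulIr0 X0).
by move/eqP: h; rewrite -subr_eq0 => /eqP h; rewrite -[RHS]h; ring.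
Qed.

(** A ray of slope m > 0 meets the curve in at most two points, the leading coefficient in X being m
    (1 + m). *)
Lemma slope_infinite u v w : 0 <= u -> 0 <= v -> on_dixon_curve u v w ->
  infinite_set ((fun t => (X t, Y t)) @` I) -> infinite_set (slope @` I).
Proof.
move=> u0 v0 H infXY fins; have [m infJ] := infinite_image_fiber infXY fins.
set J := I `&` _ in infJ.
have infX : infinite_set (X @` J).
  move=> finX; apply: infJ; apply: (@sub_finite_set _ _ ((fun x => (x, m * x)) @` (X @`
    J))).
    move=> _ [t Jt <-]; have [It /= st] := Jt; exists (X t); first by exists t.
    by rewrite (YE It) st.
  exact: finite_image.
have [_ [t0 [It0 /= st0] _]] := infinite_setN0 infX.
have m0 : 0 < m by rewrite -st0 slope_gt0.
have [|_ _ h2 _] := @cubic_infinite_roots _ _ _ _ (u * m + v)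
  ((u * m + v) * (1 + m) + m - w * m) (m * (1 + m)) 0 infX.
  move=> t [It /= st]; have := dixon_slope H It; rewrite st => /eqP; rewrite -subr_eq0
    => /eqP h.
  by rewrite -[RHS]h; ring.
have : 0 < m * (1 + m) by rewrite mulr_gt0 // addr_gt0.
by rewrite h2 ltxx.
Qed.

Hypothesis infXY : infinite_set ((fun t => (X t, Y t)) @` I).

Let It_ex : exists t, I t.
Proof. by have [_ [t It _]] := infinite_setN0 infXY; exists t. Qed.

(** The curve is u / X + v / Y + 1 = w / (1 + X + Y). For v = 1, u = w it contains the line Y = -1,
    for u = 1, v = w the line X = -1. These reducible curves would escape the comparison of
    coefficients, but have no point with X, Y > 0. *)
Lemma dixon_curve_gt u v w t : 0 <= u -> 0 <= v -> on_dixon_curve u v w -> I t ->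
  [/\ 0 < w, v = 1 -> u = w -> False & u = 1 -> v = w -> False].
Proof.
move=> u0 v0 H It; have h := H t It; have X0 := X_gt0 It; have Y0 := Y_gt0 It.
have XY0 : 0 < X t * Y t by rewrite mulr_gt0.
have XYZ0 : 0 < X t * Y t * (1 + X t + Y t) by rewrite mulr_gt0 // !addr_gt0.
have uY0 : 0 <= u * Y t * (1 + X t + Y t).
  by apply: mulr_ge0; [apply: mulr_ge0; lra | lra].
have vX0 : 0 <= v * X t * (1 + X t + Y t).
  by apply: mulr_ge0; [apply: mulr_ge0; lra | lra].
split.
- rewrite -(pmulr_lgt0 _ XY0) -h; lra.
- move=> v1 uw; subst v w; move: h.
  have : 0 <= u * Y t * (1 + Y t) by apply: mulr_ge0; [apply: mulr_ge0; lra | lra].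
  nra.
- move=> v1 uw; subst u w; move: h.
  have : 0 <= v * X t * (1 + X t) by apply: mulr_ge0; [apply: mulr_ge0; lra | lra].
  nra.
Qed.

(** For given m the difference of the two equations is linear in X. Eliminating X yields a cubic in
    m that vanishes infinitely often; if a parameter differs, its coefficients lead to a case
    excluded by [dixon_curve_gt]. *)
Lemma dixon_curve_inj u v w u' v' w' :
  0 <= u -> 0 <= v -> on_dixon_curve u v w -> on_dixon_curve u' v' w' ->
  [/\ u' = u, v' = v & w' = w].
Proof.
move=> u0 v0 H H'; have infs := slope_infinite u0 v0 H infXY.
have [t0 It0] := It_ex; have [w0 nvu nuv] := dixon_curve_gt u0 v0 H It0.
pose U := u' - u; pose V := v' - v; pose W := w' - w.
suff [U0 V0 W0] : [/\ U = 0, V = 0 & W = 0].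
  by split; apply/eqP; rewrite -subr_eq0 -/U -/V -/W ?U0 ?V0 ?W0.
have line t : I t -> (U * slope t + V) * (1 + (1 + slope t) * X t) = W * slope t * X t.
  move=> It; have h := dixon_slope H It; have h' := dixon_slope H' It.
  transitivity (w' * slope t * X t - w * slope t * X t); last by rewrite /W; ring.
  by rewrite -h -h' /U /V; ring.
(* The difference of the equations reads e X = k with e and k as below. Multiplied by e^2, the curve
   becomes m times a cubic in m; [al] and [be] abbreviate its coefficients. *)
pose al := u * W - w * U; pose be := v * W - w * V.
have [|h0 h1 h2 h3] := @cubic_infinite_roots _ _ _ _
  (- (be * V)) (- (al * V) + be * (W - U - V) + W * V)
  (al * (W - U - V) - be * U + W * U) (- (al * U)) infs.
  move=> t It; have h := dixon_slope H It; have l := line t It.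
  have m0 := lt0r_neq0 (slope_gt0 It).
  set m := slope t in h l m0 *; pose k := U * m + V; pose e := W * m - (1 + m) * k.
  have eX : e * X t = k.
    move/eqP: l; rewrite -subr_eq0 => /eqP l; apply/eqP; rewrite -subr_eq0; apply/eqP.
    by rewrite -[RHS]oppr0 -[in RHS]l /e /k; ring.
  apply: (mulIr0 m0).
  transitivity ((u * m + v) * W * m * e + m * k * W * m - w * m * k * e).
    by rewrite /al /be /e /k; ring.
  move/eqP: h; rewrite -subr_eq0 => /eqP h.
  have eZ : e * (1 + (1 + m) * X t) = W * m.
    transitivity (e + (1 + m) * (e * X t)); first by ring.
    by rewrite eX /e; ring.
  rewrite -[RHS](mulr0 (e ^+ 2)) -[in RHS]h.
  transitivity ((u * m + v) * (e * (1 + (1 + m) * X t)) * e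
    + m * (e * X t) * (e * (1 + (1 + m) * X t)) - w * m * (e * X t) * e); last by ring.
  by rewrite eX eZ; ring.
have [U0|Un] := eqVneq U 0; have [V0|Vn] := eqVneq V 0.
- split=> //; have := line _ It0; rewrite U0 V0 mul0r add0r mul0r => /esym/eqP.
  by rewrite -mulrA mulf_eq0 => /orP[/eqP //|]; rewrite mulf_eq0 !gt_eqF ?slope_gt0
    ?X_gt0.
- exfalso; have be0 : be = 0.
    by apply: (mulIr0 Vn); rewrite -[RHS]oppr0 -[in RHS]h0; ring.
  have alW : al = W.
    apply/eqP; rewrite -subr_eq0; apply/eqP/(mulIr0 Vn).
    by rewrite -[RHS]oppr0 -[in RHS]h1 be0; ring.
  have WV : W * (W - V) = 0 by rewrite -[RHS]h2 be0 alW U0; ring.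
  move: alW be0; rewrite /al /be U0 mulr0 subr0 => alW be0.
  have W0 : W != 0.
    apply/eqP => W0; move: be0; rewrite W0 mulr0 sub0r => /eqP.
    by rewrite oppr_eq0 mulf_eq0 (negbTE Vn) gt_eqF.
  have eWV : W = V by apply/eqP; rewrite -subr_eq0; apply/eqP/(mulIr0 W0).
  apply: nuv; apply/eqP; rewrite -subr_eq0; apply/eqP; apply: (mulIr0 W0).
    by rewrite mulrBr mulr1 mulrC alW subrr.
  by rewrite -[RHS]be0 -eWV; ring.
- exfalso; have al0 : al = 0.
    by apply: (mulIr0 Un); rewrite -[RHS]oppr0 -[in RHS]h3; ring.
  have beW : be = W.
    apply/eqP; rewrite -subr_eq0; apply/eqP/(mulIr0 Un).
    by rewrite -[RHS]oppr0 -[in RHS]h2 al0; ring.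
  have WV : W * (W - U) = 0 by rewrite -[RHS]h1 al0 beW V0; ring.
  move: beW al0; rewrite /al /be V0 mulr0 subr0 => beW al0.
  have W0 : W != 0.
    apply/eqP => W0; move: al0; rewrite W0 mulr0 sub0r => /eqP.
    by rewrite oppr_eq0 mulf_eq0 (negbTE Un) gt_eqF.
  have eWV : W = U by apply/eqP; rewrite -subr_eq0; apply/eqP/(mulIr0 W0).
  apply: nvu; apply/eqP; rewrite -subr_eq0; apply/eqP; apply: (mulIr0 W0).
    by rewrite mulrBr mulr1 mulrC beW subrr.
  by rewrite -[RHS]al0 -eWV; ring.
- exfalso; have al0 : al = 0.
    by apply: (mulIr0 Un); rewrite -[RHS]oppr0 -[in RHS]h3; ring.
  have be0 : be = 0.
    by apply: (mulIr0 Vn); rewrite -[RHS]oppr0 -[in RHS]h0; ring.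
  have W0 : W = 0 by apply: (mulIr0 Vn); rewrite -[RHS]h1 al0 be0; ring.
  move: al0; rewrite /al W0 mulr0 sub0r => /eqP.
  by rewrite oppr_eq0 mulf_eq0 (negbTE Un) gt_eqF.
Qed.

(** If the linear relation is not trivial, substituting X = - l0 / (l1 + l2 m) into the curve gives
    a cubic in m whose coefficients cannot all vanish, again by [dixon_curve_gt]. *)
Lemma dixon_curve_not_line u v w A B G : 0 < u -> 0 < v -> on_dixon_curve u v w ->
  (forall t, I t -> A * X t + B * Y t + 1 = G * (1 + X t + Y t)) ->
  [/\ A = 1, B = 1 & G = 1].
Proof.
move=> u0 v0 H L; have infs := slope_infinite (ltW u0) (ltW v0) H infXY.
have [t0 It0] := It_ex; have [w0 nvu nuv] := dixon_curve_gt (ltW u0) (ltW v0) H It0.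
pose l1 := A - G; pose l2 := B - G; pose l0 := 1 - G.
suff [e1 e2 e0] : [/\ l1 = 0, l2 = 0 & l0 = 0].
  by move: e1 e2 e0; rewrite /l1 /l2 /l0; split; lra.
have line t : I t -> (l1 + l2 * slope t) * X t = - l0.
  move=> It; have := L t It; rewrite (YE It) => /eqP; rewrite -subr_eq0 => /eqP h.
  by apply/eqP; rewrite -subr_eq0; apply/eqP; rewrite -[RHS]h /l1 /l2 /l0; ring.
have [|h0 h1 h2 h3] := @cubic_infinite_roots _ _ _ _
  (v * (l1 * (l1 - l0)))
  (u * (l1 * (l1 - l0)) + v * (2 * l1 * l2 - l0 * l2 - l0 * l1) - l0 * l1 + l0 ^+ 2 + w
    * l0 * l1)
  (u * (2 * l1 * l2 - l0 * l2 - l0 * l1) + v * (l2 * (l2 - l0)) - l0 * l2 + l0 ^+ 2 + w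
    * l0 * l2)
  (u * (l2 * (l2 - l0))) infs.
  move=> t It; have h := dixon_slope H It; have kX := line t It.
  set m := slope t in h kX *; set k := l1 + l2 * m in kX.
  move/eqP: h; rewrite -subr_eq0 => /eqP h.
  rewrite -[RHS](mulr0 (k ^+ 2)) -[in RHS]h.
  transitivity ((u * m + v) * (k ^+ 2 + (1 + m) * k * (k * X t))
    + m * (k * X t) * (k + (1 + m) * (k * X t)) - w * m * k * (k * X t)); last by ring.
  by rewrite kX /k; ring.
have {}h0 := mulIr0 (lt0r_neq0 v0) h0; have {}h3 := mulIr0 (lt0r_neq0 u0) h3.
have [l10|l1n] := eqVneq l1 0; have [l20|l2n] := eqVneq l2 0.
- split=> //; apply/eqP; rewrite -sqrf_eq0; apply/eqP; rewrite -[RHS]h1 l10 l20; ring.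
- exfalso; have e := mulIr0 l2n h3; have {}e : l0 = l2 by lra.
  apply: nvu; apply/eqP; rewrite -subr_eq0; apply/eqP/(mulIr0 (expf_neq0 2 l2n)).
    by rewrite -[RHS]oppr0 -[in RHS]h1 e l10; ring.
  by rewrite -[RHS]oppr0 -[in RHS]h2 e l10; ring.
- exfalso; have e := mulIr0 l1n h0; have {}e : l0 = l1 by lra.
  apply: nuv; apply/eqP; rewrite -subr_eq0; apply/eqP/(mulIr0 (expf_neq0 2 l1n)).
    by rewrite -[RHS]oppr0 -[in RHS]h2 e l20; ring.
  by rewrite -[RHS]oppr0 -[in RHS]h1 e l20; ring.
- exfalso; have e := mulIr0 l2n h3; have {}e : l0 = l2 by lra.
  have e' := mulIr0 l1n h0; have {}e' : l1 = l2 by lra.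
  have : w * l2 ^+ 2 = 0 by rewrite -[RHS]h1 e e'; ring.
  by move/eqP; rewrite mulf_eq0 sqrf_eq0 (negbTE l2n) gt_eqF.
Qed.

End DixonCurve.

(** * Lorentz space and the hyperboloid *)

Section LorentzSpace.
Local Open Scope classical_set_scope.
Local Open Scope ring_scope.
Variable R : realType.
Implicit Types (u v w : 'rV[R]_3) (x y : hplane R).

Lemma row3P u v : u 0 0 = v 0 0 -> u 0 1 = v 0 1 -> u 0 2%:R = v 0 2%:R -> u = v.
Proof.
move=> h0 h1 h2; apply/rowP => -[[|[|[|//]]] lt_i]; rewrite ?(ord1 0).
- by rewrite (_ : Ordinal lt_i = 0) //; apply: val_inj.
- by rewrite (_ : Ordinal lt_i = 1) //; apply: val_inj.
- by rewrite (_ : Ordinal lt_i = 2%:R) //; apply: val_inj.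
Qed.

(** The opposite of the Lorentz form: points of the plane get norm 1 and product cosh of their
    distance, unit tangent vectors norm -1. *)
Definition hdot u v : R := - lorentz u v.

Definition vol u v w : R :=
  det3 (u 0 0) (u 0 1) (u 0 2%:R) (v 0 0) (v 0 1) (v 0 2%:R) (w 0 0) (w 0 1) (w 0 2%:R).

(** The Lorentzian cross product. Its last entry has the opposite of the Euclidean sign, which makes
    it orthogonal to u and v for [hdot]. *)
Definition crossv u v : 'rV[R]_3 := \row_(i < 3)
  if i == 0 then u 0 1 * v 0 2%:R - u 0 2%:R * v 0 1
  else if i == 1 then u 0 2%:R * v 0 0 - u 0 0 * v 0 2%:R
  else u 0 1 * v 0 0 - u 0 0 * v 0 1.

Lemma hdotC u v : hdot u v = hdot v u.
Proof. by rewrite /hdot /lorentz; ring. Qed.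
Lemma hdotDl u v w : hdot (u + v) w = hdot u w + hdot v w.
Proof. by rewrite /hdot /lorentz !mxE; ring. Qed.
Lemma hdotZl (k : R) u w : hdot (k *: u) w = k * hdot u w.
Proof. by rewrite /hdot /lorentz !mxE; ring. Qed.
Lemma hdotNl u w : hdot (- u) w = - hdot u w.
Proof. by rewrite /hdot /lorentz !mxE; ring. Qed.
Lemma hdotDr u v w : hdot w (u + v) = hdot w u + hdot w v.
Proof. by rewrite !(hdotC w) hdotDl. Qed.
Lemma hdotZr (k : R) u w : hdot w (k *: u) = k * hdot w u.
Proof. by rewrite !(hdotC w) hdotZl. Qed.
Lemma hdotNr u w : hdot w (- u) = - hdot w u.
Proof. by rewrite !(hdotC w) hdotNl. Qed.

Definition hdotE := (hdotDl, hdotDr, hdotZl, hdotZr, hdotNl, hdotNr).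

Lemma hdot_crossv u v w : hdot (crossv u v) w = - vol u v w.
Proof. by rewrite /hdot /lorentz /vol /det3 !mxE /=; ring. Qed.

(** The matrix of [hdot] is diag (-1, -1, 1), of determinant 1, so the Gram determinant carries no
    sign. *)
Lemma vol_mul u1 u2 u3 v1 v2 v3 :
  vol u1 u2 u3 * vol v1 v2 v3 =
  det3 (hdot u1 v1) (hdot u1 v2) (hdot u1 v3) (hdot u2 v1) (hdot u2 v2) (hdot u2 v3)
    (hdot u3 v1) (hdot u3 v2) (hdot u3 v3).
Proof. by rewrite /vol /det3 /hdot /lorentz; ring. Qed.

Lemma vol_cramer u1 u2 u3 w :
  vol u1 u2 u3 *: w = vol w u2 u3 *: u1 + vol u1 w u3 *: u2 + vol u1 u2 w *: u3.
Proof. by apply: row3P; rewrite !mxE /vol /det3; ring. Qed.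

Lemma vol_eq0_dep u1 u2 u3 w : vol u1 u2 u3 != 0 ->
  hdot w u1 = 0 -> hdot w u2 = 0 -> hdot w u3 = 0 -> w = 0.
Proof.
move=> v0 h1 h2 h3.
have hw z : hdot w z = 0.
  apply: (mulIr0 v0); rewrite -hdotZr (vol_cramer u1 u2 u3 z) !hdotE h1 h2 h3; ring.
apply: row3P; rewrite !mxE.
- by have := hw (delta_mx 0 0); rewrite /hdot /lorentz !mxE /=; lra.
- by have := hw (delta_mx 0 1); rewrite /hdot /lorentz !mxE /=; lra.
- by have := hw (delta_mx 0 2%:R); rewrite /hdot /lorentz !mxE /=; lra.
Qed.

Lemma vol_inj u1 u2 u3 w w' : vol u1 u2 u3 != 0 ->
  hdot w u1 = hdot w' u1 -> hdot w u2 = hdot w' u2 -> hdot w u3 = hdot w' u3 -> w = w'.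
Proof.
move=> v0 h1 h2 h3; apply/eqP; rewrite -subr_eq0; apply/eqP.
by apply: (vol_eq0_dep v0); rewrite !hdotE ?h1 ?h2 ?h3 subrr.
Qed.

Lemma hdot_gram u1 u2 u3 v w : vol u1 u2 u3 ^+ 2 * hdot v w =
  vol v u2 u3 * vol u1 u2 u3 * hdot u1 w + vol u1 v u3 * vol u1 u2 u3 * hdot u2 w
   + vol u1 u2 v * vol u1 u2 u3 * hdot u3 w.
Proof.
transitivity (vol u1 u2 u3 * hdot (vol u1 u2 u3 *: v) w); first by rewrite hdotZl; ring.
by rewrite vol_cramer !hdotE; ring.
Qed.

(** By [hdot_gram] and [vol_mul], the product of v and w is a rational function of their products
    with three independent vectors and of the products among these. *)
Lemma eq_gram u1 u2 u3 v w u1' u2' u3' v' w' :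
  vol u1 u2 u3 != 0 ->
  hdot u1 u1 = hdot u1' u1' -> hdot u2 u2 = hdot u2' u2' -> hdot u3 u3 = hdot u3' u3' ->
  hdot u1 u2 = hdot u1' u2' -> hdot u1 u3 = hdot u1' u3' -> hdot u2 u3 = hdot u2' u3' ->
  hdot u1 v = hdot u1' v' -> hdot u2 v = hdot u2' v' -> hdot u3 v = hdot u3' v' ->
  hdot u1 w = hdot u1' w' -> hdot u2 w = hdot u2' w' -> hdot u3 w = hdot u3' w' ->
  hdot v w = hdot v' w'.
Proof.
move=> v0 h11 h22 h33 h12 h13 h23 v1 v2 v3 w1 w2 w3.
have sq : vol u1 u2 u3 ^+ 2 = vol u1' u2' u3' ^+ 2.
  by rewrite !expr2 !vol_mul !(hdotC u2 u1, hdotC u3 u1, hdotC u3 u2, hdotC u2' u1',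
    hdotC u3' u1', hdotC u3' u2') h11 h22 h33 h12 h13 h23.
apply/eqP; rewrite -subr_eq0; apply/eqP; apply: (mulIr0 (expf_neq0 2 v0)).
rewrite mulrBr {2}sq !hdot_gram !vol_mul.
rewrite !(hdotC u2 u1, hdotC u3 u1, hdotC u3 u2, hdotC u2' u1', hdotC u3' u1', hdotC
  u3' u2').
rewrite !(hdotC v u1, hdotC v u2, hdotC v u3, hdotC v' u1', hdotC v' u2', hdotC v' u3').
by rewrite h11 h22 h33 h12 h13 h23 v1 v2 v3 w1 w2 w3 subrr.
Qed.

Section OrthogonalFrame.
Variables (E1 E2 O : 'rV[R]_3) (X Y Z : R).
Hypotheses (X0 : X != 0) (Y0 : Y != 0) (Z0 : Z != 0).
Hypotheses (h11 : hdot E1 E1 = - X) (h22 : hdot E2 E2 = - Y) (h33 : hdot O O = Z).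
Hypotheses (h12 : hdot E1 E2 = 0) (h13 : hdot E1 O = 0) (h23 : hdot E2 O = 0).

Lemma frame_vol : vol E1 E2 O != 0.
Proof.
rewrite -sqrf_eq0 expr2 vol_mul !(hdotC E2 E1) !(hdotC O) h11 h22 h33 h12 h13 h23 /det3.
rewrite (_ : _ + _ = X * Y * Z) ?mulf_neq0 //; ring.
Qed.

Lemma frame_expand u :
  u = - (hdot u E1 / X) *: E1 - (hdot u E2 / Y) *: E2 + (hdot u O / Z) *: O.
Proof.
apply: (vol_inj frame_vol); rewrite !hdotE ?(hdotC E2 E1) ?(hdotC O) ?h11 ?h22 ?h33
  ?h12 ?h13 ?h23.
all: by field; rewrite ?X0 ?Y0 ?Z0.
Qed.

(** The axes are not normalized: along a motion of rectangles X, Y, Z vary, and in this form they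
    enter rationally. *)
Lemma frame_hdot u v : hdot u v =
  - (hdot u E1 * hdot v E1 / X) - hdot u E2 * hdot v E2 / Y + hdot u O * hdot v O / Z.
Proof. by rewrite [u in LHS]frame_expand !hdotE !(hdotC _ v); field; rewrite ?X0 ?Y0
  ?Z0. Qed.

End OrthogonalFrame.

Lemma hdotxx x : hdot x x = 1.
Proof. by case: x => v /= /andP[/eqP h _]; rewrite /hdot h opprK. Qed.

Lemma hplane_gt0 x : 0 < hval x 0 2%:R.
Proof. by case: x => v /= /andP[_ ]. Qed.

Lemma hval_inj : injective (@hval R).
Proof. exact: val_inj. Qed.

(* On the upper sheet, (x2 y2)^2 - (1 + x0 y0 + x1 y1)^2 =
   |x' - y'|^2 + (x0 y1 - x1 y0)^2 for the spatial parts x', y'. *)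
Lemma hdot_ge1_eq x y : 1 <= hdot x y /\ (hdot x y = 1 -> x = y).
Proof.
have := hdotxx x; have := hdotxx y; have := hplane_gt0 x; have := hplane_gt0 y.
move: (@hval_inj x y); case: x => u pu; case: y => v pv /= inj.
rewrite /hdot /lorentz; set u0 := u 0 0; set u1 := u 0 1; set u2 := u 0 2%:R.
set v0 := v 0 0; set v1 := v 0 1; set v2 := v 0 2%:R => v2p u2p hv hu.
have e : (u2 * v2) ^+ 2 = (1 + u0 * v0 + u1 * v1) ^+ 2 + ((u0 - v0) ^+ 2 + (u1 - v1) ^+
  2 + (u0 * v1 - u1 * v0) ^+ 2).
  have hu2 : u2 ^+ 2 = 1 + u0 ^+ 2 + u1 ^+ 2 by lra.
  have hv2 : v2 ^+ 2 = 1 + v0 ^+ 2 + v1 ^+ 2 by lra.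
  by rewrite exprMn hu2 hv2; ring.
have p0 : 0 < u2 * v2 by rewrite mulr_gt0.
set r := (u0 - v0) ^+ 2 + _ + _ in e; have r0 : 0 <= r.
  by rewrite /r; do ![apply: addr_ge0]; rewrite ?sqr_ge0.
have le : 1 + u0 * v0 + u1 * v1 <= u2 * v2.
  rewrite leNgt; apply/negP => lt.
  have : (u2 * v2) ^+ 2 < (1 + u0 * v0 + u1 * v1) ^+ 2.
    by rewrite !expr2 ltr_pM // ltW.
  by rewrite e; lra.
split; first by lra.
move=> h; have eq1 : u2 * v2 = 1 + u0 * v0 + u1 * v1 by lra.
have r00 : r = 0 by move: e; rewrite eq1; lra.
have [z1 z2] : (u0 - v0) ^+ 2 = 0 /\ (u1 - v1) ^+ 2 = 0.
  move: r00; rewrite /r; have := sqr_ge0 (u0 - v0); have := sqr_ge0 (u1 - v1).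
  by have := sqr_ge0 (u0 * v1 - u1 * v0); split; lra.
have d0 : u0 = v0 by apply/eqP; rewrite -subr_eq0 -sqrf_eq0 z1.
have d1 : u1 = v1 by apply/eqP; rewrite -subr_eq0 -sqrf_eq0 z2.
apply: inj; apply: row3P => //; apply: sqr_eq_pos => //.
by rewrite -/u2 -/v2; move: hu hv; rewrite d0 d1; lra.
Qed.

Lemma hdot_ge1 x y : 1 <= hdot x y. Proof. by case: (hdot_ge1_eq x y). Qed.
Lemma hdot_eq1 x y : hdot x y = 1 -> x = y. Proof. by case: (hdot_ge1_eq x y). Qed.
Lemma hdot_gt1 x y : x <> y -> 1 < hdot x y.
Proof.
by move=> xy; rewrite lt_neqAle hdot_ge1 andbT eq_sym; apply/eqP => /hdot_eq1.
Qed.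

Lemma arcosh_inj (c c' : R) : 1 <= c -> 1 <= c' -> arcosh c = arcosh c' -> c = c'.
Proof.
have lt (d d' : R) : 1 <= d -> d < d' -> arcosh d < arcosh d'.
  move=> d1 dd'; have d0 : 0 < d by apply: lt_le_trans d1.
  have sq0 (e : R) : 0 <= Num.sqrt (e ^+ 2 - 1) by rewrite sqrtr_ge0.
  have d'0 := lt_trans d0 dd'.
  rewrite /arcosh ltr_ln ?posrE; last 2 first.
  - by rewrite ltr_pwDl.
  - by rewrite ltr_pwDl.
  apply: ltr_leD => //; rewrite ler_wsqrtr // lerD2r.
  by rewrite !expr2 ler_pM // ltW.
move=> c1 c1' e; have [h|h|//] := ltgtP c c'.
- by have := lt _ _ c1 h; rewrite e ltxx.
- by have := lt _ _ c1' h; rewrite e ltxx.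
Qed.

Lemma dH_hdot x y x' y' : dH x y = dH x' y' <-> hdot x y = hdot x' y'.
Proof.
rewrite /dH -!/(hdot _ _); split; last by move=> ->.
by apply: arcosh_inj; apply: hdot_ge1.
Qed.

(** On the lower sheet - u would be a point of the plane, with product at least 1 with y. *)
Lemma upper_sheet u y : hdot u u = 1 -> 0 < hdot u y ->
  (lorentz u u == -1) && (0 < u 0 2%:R).
Proof.
move=> uu uy; apply/andP; split; first by rewrite -[lorentz u u]opprK -/(hdot u u) uu.
rewrite ltNge; apply/negP => u2.
have pu : (lorentz (- u) (- u) == -1) && (0 < (- u) 0 2%:R).
  rewrite -[lorentz _ _]opprK -/(hdot _ _) !hdotE opprK uu eqxx /= mxE oppr_gt0.
  rewrite lt_neqAle u2 andbT; apply/eqP => u20.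
  by move: uu; rewrite /hdot /lorentz u20; nra.
by have := hdot_ge1 (HPlane pu) y; rewrite /= hdotNl; lra.
Qed.

End LorentzSpace.

(** * Orthonormal frames, lines and reflections *)

Section Frames.
Local Open Scope classical_set_scope.
Local Open Scope ring_scope.
Variable R : realType.
Implicit Types (u v w : 'rV[R]_3) (x y o : hplane R).

Definition orthoframe o v w :=
  [/\ unit_tangent o v, unit_tangent o w & lorentz v w = 0].

Lemma orthoframeE o v w : orthoframe o v w <->
  [/\ hdot v v = - 1, hdot w w = - 1, hdot v w = 0, hdot v o = 0 & hdot w o = 0].
Proof.
rewrite /orthoframe /unit_tangent; split.
  move=> [[h1 h2] [h3 h4] h5]; rewrite !(hdotC _ o) /hdot h1 h2 h3 h4 h5.
  by rewrite oppr0.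
rewrite !(hdotC _ o) /hdot => -[h1 h2 h3 h4 h5].
by do ![split] => //; lra.
Qed.

Lemma orthoframe_sym o v w : orthoframe o v w -> orthoframe o w v.
Proof. by move=> /orthoframeE[? ? ? ? ?]; apply/orthoframeE; rewrite (hdotC w v). Qed.

Section Coordinates.
Variables (o : hplane R) (v w : 'rV[R]_3).
Hypothesis fr : orthoframe o v w.

Lemma orthoframe_vol : vol v w o != 0.
Proof.
have /orthoframeE[h1 h2 h3 h4 h5] := fr.
exact: (frame_vol (oner_neq0 R) (oner_neq0 R) (oner_neq0 R) h1 h2 (hdotxx o) h3 h4 h5).
Qed.

Lemma orthoframe_expand u : u = - hdot u v *: v - hdot u w *: w + hdot u o *: hval o.
Proof.
have /orthoframeE[h1 h2 h3 h4 h5] := fr.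
rewrite {1}[u](frame_expand (oner_neq0 R) (oner_neq0 R) (oner_neq0 R) h1 h2 (hdotxx o)
  h3 h4 h5).
by rewrite !divr1.
Qed.

Lemma orthoframe_hdot u u' :
  hdot u u' = - (hdot u v * hdot u' v) - hdot u w * hdot u' w + hdot u o * hdot u' o.
Proof.
have /orthoframeE[h1 h2 h3 h4 h5] := fr.
rewrite (frame_hdot (oner_neq0 R) (oner_neq0 R) (oner_neq0 R) h1 h2 (hdotxx o) h3 h4 h5).
by rewrite !divr1.
Qed.

Lemma orthoframe_inj u u' : hdot u v = hdot u' v -> hdot u w = hdot u' w ->
  hdot u o = hdot u' o -> u = u'.
Proof. exact: vol_inj orthoframe_vol. Qed.

Definition lincomb (a b c : R) := a *: v + b *: w + c *: hval o.

Lemma hdot_lincomb a b c : [/\ hdot (lincomb a b c) v = - a,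
  hdot (lincomb a b c) w = - b & hdot (lincomb a b c) o = c].
Proof.
have /orthoframeE[h1 h2 h3 h4 h5] := fr.
rewrite /lincomb !hdotE !(hdotC (hval o)) (hdotC w v) h1 h2 h3 h4 h5 hdotxx.
by split; ring.
Qed.

Lemma lincombE u : u = lincomb (- hdot u v) (- hdot u w) (hdot u o).
Proof. by rewrite {1}[u]orthoframe_expand /lincomb !scaleNr. Qed.

Lemma hdot_lincomb2 a b c a' b' c' :
  hdot (lincomb a b c) (lincomb a' b' c') = - (a * a') - b * b' + c * c'.
Proof.
have [h1 h2 h3] := hdot_lincomb a b c; have [h1' h2' h3'] := hdot_lincomb a' b' c'.
by rewrite orthoframe_hdot h1 h2 h3 h1' h2' h3'; ring.
Qed.

Lemma lincomb_hplane a b c : 0 < c -> c ^+ 2 = 1 + a ^+ 2 + b ^+ 2 ->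
  (lorentz (lincomb a b c) (lincomb a b c) == -1) && (0 < lincomb a b c 0 2%:R).
Proof.
move=> c0 e; apply: (@upper_sheet _ _ o); last by have [_ _ ->] := hdot_lincomb a b c.
by rewrite hdot_lincomb2; lra.
Qed.

Lemma hplane_norm x : hdot x o ^+ 2 = 1 + hdot x v ^+ 2 + hdot x w ^+ 2.
Proof. by have := orthoframe_hdot x x; rewrite hdotxx => e; lra. Qed.

Lemma cosh_sinh_param (al be : R) : 0 < al -> al ^+ 2 - be ^+ 2 = 1 ->
  exists s, cosh s = al /\ sinh s = be.
Proof.
move=> al0 e; have ab : 0 < al + be by nra.
exists (ln (al + be)); rewrite /cosh /sinh expRN lnK ?posrE //.
have -> : (al + be)^-1 = al - be.
  by apply: (mulfI (lt0r_neq0 ab)); rewrite mulfV ?lt0r_neq0 // -e; ring.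
by split; field.
Qed.

Lemma geodesicP x : geodesic o v x <-> hdot x w = 0.
Proof.
have /orthoframeE[h1 h2 h3 h4 h5] := fr; split.
  by move=> [s ->]; rewrite !hdotE (hdotC _ w) h5 h3; ring.
move=> xw; have [||s [hc hs]] := @cosh_sinh_param (hdot x o) (- hdot x v).
- by apply: lt_le_trans (hdot_ge1 x o).
- by rewrite hplane_norm xw; ring.
by exists s; rewrite hc hs [LHS]orthoframe_expand xw scale0r subr0 addrC.
Qed.
End Coordinates.

(** The cross product of v and w has norm 1, so it or its opposite is a point of the plane. *)
Lemma orthoframe_exists v w : hdot v v = - 1 -> hdot w w = - 1 -> hdot v w = 0 ->
  exists o, orthoframe o v w.
Proof.
move=> h1 h2 h3; pose c := crossv v w.
have cc : hdot c c = 1.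
  transitivity (hdot v v * hdot w w - hdot v w ^+ 2); last by rewrite h1 h2 h3; ring.
  by rewrite /c /hdot /lorentz !mxE /=; ring.
have cv : hdot c v = 0 by rewrite hdot_crossv /vol /det3; ring.
have cw : hdot c w = 0 by rewrite hdot_crossv /vol /det3; ring.
have c2 : c 0 2%:R != 0.
  by apply/eqP => c20; move: cc; rewrite /hdot /lorentz c20; nra.
have main (e : R) : e ^+ 2 = 1 -> 0 < e * c 0 2%:R -> exists o, orthoframe o v w.
  move=> e2 ec; have pe : (lorentz (e *: c) (e *: c) == -1) && (0 < (e *: c) 0 2%:R).
    rewrite -[lorentz _ _]opprK -/(hdot _ _) !hdotE cc mxE ec andbT.
    by rewrite mulr1 -expr2 e2.
  exists (HPlane pe); apply/orthoframeE; rewrite /= !hdotZr !(hdotC _ c) cv cw mulr0.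
  by split.
have [c_gt|] := ltP 0 (c 0 2%:R); first by apply: (main 1); rewrite ?expr1n ?mul1r.
rewrite le_eqVlt (negbTE c2) /= => c_lt; apply: (main (-1)); first by rewrite sqrrN
  expr1n.
by rewrite mulN1r oppr_gt0.
Qed.

Section Reflections.
Variables (o : hplane R) (v w : 'rV[R]_3).
Hypothesis fr : orthoframe o v w.

Definition reflv u := u + 2 * hdot u w *: w.

Lemma reflvE u : [/\ hdot (reflv u) v = hdot u v, hdot (reflv u) w = - hdot u w &
  hdot (reflv u) o = hdot u o].
Proof.
have /orthoframeE[h1 h2 h3 h4 h5] := fr.
by rewrite /reflv !hdotE (hdotC w v) h2 h3 h5; split; ring.
Qed.

Lemma refl_subproof x : (lorentz (reflv x) (reflv x) == -1) && (0 < reflv x 0 2%:R).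
Proof.
have [h1 h2 h3] := reflvE x.
apply: (@upper_sheet _ _ o); last by rewrite h3 (lt_le_trans ltr01) // hdot_ge1.
by rewrite (orthoframe_hdot fr) h1 h2 h3 -[RHS](hdotxx x) [RHS](orthoframe_hdot fr); ring.
Qed.

Definition refl x := HPlane (refl_subproof x).

Lemma refl_is_reflection : is_reflection (geodesic o v) refl.
Proof.
split=> [x y|x].
  apply/dH_hdot; have [h1 h2 h3] := reflvE x; have [k1 k2 k3] := reflvE y.
  by rewrite /= (orthoframe_hdot fr (reflv x)) (orthoframe_hdot fr x) h1 h2 h3 k1 k2
    k3; ring.
have [h1 h2 h3] := reflvE x.
split=> [e|/(geodesicP fr) e].
  by apply/(geodesicP fr); have := congr1 (fun z : hplane R => hdot z w) e; rewrite /=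
    h2; lra.
apply/hval_inj/(orthoframe_inj fr); rewrite /= ?h1 ?h3 // h2 e; exact: oppr0.
Qed.

(** An isometry fixing the line keeps products with two of its points, hence the coordinates along v
    and o. The coordinate along w can only change sign, and it is kept only if x is fixed, that is,
    on the line. *)
Lemma is_reflection_refl f x : is_reflection (geodesic o v) f -> f x = refl x.
Proof.
move=> [iso fix_f]; have [h1 h2 h3] := reflvE x.
have /orthoframeE[g1 g2 g3 g4 g5] := fr.
have inv y : geodesic o v y -> hdot (f x) y = hdot x y.
  by move=> Ly; have /fix_f fy := Ly; rewrite -{1}fy; apply/dH_hdot/iso.
have fo : hdot (f x) o = hdot x o by apply/inv/(geodesicP fr); rewrite hdotC.
(* For c = sqrt 2 the vector v + c o is a point of the line other than o. *)
have [c c0 c1] : exists2 c : R, 0 < c & c ^+ 2 = 1 + 1 ^+ 2 + 0 ^+ 2.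
  by exists (Num.sqrt 2); rewrite ?sqrtr_gt0 // sqr_sqrtr //; ring.
have fv : hdot (f x) v = hdot x v.
  have := @inv (HPlane (lincomb_hplane fr c0 c1)).
  rewrite /= /lincomb !hdotE fo !mul0r !addr0 !mul1r => /(_ _) /addIr; apply.
  by apply/(geodesicP fr) => /=; have [_ -> _] := hdot_lincomb fr 1 0 c; rewrite oppr0.
apply/hval_inj/(orthoframe_inj fr); rewrite /= ?h1 ?h2 ?h3 //.
have : hdot (f x) w ^+ 2 = hdot x w ^+ 2.
  have := hplane_norm fr (f x); have := hplane_norm fr x; rewrite fo fv => -> e.
  by lra.
move/eqP; rewrite eqf_sqr => /orP[] /eqP // e.
have : f x = x by apply/hval_inj/(orthoframe_inj fr).
by move=> /fix_f/(geodesicP fr) xw; rewrite e xw oppr0.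
Qed.
End Reflections.

Lemma orthogonal_lines_frame (P Q : set (hplane R)) : orthogonal_lines P Q ->
  exists o v w, [/\ orthoframe o v w, P = geodesic o v & Q = geodesic o w].
Proof. by move=> [c [v [w [h1 h2 h3 h4 h5]]]]; exists c, v, w. Qed.

Lemma frame_orthogonal_lines o v w : orthoframe o v w ->
  [/\ is_line (geodesic o v), is_line (geodesic o w) &
      orthogonal_lines (geodesic o v) (geodesic o w)].
Proof.
move=> [h1 h2 h3]; split; [by exists o, v | by exists o, w |].
by exists o, v, w.
Qed.

End Frames.

(** * Rectangles as symmetric quadrilaterals *)

Section Rectangles.
Local Open Scope classical_set_scope.
Local Open Scope ring_scope.
Variable R : realType.
Implicit Types (u v w : 'rV[R]_3) (x y z : R) (o p : hplane R).

Definition sgb (b : bool) : R := (-1) ^+ b.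

Lemma sgb_sqr b : sgb b ^+ 2 = 1. Proof. by rewrite /sgb sqrr_sign. Qed.
Lemma sgb_mul b : sgb b * sgb b = 1. Proof. by rewrite -expr2 sgb_sqr. Qed.
Lemma sgbN b : sgb (~~ b) = - sgb b. Proof. by rewrite /sgb signrN. Qed.
Lemma sgb_neq0 b : sgb b != 0. Proof. by rewrite /sgb signr_eq0. Qed.
Lemma sgb_inj : injective sgb.
Proof.
by move=> [] [] //; rewrite /sgb expr1 expr0 => e; exfalso; lra.
Qed.

Lemma sqr_sgb (s : R) : s ^+ 2 = 1 -> exists b, s = sgb b.
Proof.
move/eqP; rewrite -[X in _ == X](expr1n R 2) eqf_sqr => /orP[] /eqP ->.
  by exists false.
by exists true.
Qed.

Definition in_rectangle o v w x y z p :=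
  exists b1 b2, hval p = lincomb o v w (sgb b1 * x) (sgb b2 * y) z.

Lemma in_rectangle_norm o v w x y z p :
  in_rectangle o v w x y z p -> in_rectangle o v w `|x| `|y| z p.
Proof.
move=> [b1 [b2 e]]; exists (b1 (+) (x < 0)), (b2 (+) (y < 0)).
rewrite e /lincomb /sgb !signr_addb -!mulrA.
have sg (t : R) : (-1) ^+ (t < 0)%R * `|t| = t.
  by have [t0|t0] := ltP t 0; rewrite /= ?expr1 ?expr0 ?mulN1r ?mul1r ?(ltr0_norm t0)
    ?(ger0_norm t0) ?opprK.
by rewrite !sg.
Qed.

Section Vertices.
Variables (o : hplane R) (v w : 'rV[R]_3) (x y z : R).
Hypothesis fr : orthoframe o v w.
Hypotheses (x0 : x != 0) (y0 : y != 0) (z0 : 0 < z).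
Hypothesis norm_z : z ^+ 2 = 1 + x ^+ 2 + y ^+ 2.

Lemma vertex_subproof b1 b2 : z ^+ 2 = 1 + (sgb b1 * x) ^+ 2 + (sgb b2 * y) ^+ 2.
Proof. by rewrite !exprMn !sgb_sqr !mul1r. Qed.

Definition vertex b1 b2 : hplane R :=
  HPlane (lincomb_hplane fr z0 (vertex_subproof b1 b2)).

Lemma vertex_inj b1 b2 c1 c2 : vertex b1 b2 = vertex c1 c2 -> b1 = c1 /\ b2 = c2.
Proof.
move=> e; have [h1 h2 _] := hdot_lincomb fr (sgb b1 * x) (sgb b2 * y) z.
have [k1 k2 _] := hdot_lincomb fr (sgb c1 * x) (sgb c2 * y) z.
have := congr1 (fun p : hplane R => hdot p w) e; have := congr1 (fun p : hplane R =>
  hdot p v) e.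
rewrite /= h1 h2 k1 k2 => /oppr_inj/(mulIf x0)/sgb_inj -> /oppr_inj/(mulIf y0)/sgb_inj ->.
by split.
Qed.

Lemma refl_vertex b1 b2 : refl fr (vertex b1 b2) = vertex b1 (~~ b2).
Proof.
apply/hval_inj/(orthoframe_inj fr) => /=.
all: have [h1 h2 h3] := hdot_lincomb fr (sgb b1 * x) (sgb b2 * y) z.
all: have [k1 k2 k3] := hdot_lincomb fr (sgb b1 * x) (sgb (~~ b2) * y) z.
all: have [f1 f2 f3] := reflvE fr (vertex b1 b2).
- by rewrite f1 h1 k1.
- by rewrite f2 k2 h2 sgbN mulNr opprK.
- by rewrite f3 h3 k3.
Qed.

Lemma refl_sym_vertex b1 b2 :
  refl (orthoframe_sym fr) (vertex b1 b2) = vertex (~~ b1) b2.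
Proof.
apply/hval_inj/(orthoframe_inj fr) => /=.
all: have [h1 h2 h3] := hdot_lincomb fr (sgb b1 * x) (sgb b2 * y) z.
all: have [k1 k2 k3] := hdot_lincomb fr (sgb (~~ b1) * x) (sgb b2 * y) z.
all: have [f1 f2 f3] := reflvE (orthoframe_sym fr) (vertex b1 b2).
- by rewrite f2 k1 h1 sgbN mulNr opprK.
- by rewrite f1 h2 k2.
- by rewrite f3 h3 k3.
Qed.

(** Gray code order: cyclically consecutive vertices differ in exactly one sign, so the sides are
    those of the rectangle. *)
Definition quad (k : 'I_4) : hplane R := vertex ((0 < k) && (k < 3))%N (1 < k)%N.

Lemma quad_inj : is_quadrilateral quad.
Proof.
move=> [[|[|[|[|//]]]] ki] [[|[|[|[|//]]]] li] /vertex_inj[] //= *.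
all: exact: val_inj.
Qed.

Lemma quad_onto b1 b2 : exists k, vertex b1 b2 = quad k.
Proof.
case: b1 b2 => -[].
- by exists (@Ordinal 4 2 isT).
- by exists (@Ordinal 4 1 isT).
- by exists (@Ordinal 4 3 isT).
- by exists (@Ordinal 4 0 isT).
Qed.

(** A map k |-> c - k on Z/4 reverses the cyclic order and sends the side {i, i + 1} to the one that
    starts at c - i - 1. *)
Lemma symmetric_of_rotation (f : hplane R -> hplane R) (c : 'I_4) (L : set (hplane R)) :
  is_reflection L f -> (forall k, f (quad k) = quad (c - k)) -> symmetric_wrt quad L.
Proof.
move=> fL fq; exists f; split => // i; exists (c - i - 1).
by rewrite !fq subrK opprD addrA setUC.
Qed.

Lemma quad_symmetric : symmetric_wrt quad (geodesic o v) /\ symmetric_wrt quad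
  (geodesic o w).
Proof.
split.
- apply: (@symmetric_of_rotation _ 3%:R); first exact: (refl_is_reflection fr).
  by move=> [[|[|[|[|//]]]] ki]; rewrite refl_vertex.
- apply: (@symmetric_of_rotation _ 1%:R); first exact: (refl_is_reflection
    (orthoframe_sym fr)).
  by move=> [[|[|[|[|//]]]] ki]; rewrite refl_sym_vertex.
Qed.

Lemma quad_off k : ~ geodesic o v (quad k) /\ ~ geodesic o w (quad k).
Proof.
rewrite /quad; move: (_ && _) (1 < k)%N => b1 b2.
have [h1 h2 _] := hdot_lincomb fr (sgb b1 * x) (sgb b2 * y) z.
split=> [/(geodesicP fr)|/(geodesicP (orthoframe_sym fr))]; rewrite /= ?h1 ?h2.
  by apply/eqP; rewrite oppr_eq0 mulf_neq0 ?sgb_neq0.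
by apply/eqP; rewrite oppr_eq0 mulf_neq0 ?sgb_neq0.
Qed.

Lemma in_rectangle_quad p : in_rectangle o v w x y z p -> exists k, p = quad k.
Proof.
move=> [b1 [b2 e]]; have [k ek] := quad_onto b1 b2; exists k; rewrite -ek.
exact: hval_inj.
Qed.
End Vertices.

Lemma condition_D2_of_rectangles m n (p : 'I_m -> hplane R) (q : 'I_n -> hplane R)
  o v w x y z x' y' z' : orthoframe o v w ->
  x != 0 -> y != 0 -> 0 < z -> z ^+ 2 = 1 + x ^+ 2 + y ^+ 2 ->
  x' != 0 -> y' != 0 -> 0 < z' -> z' ^+ 2 = 1 + x' ^+ 2 + y' ^+ 2 ->
  (forall i, in_rectangle o v w x y z (p i)) ->
  (forall j, in_rectangle o v w x' y' z' (q j)) -> condition_D2 p q.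
Proof.
move=> fr x0 y0 z0 nz x0' y0' z0' nz' hp hq.
have [l1 l2 l3] := frame_orthogonal_lines fr.
exists (geodesic o v), (geodesic o w), (quad fr z0 nz), (quad fr z0' nz').
have [s1 s2] := quad_symmetric fr z0 nz; have [s1' s2'] := quad_symmetric fr z0' nz'.
split; [by split | split => // | split => // | |].
- exact: quad_inj.
- exact: quad_off.
- exact: quad_inj.
- exact: quad_off.
- by move=> i; apply: in_rectangle_quad.
- by move=> j; apply: in_rectangle_quad.
Qed.

(** Both reflections permute the vertices. Since A 0 lies on neither line, its orbit has four
    points, hence contains every vertex. *)
Lemma quadrilateral_in_rectangle o v w (A : 'I_4 -> hplane R) :
  orthoframe o v w -> is_quadrilateral A ->
  symmetric_wrt A (geodesic o v) -> symmetric_wrt A (geodesic o w) ->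
  (forall k, ~ geodesic o v (A k) /\ ~ geodesic o w (A k)) ->
  exists x y z, [/\ 0 < x, 0 < y, 0 < z, z ^+ 2 = 1 + x ^+ 2 + y ^+ 2 &
    forall k, in_rectangle o v w x y z (A k)].
Proof.
move=> fr injA symK symL off.
have refl_range v' w' (fr' : orthoframe o v' w') : symmetric_wrt A (geodesic o v') ->
    forall i, exists j, refl fr' (A i) = A j.
  move=> [f [fref fA]] i; have [j] := fA i.
  move/seteqP => [/(_ (f (A i)) (or_introl erefl))] + _; rewrite (is_reflection_refl
    fr' _ fref).
  by case=> ->; [exists j | exists (j + 1)].
pose x := - hdot (A 0) v; pose y := - hdot (A 0) w; pose z := hdot (A 0) o.
have z0 : 0 < z by rewrite (lt_le_trans ltr01) // hdot_ge1.
have nz : z ^+ 2 = 1 + x ^+ 2 + y ^+ 2.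
  by rewrite /x /y (sqrrN (hdot _ _)) (sqrrN (hdot _ _)) (hplane_norm fr (A 0)).
have [offv offw] := off 0.
have x0 : x != 0 by rewrite oppr_eq0; apply/eqP => /(geodesicP (orthoframe_sym fr)).
have y0 : y != 0 by rewrite oppr_eq0; apply/eqP => /(geodesicP fr).
pose g := vertex fr z0 nz.
have A0 : A 0 = g false false.
  by apply/hval_inj; rewrite /= /sgb expr0 !mul1r -(lincombE fr).
have gA b : exists k, A k = g b.1 b.2.
  have [k1 e1] : exists k, A k = g b.1 false.
    case: b.1; last by exists 0.
    have [k ek] := refl_range _ _ (orthoframe_sym fr) symL 0.
    by exists k; rewrite -ek A0 refl_sym_vertex.
  case: b.2; last by exists k1.
  by have [k ek] := refl_range _ _ fr symK k1; exists k; rewrite -ek e1 refl_vertex.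
have [h hP] := choice gA.
have inj_h : injective h.
  move=> [b1 b2] [c1 c2] e; have := hP (b1, b2); rewrite e hP /=.
  by move=> /(vertex_inj x0 y0)[-> ->].
have onto k : exists b, h b = k.
  have /(inj_card_bij inj_h)[h' _ hK] : (#|'I_4| <= #|{: bool * bool}|)%N.
    by rewrite card_ord card_prod card_bool.
  by exists (h' k); rewrite hK.
exists `|x|, `|y|, z; split; rewrite ?normr_gt0 //; first by rewrite !real_normK
  ?num_real.
move=> k; apply: in_rectangle_norm; have [b <-] := onto k; rewrite hP.
by exists b.1, b.2.
Qed.

Lemma condition_D2_rectangles m n (p : 'I_m -> hplane R) (q : 'I_n -> hplane R) :
  condition_D2 p q -> exists o v w x y z x' y' z',
  [/\ orthoframe o v w,
    [/\ 0 < x, 0 < y, 0 < z & z ^+ 2 = 1 + x ^+ 2 + y ^+ 2],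
    [/\ 0 < x', 0 < y', 0 < z' & z' ^+ 2 = 1 + x' ^+ 2 + y' ^+ 2],
    forall i, in_rectangle o v w x y z (p i) &
    forall j, in_rectangle o v w x' y' z' (q j)].
Proof.
move=> [K [L [A [B [[_ _ KL] [qA AK AL offA] [qB BK BL offB] pA qB']]]]].
have [c [v [w [fr eK eL]]]] := orthogonal_lines_frame KL; subst K L.
have [x [y [z [? ? ? ? hA]]]] := quadrilateral_in_rectangle fr qA AK AL offA.
have [x' [y' [z' [? ? ? ? hB]]]] := quadrilateral_in_rectangle fr qB BK BL offB.
exists c, v, w, x, y, z, x', y', z'; split => //.
- by move=> i; have [k ->] := pA i.
- by move=> j; have [k ->] := qB' j.
Qed.

End Rectangles.

(** * Constructing flexes *)

Section Continuity.
Local Open Scope classical_set_scope.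
Local Open Scope ring_scope.
Variables (R : realType) (T : topologicalType).
Implicit Types (f g h : T -> 'rV[R]_3) (a b c : T -> R).

Lemma continuous_coord f j t : {for t, continuous f} ->
  {for t, continuous (fun s => f s 0 j)}.
Proof.
move=> cf; exact: (continuous_comp cf (@coord_continuous R 1 3 0 j (f t))).
Qed.

Lemma continuous_hdot f g t : {for t, continuous f} -> {for t, continuous g} ->
  {for t, continuous (fun s => hdot (f s) (g s))}.
Proof.
move=> cf cg; rewrite /hdot /lorentz.
by apply: continuousN; apply: continuousB; [apply: continuousD|];
  apply: continuousM; exact: continuous_coord.
Qed.

Lemma continuous_vol f g h t : {for t, continuous f} -> {for t, continuous g} ->
  {for t, continuous h} -> {for t, continuous (fun s => vol (f s) (g s) (h s))}.
Proof.
move=> cf cg ch; rewrite /vol /det3.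
apply: continuousD; first apply: continuousD.
all: apply: continuousM; first exact: continuous_coord.
all: by apply: continuousB; apply: continuousM; exact: continuous_coord.
Qed.

Lemma continuous_lincomb3 a b c (u v w : 'rV[R]_3) t : {for t, continuous a} ->
  {for t, continuous b} -> {for t, continuous c} ->
  {for t, continuous (fun s => a s *: u + b s *: v + c s *: w)}.
Proof.
move=> ca cb cc; apply: continuousD; first apply: continuousD.
all: exact: continuousZr_tmp.
Qed.

Lemma continuous_lin3 (k1 k2 k3 : R) a b c t : {for t, continuous a} ->
  {for t, continuous b} -> {for t, continuous c} ->
  {for t, continuous (fun s => k1 * a s + k2 * b s + k3 * c s)}.
Proof.
move=> ca cb cc; apply: continuousD; first apply: continuousD.
all: by apply: continuousM; [exact: cvg_cst | ].
Qed.

Lemma continuous_sqrt a t : {for t, continuous a} ->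
  {for t, continuous (fun s => Num.sqrt (a s))}.
Proof. move=> ca; exact: (continuous_comp ca (@sqrt_continuous R (a t))). Qed.
End Continuity.

(** * Bringing two joints to rest by isometries *)

Section MovingFrame.
Local Open Scope classical_set_scope.
Local Open Scope ring_scope.
Variable R : realType.

Lemma hdot_crossvl (u v : 'rV[R]_3) : hdot (crossv u v) u = 0.
Proof. by rewrite hdot_crossv /vol /det3; ring. Qed.
Lemma hdot_crossvr (u v : 'rV[R]_3) : hdot (crossv u v) v = 0.
Proof. by rewrite hdot_crossv /vol /det3; ring. Qed.
Lemma hdot_crossv2 (u v : 'rV[R]_3) :
  hdot (crossv u v) (crossv u v) = hdot u u * hdot v v - hdot u v ^+ 2.
Proof. by rewrite /hdot /lorentz !mxE /=; ring. Qed.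

Lemma vol_crossv_neq0 (x y : hplane R) : x <> y -> vol x y (crossv x y) != 0.
Proof.
move=> xy; rewrite -[vol _ _ _]opprK -hdot_crossv oppr_eq0.
by rewrite hdot_crossv2 !hdotxx mulr1 subr_eq0 eq_sym gt_eqF // exprn_egt1 // hdot_gt1.
Qed.

(* When H(x1, x2) = H(y1, y2), this is the linear isometry taking y1 to x1 and
   y2 to x2. *)
Definition frame_move (x1 x2 y1 y2 u : 'rV[R]_3) : 'rV[R]_3 :=
  let c := hdot y1 y2 in
  ((hdot u y1 - c * hdot u y2) / (1 - c ^+ 2)) *: x1 +
  ((hdot u y2 - c * hdot u y1) / (1 - c ^+ 2)) *: x2 +
  (- vol y1 y2 u / (1 - c ^+ 2)) *: crossv x1 x2.

Section Move.
Variables (x1 x2 y1 y2 : hplane R).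
Hypothesis x12 : x1 <> x2.
Hypothesis same : hdot x1 x2 = hdot y1 y2.

Let c1 : 1 - hdot y1 y2 ^+ 2 != 0.
Proof. by rewrite -same subr_eq0 eq_sym gt_eqF // exprn_egt1 // hdot_gt1. Qed.

Lemma frame_moveE u :
  [/\ hdot (frame_move x1 x2 y1 y2 u) x1 = hdot u y1,
      hdot (frame_move x1 x2 y1 y2 u) x2 = hdot u y2 &
      hdot (frame_move x1 x2 y1 y2 u) (crossv x1 x2) = hdot u (crossv y1 y2)].
Proof.
rewrite /frame_move !hdotE !(hdotC x2 x1) !(hdotC _ (crossv x1 x2)).
rewrite !hdot_crossvl !hdot_crossvr hdot_crossv2 !hdotxx same -hdot_crossv (hdotC u
  (crossv _ _)).
by split; field.
Qed.

Lemma frame_move_hdot u u' :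
  hdot (frame_move x1 x2 y1 y2 u) (frame_move x1 x2 y1 y2 u') = hdot u u'.
Proof.
have [h1 h2 h3] := frame_moveE u; have [k1 k2 k3] := frame_moveE u'.
apply: (@eq_gram _ x1 x2 (crossv x1 x2) _ _ y1 y2 (crossv y1 y2)).
all: rewrite ?hdotxx ?hdot_crossv2 ?same ?hdotxx //.
- exact: vol_crossv_neq0.
- by rewrite !(hdotC _ (crossv _ _)) !hdot_crossvl.
- by rewrite !(hdotC _ (crossv _ _)) !hdot_crossvr.
all: by rewrite hdotC ?h1 ?h2 ?h3 ?k1 ?k2 ?k3 hdotC.
Qed.

Lemma frame_move_fst : frame_move x1 x2 y1 y2 y1 = x1.
Proof.
have [h1 h2 h3] := frame_moveE y1.
apply: (vol_inj (vol_crossv_neq0 x12)); rewrite ?h1 ?h2 ?h3 ?hdotxx //.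
by rewrite !(hdotC _ (crossv _ _)) !hdot_crossvl.
Qed.

Lemma frame_move_snd : frame_move x1 x2 y1 y2 y2 = x2.
Proof.
have [h1 h2 h3] := frame_moveE y2.
apply: (vol_inj (vol_crossv_neq0 x12)); rewrite ?h1 ?h2 ?h3 ?hdotxx //.
  by rewrite hdotC -same hdotC.
by rewrite !(hdotC _ (crossv _ _)) !hdot_crossvr.
Qed.

Lemma frame_move_subproof (z : hplane R) :
  (lorentz (frame_move x1 x2 y1 y2 z) (frame_move x1 x2 y1 y2 z) == -1)
   && (0 < frame_move x1 x2 y1 y2 z 0 2%:R).
Proof.
apply: (@upper_sheet _ _ x1); first by rewrite frame_move_hdot hdotxx.
by have [-> _ _] := frame_moveE z; apply: lt_le_trans (hdot_ge1 _ _).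
Qed.
End Move.

Lemma frame_move_id (x1 x2 : hplane R) u : x1 <> x2 -> frame_move x1 x2 x1 x2 u = u.
Proof.
move=> x12; have [h1 h2 h3] := frame_moveE x12 erefl u.
exact: (vol_inj (vol_crossv_neq0 x12)).
Qed.

(** Composing at each time with the isometry that takes p i0 and q j0 back to their initial
    positions gives the joints at rest that a flex requires. The changing distance within the p's
    survives the composition, so the result is not constant. *)
Lemma flexible_of_motion m n (p : 'I_m -> hplane R) (q : 'I_n -> hplane R)
  (P : R -> 'I_m -> hplane R) (Q : R -> 'I_n -> hplane R) (i0 : 'I_m) (j0 : 'I_n) :
  is_framework p q ->
  (forall i, continuous (fun t => hval (P t i))) ->
  (forall j, continuous (fun t => hval (Q t j))) ->
  (forall i, P 0 i = p i) -> (forall j, Q 0 j = q j) ->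
  (forall t i j, hdot (P t i) (Q t j) = hdot (p i) (q j)) ->
  (exists i k, hdot (P 1 i) (P 1 k) <> hdot (p i) (p k)) ->
  flexible p q.
Proof.
move=> fw cP cQ P0 Q0 PQ [i [k ik]].
have ne := fw i0 j0; have same t := esym (PQ t i0 j0).
pose g t (z : hplane R) := HPlane (frame_move_subproof ne (same t) z).
have cg (Z : R -> hplane R) : continuous (fun t => hval (Z t)) ->
    continuous (fun t => hval (g t (Z t))).
  move=> cZ; pose c := hdot (p i0) (q j0).
  pose al t := (hdot (Z t) (P t i0) - c * hdot (Z t) (Q t j0)) / (1 - c ^+ 2).
  pose be t := (hdot (Z t) (Q t j0) - c * hdot (Z t) (P t i0)) / (1 - c ^+ 2).
  pose ga t := - vol (P t i0) (Q t j0) (Z t) / (1 - c ^+ 2).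
  have -> : (fun t => hval (g t (Z t))) =
      (fun t => al t *: hval (p i0) + be t *: hval (q j0) + ga t *: crossv (p i0) (q j0)).
    by apply/funext => t; rewrite /= /frame_move PQ.
  move=> t; apply: (@continuous_lincomb3 _ _ al be ga).
  - apply: continuousM; last exact: cvg_cst.
    apply: continuousB; first by apply: continuous_hdot; [exact: cZ | exact: cP].
    by apply: continuousM; [exact: cvg_cst|apply: continuous_hdot; [exact: cZ | exact:
      cQ]].
  - apply: continuousM; last exact: cvg_cst.
    apply: continuousB; first by apply: continuous_hdot; [exact: cZ | exact: cQ].
    by apply: continuousM; [exact: cvg_cst|apply: continuous_hdot; [exact: cZ | exact:
      cP]].
  - apply: continuousM; last exact: cvg_cst.
    by apply: continuousN; apply: continuous_vol; [exact: cP | exact: cQ | exact: cZ].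
exists (fun t i => g t (P t i)), (fun t j => g t (Q t j)); split.
- split=> [i'|j']; apply: continuous_subspaceT; exact: cg.
- split=> [i'|j']; apply: hval_inj; rewrite /= ?P0 ?Q0; exact: frame_move_id.
- exists 1; first by rewrite ler01 lexx.
  left; apply: contrapT => /forallNP H; apply: ik.
  have e l : g 1 (P 1 l) = p l by apply: contrapT => /H.
  by rewrite -[in RHS]e -[in RHS](e k) /= frame_move_hdot.
- by move=> t _ i' j'; apply/dH_hdot; rewrite /= frame_move_hdot.
- exists i0, j0 => t _; split; apply: hval_inj => /=.
  + exact: frame_move_fst.
  + exact: frame_move_snd.
Qed.
End MovingFrame.

(** * The flex along two orthogonal lines *)

Section Flexes.
Local Open Scope classical_set_scope.
Local Open Scope ring_scope.
Variable R : realType.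

(** Maps all of R continuously into [0, 1], so that motions can be continuous everywhere while their
    parameter stays in a small interval; it is 0 at 0 and positive at 1. *)
Definition ramp (t : R) : R := t ^+ 2 / (1 + t ^+ 2).

Lemma ramp_den_gt0 (t : R) : 0 < 1 + t ^+ 2.
Proof. by have := sqr_ge0 t; lra. Qed.

Lemma ramp0 : ramp 0 = 0. Proof. by rewrite /ramp expr0n /= mul0r. Qed.
Lemma ramp1 : ramp 1 = 1 / 2. Proof. by rewrite /ramp expr1n; field. Qed.

Lemma ramp_itv t : 0 <= ramp t <= 1.
Proof.
have h := ramp_den_gt0 t; apply/andP; split; first by rewrite divr_ge0 ?sqr_ge0 // ltW.
by rewrite ler_pdivrMr // mul1r; lra.
Qed.

Lemma continuous_pointwise (T U : topologicalType) (f : T -> U) :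
  (forall t, {for t, continuous f}) -> continuous f.
Proof. by []. Qed.

Lemma continuous_ramp : continuous ramp.
Proof.
apply: continuous_pointwise => t; rewrite /ramp.
have csq (x : R) : {for x, continuous (fun t : R => t ^+ 2)} by exact: exprn_continuous.
apply: continuousM => //; apply: continuousV; first by rewrite gt_eqF // ramp_den_gt0.
by apply: continuousD => //; exact: cvg_cst.
Qed.

Lemma continuous_affine_ramp (a k : R) : continuous (fun t => a + k * ramp t).
Proof.
apply: continuous_pointwise => t; apply: continuousD; first exact: cvg_cst.
by apply: continuousM; [exact: cvg_cst | exact: continuous_ramp].
Qed.

Lemma finite_pos_lb (F : finType) (f : F -> R) : (forall i, 0 < f i) ->
  exists2 e : R, 0 < e & forall i, e <= f i.
Proof.
move=> f0; exists (\big[Order.min/1]_i f i); first by apply: lt_bigmin.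
by move=> i; apply: bigmin_le.
Qed.

Lemma continuous_pos_right (f : R -> R) (x : R) : {for x, continuous f} -> 0 < f x ->
  exists2 e : R, 0 < e & forall y, x <= y <= x + e -> 0 < f y.
Proof.
move=> cf fx; have /nbhs_ballP[e /= e0 be] : nbhs x [set y | 0 < f y] by exact: cvgr_gt
  cf _ fx.
exists (e / 2); first by rewrite divr_gt0.
move=> y /andP[xy ye]; apply: be; rewrite /ball /= ltr_distlC.
by apply/andP; split; lra.
Qed.

Lemma flexible_sym m n (p : 'I_m -> hplane R) (q : 'I_n -> hplane R) :
  flexible q p -> flexible p q.
Proof.
move=> [pt [qt [[h1 h2] [h3 h4] [t t01 h5] h6 [i [j h7]]]]]; exists qt, pt; split => //.
- by exists t => //; case: h5 => h; [right|left].
- by move=> s s01 i' j'; apply/dH_hdot; rewrite (hdotC (qt s i')) (hdotC (p i'));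
    apply/dH_hdot/h6.
- by exists j, i => s s01; have [] := h7 s s01.
Qed.

Section FrameMotion.
Variables (o : hplane R) (v w : 'rV[R]_3).
Hypothesis fr : orthoframe o v w.

(** [insubd] falls back to the point o off the upper sheet; the motions below never leave the sheet,
    so that [frame_pointK] applies. *)
Definition frame_point (a b c : R) : hplane R := insubd o (lincomb o v w a b c).

Lemma frame_pointK a b c : 0 < c -> c ^+ 2 = 1 + a ^+ 2 + b ^+ 2 ->
  hval (frame_point a b c) = lincomb o v w a b c.
Proof. by move=> c0 e; apply: insubdK; apply: lincomb_hplane. Qed.

Lemma continuous_frame_point (a b c : R -> R) :
  continuous a -> continuous b -> continuous c ->
  (forall t, 0 < c t /\ c t ^+ 2 = 1 + a t ^+ 2 + b t ^+ 2) ->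
  continuous (fun t => hval (frame_point (a t) (b t) (c t))).
Proof.
move=> ca cb cc H.
have -> : (fun t => hval (frame_point (a t) (b t) (c t))) =
    (fun t => a t *: v + b t *: w + c t *: hval o).
  by apply/funext => t; have [h1 h2] := H t; rewrite frame_pointK.
by apply: continuous_pointwise => t; apply: (@continuous_lincomb3 _ _ a b c); [exact:
  ca | exact: cb | exact: cc].
Qed.

Lemma sgb_lt0 (x : R) : sgb R (x < 0)%R * Num.sqrt (x ^+ 2) = x.
Proof.
rewrite sqrtr_sqr /sgb; have [x0|x0] := ltP x 0; rewrite /= ?expr1 ?expr0 ?mulN1r ?mul1r.
  by rewrite ltr0_norm ?opprK.
by rewrite ger0_norm.
Qed.

(** Products between the parts are products of cosh distances to o, which are multiplied by sqrt L
    for the p's and divided by it for the q's. The q's need room to approach o: k is a lower bound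
    of their c^2 - 1, and L stays at most 1 + k. *)
Lemma flexible_D1_half m n (p : 'I_m -> hplane R) (q : 'I_n -> hplane R)
    (i0 i1 : 'I_m) (j0 : 'I_n) :
  is_framework p q -> p i0 <> p i1 ->
  (forall i, hdot (p i) w = 0) -> (forall j, hdot (q j) v = 0) ->
  (forall j, hdot (q j) w != 0) -> flexible p q.
Proof.
move=> fw i01 pw qv qw.
pose c (x : hplane R) := hdot x o.
have c1 x : 1 <= c x by apply: hdot_ge1.
have c0 x : 0 < c x by apply: lt_le_trans (c1 x).
have qc j : c (q j) ^+ 2 = 1 + hdot (q j) w ^+ 2.
  by rewrite /c (hplane_norm fr) qv expr0n /= addr0.
have pc i : c (p i) ^+ 2 = 1 + hdot (p i) v ^+ 2.
  by rewrite /c (hplane_norm fr) pw expr0n /= addr0.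
have [k k0 kq] : exists2 k : R, 0 < k & forall j, k <= hdot (q j) w ^+ 2.
  by apply: finite_pos_lb => j; rewrite lt_def sqrf_eq0 qw sqr_ge0.
pose L t := 1 + k * ramp t.
have L1 t : 1 <= L t <= 1 + k.
  have /andP[h0 h1] := ramp_itv t; have := mulr_ge0 (ltW k0) h0.
  have : k * ramp t <= k * 1 by rewrite ler_pM2l.
  by rewrite /L; lra.
have L0 t : 0 < L t by have /andP[h _] := L1 t; apply: lt_le_trans h.
have cL : continuous L by exact: continuous_affine_ramp.
have csL : continuous (fun t => Num.sqrt (L t)) by apply: continuous_pointwise => t;
  apply: continuous_sqrt; exact: cL.
have sL0 t : 0 < Num.sqrt (L t) by rewrite sqrtr_gt0.
have sL2 t : Num.sqrt (L t) ^+ 2 = L t by rewrite sqr_sqrtr // ltW.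
pose a i t := sgb R (- hdot (p i) v < 0)%R * Num.sqrt (L t * c (p i) ^+ 2 - 1).
pose b j t := sgb R (- hdot (q j) w < 0)%R * Num.sqrt (c (q j) ^+ 2 / L t - 1).
have a2 i t : a i t ^+ 2 = L t * c (p i) ^+ 2 - 1.
  rewrite exprMn sgb_sqr mul1r sqr_sqrtr // subr_ge0.
  have /andP[h _] := L1 t; have h' : 1 <= c (p i) ^+ 2 by rewrite exprn_ege1.
  by rewrite -[leLHS]mulr1 ler_pM.
have b2 j t : b j t ^+ 2 = c (q j) ^+ 2 / L t - 1.
  rewrite exprMn sgb_sqr mul1r sqr_sqrtr // subr_ge0 ler_pdivlMr // mul1r qc.
  by have /andP[_ h] := L1 t; have := kq j; lra.
have pz t i : 0 < Num.sqrt (L t) * c (p i) /\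
   (Num.sqrt (L t) * c (p i)) ^+ 2 = 1 + a i t ^+ 2 + 0 ^+ 2.
  by rewrite mulr_gt0 // a2 exprMn sL2; split => //; ring.
have qz t j : 0 < c (q j) / Num.sqrt (L t) /\
   (c (q j) / Num.sqrt (L t)) ^+ 2 = 1 + 0 ^+ 2 + b j t ^+ 2.
  by rewrite divr_gt0 // b2 exprMn exprVn sL2; split => //; ring.
pose P t i := frame_point (a i t) 0 (Num.sqrt (L t) * c (p i)).
pose Q t j := frame_point 0 (b j t) (c (q j) / Num.sqrt (L t)).
have L_0 : L 0 = 1 by rewrite /L ramp0 mulr0 addr0.
have PE t i : hval (P t i) = lincomb o v w (a i t) 0 (Num.sqrt (L t) * c (p i)).
  by have [h1 h2] := pz t i; exact: frame_pointK.
have QE t j : hval (Q t j) = lincomb o v w 0 (b j t) (c (q j) / Num.sqrt (L t)).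
  by have [h1 h2] := qz t j; exact: frame_pointK.
apply: (@flexible_of_motion _ _ _ p q P Q i0 j0) => //.
- move=> i; apply: continuous_frame_point; [| by move=> t; exact: cvg_cst | | by move=>
    t; exact: pz].
    apply: continuous_pointwise => t; apply: continuousM; first exact: cvg_cst.
    apply: continuous_sqrt; apply: continuousB; last exact: cvg_cst.
    by apply: continuousM; [exact: cL | exact: cvg_cst].
  by apply: continuous_pointwise => t; apply: continuousM; [exact: csL | exact: cvg_cst].
- move=> j; apply: continuous_frame_point; [by move=> t; exact: cvg_cst | | | by move=>
    t; exact: qz].
    apply: continuous_pointwise => t; apply: continuousM; first exact: cvg_cst.
    apply: continuous_sqrt; apply: continuousB; last exact: cvg_cst.
    apply: continuousM; first exact: cvg_cst.
    by apply: continuousV; [rewrite gt_eqF | exact: cL].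
  apply: continuous_pointwise => t; apply: continuousM; first exact: cvg_cst.
  by apply: continuousV; [rewrite gt_eqF | exact: csL].
- move=> i; apply: hval_inj; rewrite PE [RHS](lincombE fr) pw oppr0 L_0 sqrtr1 mul1r.
  rewrite /a L_0 mul1r pc addrC addKr.
  by rewrite -[in Num.sqrt _]sqrrN sgb_lt0.
- move=> j; apply: hval_inj; rewrite QE [RHS](lincombE fr) qv oppr0 L_0 sqrtr1 divr1.
  rewrite /b L_0 divr1 qc addrC addKr.
  by rewrite -[in Num.sqrt _]sqrrN sgb_lt0.
- move=> t i j; rewrite PE QE (hdot_lincomb2 fr) (orthoframe_hdot fr (p i)) pw qv /c.
  by field; rewrite gt_eqF.
(* If the product h of p i0 and p i1 were the same at time 1, then (L c0 c1 - h)^2 = (L c0^2 - 1) (L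
   c1^2 - 1) would hold for two values of L. The terms in L^2 cancel, so both coefficients vanish,
   and h = 1. *)
- exists i0, i1; rewrite !PE (hdot_lincomb2 fr) => e.
  set h := hdot (p i0) (p i1) in e.
  have e0 := orthoframe_hdot fr (p i0) (p i1).
  rewrite !pw -/h -/(c _) -/(c _) in e0.
  set x := hdot (p i0) v in e0; set y := hdot (p i1) v in e0.
  have hx : x ^+ 2 = c (p i0) ^+ 2 - 1 by rewrite pc; ring.
  have hy : y ^+ 2 = c (p i1) ^+ 2 - 1 by rewrite pc; ring.
  set c0' := c (p i0) in e e0 hx hy; set c1' := c (p i1) in e e0 hx hy.
  have g1 : (L 1 * c0' * c1' - h) ^+ 2 = (L 1 * c0' ^+ 2 - 1) * (L 1 * c1' ^+ 2 - 1).
    rewrite -!a2 -exprMn; congr (_ ^+ 2); move: (sL2 1) e.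
    by move: (Num.sqrt (L 1)) => r hr e; rewrite -e -hr; ring.
  have g0 : (c0' * c1' - h) ^+ 2 = (c0' ^+ 2 - 1) * (c1' ^+ 2 - 1).
    by rewrite -hx -hy e0; ring.
  have Lgt : L 1 - 1 != 0.
    by rewrite /L addrC addKr ramp1 !mulf_neq0 ?gt_eqF ?invr_gt0.
  have z : 2 * h * c0' * c1' - c0' ^+ 2 - c1' ^+ 2 = 0.
    apply: (mulIr0 Lgt).
    transitivity (((c0' * c1' - h) ^+ 2 - (c0' ^+ 2 - 1) * (c1' ^+ 2 - 1)) -
      ((L 1 * c0' * c1' - h) ^+ 2 - (L 1 * c0' ^+ 2 - 1) * (L 1 * c1' ^+ 2 - 1)));
        first by ring.
    by rewrite g1 g0; ring.
  have h1 : h = 1.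
    apply: sqr_eq_pos; [exact: lt_le_trans (hdot_ge1 _ _) | by [] |].
    apply/eqP; rewrite -subr_eq0; apply/eqP.
    transitivity (((c0' * c1' - h) ^+ 2 - (c0' ^+ 2 - 1) * (c1' ^+ 2 - 1)) + (2 * h *
      c0' * c1' - c0' ^+ 2 - c1' ^+ 2)); first by ring.
    by rewrite z g0; ring.
  exact/i01/hdot_eq1.
Qed.
End FrameMotion.

(** At most one part has a joint at the intersection of the lines; the other part is the one to be
    moved towards it. *)
Lemma flexible_D1 m n (p : 'I_m -> hplane R) (q : 'I_n -> hplane R) :
  (1 < m)%N -> (1 < n)%N -> non_overlapping p q -> condition_D1 p q -> flexible p q.
Proof.
move=> m1 n1 [pinj qinj fw] [P [Q [_ _ /orthogonal_lines_frame[c [v [w [fr -> ->]]]] hp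
  hq]]].
have pw i : hdot (p i) w = 0 by apply/(geodesicP fr).
have qv j : hdot (q j) v = 0 by apply/(geodesicP (orthoframe_sym fr)).
pose i0 := Ordinal (ltnW m1); pose i1 := Ordinal m1.
pose j0 := Ordinal (ltnW n1); pose j1 := Ordinal n1.
have oE (x : hplane R) : hdot x v = 0 -> hdot x w = 0 -> x = c.
  move=> hv hw; apply/hval_inj; rewrite [LHS](orthoframe_expand fr) hv hw oppr0 !scale0r.
  rewrite subr0 add0r (_ : hdot x c = 1) ?scale1r //.
  apply: sqr_eq_pos; [exact: lt_le_trans (hdot_ge1 _ _) | by [] |].
  by rewrite (hplane_norm fr) hv hw; ring.
have [qw|] := pselect (forall j, hdot (q j) w != 0).
  by apply: (@flexible_D1_half _ _ _ fr _ _ p q i0 i1 j0) => // /pinj.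
move=> /existsNP[j /negP/negPn/eqP qjw]; have qj := oE _ (qv j) qjw.
apply: flexible_sym; apply: (@flexible_D1_half _ _ _ (orthoframe_sym fr) _ _ q p j0 j1
  i0) => //.
- by move=> a b /esym; apply: fw.
- by move=> /qinj.
- by move=> i; apply/eqP => piv; apply: (fw i j); rewrite qj; apply: oE.
Qed.
End Flexes.

(** * The flex of two rectangles *)

Section DixonFlex.
Local Open Scope classical_set_scope.
Local Open Scope ring_scope.
Variable R : realType.

(* Clearing denominators in U X0 / X + V Y0 / Y + 1 = W Z0 / (1 + X + Y) gives
   an equation quadratic in Y with leading coefficient U X0 + X. *)
Definition dixon_lin (U V X0 Y0 X : R) : R :=
  U * X0 * (1 + X) + V * Y0 * X + X * (1 + X) - (1 + U + V) * (1 + X0 + Y0) * X.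

(** N is the Y-derivative of the quadratic at the starting point, and N^2 its discriminant there. If
    N <> 0, the root with the sign of N passes through Y0 and stays real and positive for X slightly
    above X0. *)
Lemma dixon_path_half (U V X0 Y0 : R) :
  0 < U -> 0 < V -> 0 < X0 -> 0 < Y0 ->
  2 * (U * X0 + X0) * Y0 + dixon_lin U V X0 Y0 X0 != 0 ->
  exists X Y : R -> R, [/\ continuous X, continuous Y,
    X 0 = X0 /\ Y 0 = Y0, X 1 <> X0 &
    forall t, [/\ 0 < X t, 0 < Y t &
      U * X0 / X t + V * Y0 / Y t + 1 = (1 + U + V) * (1 + X0 + Y0) / (1 + X t + Y t)]].
Proof.
move=> U0 V0 X00 Y00; set N := 2 * (U * X0 + X0) * Y0 + _ => N0.
pose A x := U * X0 + x; pose B x := dixon_lin U V X0 Y0 x.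
pose D x := B x ^+ 2 - 4 * A x * (V * Y0 * x * (1 + x)).
have cid (x : R) : {for x, continuous (fun x : R => x)} by exact: cvg_id.
have ccst (k x : R) : {for x, continuous (fun _ : R => k)} by exact: cvg_cst.
have cA x : {for x, continuous A} by apply: continuousD; [exact: ccst | exact: cid].
have cB x : {for x, continuous B}.
  rewrite /B /dixon_lin; apply: continuousB; first apply: continuousD; first apply:
    continuousD.
  - by apply: continuousM; [exact: ccst | apply: continuousD; [exact: ccst | exact: cid]].
  - by apply: continuousM; [exact: ccst | exact: cid].
  - by apply: continuousM; [exact: cid | apply: continuousD; [exact: ccst | exact: cid]].
  - by apply: continuousM; [exact: ccst | exact: cid].
have cD x : {for x, continuous D}.
  rewrite /D; have -> : (fun x => B x ^+ 2 - 4 * A x * (V * Y0 * x * (1 + x))) =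
     (fun x => B x * B x - 4 * A x * (V * Y0 * x * (1 + x))) by apply/funext => y;
       rewrite expr2.
  apply: continuousB; first by apply: continuousM; exact: cB.
  apply: continuousM; first by apply: continuousM; [exact: ccst | exact: cA].
  apply: continuousM; first by apply: continuousM; [exact: ccst | exact: cid].
  by apply: continuousD; [exact: ccst | exact: cid].
pose e := sgb R (N < 0)%R.
pose Yf x := (- B x + e * Num.sqrt (D x)) / (2 * A x).
have A0 x : 0 < x -> 0 < A x by move=> x0; rewrite /A addr_gt0 // mulr_gt0.
have cY x : 0 < x -> {for x, continuous Yf}.
  move=> x0; apply: continuousM; last first.
    apply: continuousV; first by rewrite mulf_neq0 ?pnatr_eq0 // gt_eqF ?A0.
    by apply: continuousM; [exact: ccst | exact: cA].
  apply: continuousD; first by apply: continuousN; exact: cB.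
  by apply: continuousM; [exact: ccst | apply: continuous_sqrt; exact: cD].
have DN : D X0 = N ^+ 2 by rewrite /D /N /A /B /dixon_lin; ring.
have YX0 : Yf X0 = Y0.
  rewrite /Yf DN /e sgb_lt0 /N /A -/(B X0).
  by field; rewrite gt_eqF // -/(A X0) A0.
have [k1 k10 pD] : exists2 k : R, 0 < k & forall y, X0 <= y <= X0 + k -> 0 < D y.
  by apply: continuous_pos_right; rewrite ?DN // lt_def sqrf_eq0 N0 sqr_ge0.
have [k2 k20 pY] : exists2 k : R, 0 < k & forall y, X0 <= y <= X0 + k -> 0 < Yf y.
  by apply: continuous_pos_right; rewrite ?YX0 //; exact: cY.
pose k := Num.min k1 k2.
have k0 : 0 < k by rewrite /k lt_min k10 k20.
have [kk1 kk2] : k <= k1 /\ k <= k2 by rewrite /k !ge_min !lexx orbT.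
pose X t := X0 + k * ramp t.
have Xitv t : X0 <= X t <= X0 + k.
  have /andP[h0 h1] := ramp_itv t; have := mulr_ge0 (ltW k0) h0.
  have : k * ramp t <= k * 1 by rewrite ler_pM2l.
  by rewrite /X; lra.
have Xpos t : 0 < X t by have /andP[h _] := Xitv t; apply: lt_le_trans h.
have cX : continuous X by exact: continuous_affine_ramp.
exists X, (fun t => Yf (X t)); split => //.
- by apply: continuous_pointwise => t; apply: (continuous_comp (cX t) (cY _ (Xpos t))).
- by rewrite /X ramp0 mulr0 addr0 YX0.
- rewrite /X ramp1 => /eqP; rewrite -subr_eq0 addrC addKr => /eqP; lra.
move=> t; have Y0t : 0 < Yf (X t) by apply: pY; have := Xitv t; lra.
split => //; have D0 : 0 < D (X t) by apply: pD; have := Xitv t; lra.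
have q : A (X t) * Yf (X t) ^+ 2 + B (X t) * Yf (X t) + V * Y0 * X t * (1 + X t) = 0.
  have s2 : (e * Num.sqrt (D (X t))) ^+ 2 = D (X t).
    by rewrite exprMn sgb_sqr mul1r sqr_sqrtr // ltW.
  have At := lt0r_neq0 (A0 _ (Xpos t)).
  apply: (@mulIr0 _ (4 * A (X t))); first by rewrite mulf_neq0 ?pnatr_eq0.
  transitivity ((e * Num.sqrt (D (X t))) ^+ 2 - D (X t)); last by rewrite s2 subrr.
  by rewrite /Yf /D; field.
move: (Xpos t) Y0t q; rewrite /A /B /dixon_lin; move: (Yf (X t)) => y; move: (X t) => x
  x0 y0 q.
have nz : 1 + x + y != 0 by rewrite gt_eqF //; lra.
apply/eqP; rewrite -subr_eq0; apply/eqP.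
transitivity ((0 : R) / (x * y * (1 + x + y))); last by rewrite mul0r.
rewrite -q; field; rewrite ?nz ?(lt0r_neq0 x0) ?(lt0r_neq0 y0) //.
Qed.

(** If the Y-derivative vanishes, the roles of X and Y are exchanged. The two derivatives, divided
    by X0 and Y0, are affine in (U, V), with (X0, Y0) as their only common zero. *)
Lemma dixon_path (U V X0 Y0 : R) :
  0 < U -> 0 < V -> 0 < X0 -> 0 < Y0 -> ~ (U = X0 /\ V = Y0) ->
  exists X Y : R -> R, [/\ continuous X, continuous Y,
    X 0 = X0 /\ Y 0 = Y0, X 1 <> X0 \/ Y 1 <> Y0 &
    forall t, [/\ 0 < X t, 0 < Y t &
      U * X0 / X t + V * Y0 / Y t + 1 = (1 + U + V) * (1 + X0 + Y0) / (1 + X t + Y t)]].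
Proof.
move=> U0 V0 X00 Y00 ne.
have [N0|N0] := eqVneq (2 * (U * X0 + X0) * Y0 + dixon_lin U V X0 Y0 X0) 0; last first.
  have [X [Y [h1 h2 h3 h4 h5]]] := dixon_path_half U0 V0 X00 Y00 N0.
  by exists X, Y; split => //; left.
have [M0|M0] := eqVneq (2 * (V * Y0 + Y0) * X0 + dixon_lin V U Y0 X0 Y0) 0; last first.
  have [Y [X [h1 h2 [h3 h3'] h4 h5]]] := dixon_path_half V0 U0 Y00 X00 M0.
  exists X, Y; split => //; first by right.
  move=> t; have [? ? e] := h5 t; split => //.
  by rewrite [U * _ / _ + _]addrC e (addrAC 1) (addrAC 1 X0) (addrAC 1 (X t)).
exfalso; apply: ne.
have n : U * Y0 + Y0 - V * (1 + X0) = 0.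
  by apply: (mulIr0 (lt0r_neq0 X00)); rewrite -[RHS]N0 /dixon_lin; ring.
have m : V * X0 + X0 - U * (1 + Y0) = 0.
  by apply: (mulIr0 (lt0r_neq0 Y00)); rewrite -[RHS]M0 /dixon_lin; ring.
have z0 : 1 + X0 + Y0 != 0 by rewrite gt_eqF //; lra.
have UX : U = X0.
  apply/eqP; rewrite -subr_eq0; apply/eqP/(mulIr0 z0).
  transitivity ((U * Y0 + Y0 - V * (1 + X0)) * - X0 - (V * X0 + X0 - U * (1 + Y0)) * (1
    + X0)).
    ring.
  by rewrite n m; ring.
by split => //; move: n m; rewrite UX; lra.
Qed.

(** Three vertices of a rectangle span a side in each direction. Such a side has product 1 + 2 X or
    1 + 2 Y, which detects the motion in [flexible_D2]. *)
Lemma rectangle_side (I : finType) (b : I -> bool * bool) : injective b -> (2 < #|I|)%N ->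
  (exists i k, (b i).1 != (b k).1 /\ (b i).2 = (b k).2) /\
  (exists i k, (b i).1 = (b k).1 /\ (b i).2 != (b k).2).
Proof.
move=> binj I3.
have pig (f : bool * bool -> bool) : exists i k, i != k /\ f (b i) = f (b k).
  apply: contrapT => H.
  have /leq_card : injective (fun i => f (b i)).
    move=> i k e; apply/eqP; apply: contrapT => /negP ik; apply: H.
    by exists i, k.
  by rewrite card_bool leqNgt I3.
split.
- have [i [k [ik e]]] := pig snd; exists i, k; split => //.
  apply: contra ik => /eqP e1; apply/eqP/binj.
  by move: e e1; case: (b i) (b k) => ? ? [? ?] /= -> ->.
- have [i [k [ik e]]] := pig fst; exists i, k; split => //.
  apply: contra ik => /eqP e1; apply/eqP/binj.
  by move: e e1; case: (b i) (b k) => ? ? [? ?] /= -> ->.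
Qed.

Lemma flexible_D2 m n (p : 'I_m -> hplane R) (q : 'I_n -> hplane R) :
  (2 < m)%N -> (2 < n)%N -> non_overlapping p q -> condition_D2 p q -> flexible p q.
Proof.
move=> m3 n3 [pinj qinj fw] /condition_D2_rectangles.
move=> [c [v [w [x0 [y0 [z0 [x1 [y1 [z1 [fr [X0 Y0 Z0 nz0] [X1 Y1 Z1 nz1] hp hq]]]]]]]]]].
have /choice[b bP] : forall i, exists b : bool * bool,
    hval (p i) = lincomb c v w (sgb R b.1 * x0) (sgb R b.2 * y0) z0.
  by move=> i; have [b1 [b2 e]] := hp i; exists (b1, b2).
have /choice[d dP] : forall j, exists d : bool * bool,
    hval (q j) = lincomb c v w (sgb R d.1 * x1) (sgb R d.2 * y1) z1.
  by move=> i; have [b1 [b2 e]] := hq i; exists (b1, b2).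
have binj : injective b by move=> i k e; apply/pinj/hval_inj; rewrite !bP e.
have dinj : injective d by move=> i k e; apply/qinj/hval_inj; rewrite !dP e.
(* If the rectangles coincided, at least six distinct joints would occupy four vertices. *)
have ne : ~ (x1 ^+ 2 = x0 ^+ 2 /\ y1 ^+ 2 = y0 ^+ 2).
  move=> [ex ey]; have {}ex := sqr_eq_pos X1 X0 ex; have {}ey := sqr_eq_pos Y1 Y0 ey.
  have ez : z1 = z0 by apply: sqr_eq_pos => //; rewrite nz1 nz0 ex ey.
  pose h (s : 'I_m + 'I_n) := match s with inl i => b i | inr j => d j end.
  have /leq_card : injective h.
    move=> [i|j] [k|l] /= e; first by rewrite (binj _ _ e).
    - by case: (fw i l); apply: hval_inj; rewrite bP dP e ex ey ez.
    - by case: (fw k j); apply: hval_inj; rewrite bP dP e ex ey ez.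
    - by rewrite (dinj _ _ e).
  rewrite card_sum !card_ord card_prod card_bool => mn4.
  by have := leq_trans (leq_add m3 n3) mn4.
have sqr0 (r : R) : 0 < r -> 0 < r ^+ 2 by apply: exprn_gt0.
have [X [Y [cX cY [X_0 Y_0] XY1 H]]] := dixon_path (sqr0 _ X1) (sqr0 _ Y1) (sqr0 _ X0)
  (sqr0 _ Y0) ne.
pose Z t := 1 + X t + Y t.
have XP t : 0 < X t by have [] := H t.
have YP t : 0 < Y t by have [] := H t.
have ZP t : 0 < Z t by rewrite /Z !addr_gt0.
have cZ : continuous Z.
  apply: continuous_pointwise => t; apply: continuousD; last exact: cY.
  by apply: continuousD; [exact: cvg_cst | exact: cX].
pose sx t := Num.sqrt (X t); pose sy t := Num.sqrt (Y t); pose sz t := Num.sqrt (Z t).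
have csx : continuous sx by apply: continuous_pointwise => t; apply: continuous_sqrt;
  exact: cX.
have csy : continuous sy by apply: continuous_pointwise => t; apply: continuous_sqrt;
  exact: cY.
have csz : continuous sz by apply: continuous_pointwise => t; apply: continuous_sqrt;
  exact: cZ.
have sxP t : 0 < sx t by rewrite sqrtr_gt0.
have syP t : 0 < sy t by rewrite sqrtr_gt0.
have szP t : 0 < sz t by rewrite sqrtr_gt0.
have sx2 t : sx t ^+ 2 = X t by rewrite sqr_sqrtr // ltW.
have sy2 t : sy t ^+ 2 = Y t by rewrite sqr_sqrtr // ltW.
have sz2 t : sz t ^+ 2 = Z t by rewrite sqr_sqrtr // ltW.
have Z_0 : Z 0 = z0 ^+ 2 by rewrite /Z X_0 Y_0 nz0.
have sx_0 : sx 0 = x0 by apply: sqr_eq_pos; rewrite // sx2 X_0.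
have sy_0 : sy 0 = y0 by apply: sqr_eq_pos; rewrite // sy2 Y_0.
have sz_0 : sz 0 = z0 by apply: sqr_eq_pos; rewrite // sz2 Z_0.
(* Each coordinate of the q's varies inversely to that of the p's, so every term of [hdot_lincomb2]
   is constant. The equation of [dixon_path] says that the q's stay on the hyperboloid. *)
pose P t i := frame_point c v w (sgb R (b i).1 * sx t) (sgb R (b i).2 * sy t) (sz t).
pose Q t j := frame_point c v w (sgb R (d j).1 * (x1 * x0 / sx t))
   (sgb R (d j).2 * (y1 * y0 / sy t)) (z1 * z0 / sz t).
have pz t i : 0 < sz t /\ sz t ^+ 2 = 1 + (sgb R (b i).1 * sx t) ^+ 2 + (sgb R (b i).2
  * sy t) ^+ 2.
  by rewrite !exprMn !sgb_sqr !mul1r sx2 sy2 sz2.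
have qz t j : 0 < z1 * z0 / sz t /\ (z1 * z0 / sz t) ^+ 2 =
    1 + (sgb R (d j).1 * (x1 * x0 / sx t)) ^+ 2 + (sgb R (d j).2 * (y1 * y0 / sy t)) ^+ 2.
  have [_ _ e] := H t.
  split; first by rewrite divr_gt0 // mulr_gt0.
  rewrite !exprMn !exprVn !sgb_sqr !mul1r sx2 sy2 sz2 nz1 nz0 -/(Z t) in e *.
  by rewrite -e; ring.
have PE t i : hval (P t i) = lincomb c v w (sgb R (b i).1 * sx t) (sgb R (b i).2 * sy
  t) (sz t).
  by have [h1 h2] := pz t i; exact: frame_pointK.
have QE t j : hval (Q t j) = lincomb c v w (sgb R (d j).1 * (x1 * x0 / sx t))
   (sgb R (d j).2 * (y1 * y0 / sy t)) (z1 * z0 / sz t).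
  by have [h1 h2] := qz t j; exact: frame_pointK.
have cdiv (k : R) (f : R -> R) : continuous f -> (forall t, 0 < f t) -> continuous (fun
  t => k / f t).
  move=> cf f0; apply: continuous_pointwise => t; apply: continuousM; first exact:
    cvg_cst.
  by apply: continuousV; [rewrite gt_eqF | exact: cf].
have cmul (k : R) (f : R -> R) : continuous f -> continuous (fun t => k * f t).
  by move=> cf; apply: continuous_pointwise => t; apply: continuousM; [exact: cvg_cst |
    exact: cf].
apply: (@flexible_of_motion _ _ _ p q P Q (Ordinal (ltnW (ltnW m3))) (Ordinal (ltnW
  (ltnW n3)))) => //.
- move=> i; apply: continuous_frame_point => //; try exact: cmul; by move=> t; exact: pz.
- move=> j; apply: continuous_frame_point => //.
  + by apply: cmul; apply: cdiv.
  + by apply: cmul; apply: cdiv.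
  + exact: cdiv.
- by move=> i; apply: hval_inj; rewrite PE bP sx_0 sy_0 sz_0.
- move=> j; apply: hval_inj; rewrite QE dP sx_0 sy_0 sz_0.
  by rewrite !mulfK ?gt_eqF.
- move=> t i j; rewrite PE QE bP dP !(hdot_lincomb2 fr).
  by field; rewrite !gt_eqF.
have [[i [k [b1 b2]]] [i' [k' [b1' b2']]]] :
  (exists i k, (b i).1 != (b k).1 /\ (b i).2 = (b k).2) /\
  (exists i k, (b i).1 = (b k).1 /\ (b i).2 != (b k).2).
  by apply: rectangle_side; rewrite ?card_ord.
have sgbne (a a' : bool) : a != a' -> sgb R a * sgb R a' = - 1.
  by case: a a' => -[] // _; rewrite /sgb expr1 expr0; ring.
case: XY1 => ne1.
- exists i, k; rewrite !PE !bP !(hdot_lincomb2 fr) b2 => e; apply: ne1.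
  have s2 := sgb_mul R (b k).2; have s1 := sgbne _ _ b1.
  have key (xx yy zz : R) : - (sgb R (b i).1 * xx * (sgb R (b k).1 * xx)) - sgb R (b
    k).2 * yy * (sgb R (b k).2 * yy) + zz * zz
    = xx ^+ 2 - yy ^+ 2 + zz ^+ 2.
    transitivity (- (sgb R (b i).1 * sgb R (b k).1) * xx ^+ 2 - (sgb R (b k).2 * sgb R
      (b k).2) * yy ^+ 2 + zz ^+ 2); first by ring.
    by rewrite s1 s2; ring.
  by move: e; rewrite !key sx2 sy2 sz2 nz0 /Z; lra.
- exists i', k'; rewrite !PE !bP !(hdot_lincomb2 fr) b1' => e; apply: ne1.
  have s2 := sgb_mul R (b k').1; have s1 := sgbne _ _ b2'.
  have key (xx yy zz : R) : - (sgb R (b k').1 * xx * (sgb R (b k').1 * xx)) - sgb R (b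
    i').2 * yy * (sgb R (b k').2 * yy) + zz * zz
    = - xx ^+ 2 + yy ^+ 2 + zz ^+ 2.
    transitivity (- (sgb R (b k').1 * sgb R (b k').1) * xx ^+ 2 - (sgb R (b i').2 * sgb
      R (b k').2) * yy ^+ 2 + zz ^+ 2); first by ring.
    by rewrite s1 s2; ring.
  by move: e; rewrite !key sx2 sy2 sz2 nz0 /Z; lra.
Qed.
End DixonFlex.

(** * Frameworks with distance matrix of rank one or two *)

Section LowRank.
Local Open Scope classical_set_scope.
Local Open Scope ring_scope.
Variable R : realType.

(** np and nq are normals to the lines p0 p1 and q0 q1, and their product is itself a 2x2 minor. The
    Gram determinant of (p0, p1, pk) against (q0, q1, nq) expands along nq into 2x2 minors; as nq
    has nonzero norm, pk lies on the line p0 p1. *)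
Lemma condition_D1_of_minors m n (p : 'I_m -> hplane R) (q : 'I_n -> hplane R)
    (i0 i1 : 'I_m) (j0 j1 : 'I_n) :
  p i0 <> p i1 -> q j0 <> q j1 ->
  (forall i k j l, hdot (p i) (q j) * hdot (p k) (q l) =
     hdot (p i) (q l) * hdot (p k) (q j)) -> condition_D1 p q.
Proof.
move=> p01 q01 minors.
pose np := crossv (p i0) (p i1); pose nq := crossv (q j0) (q j1).
have npp : 0 < - hdot np np.
  by rewrite hdot_crossv2 !hdotxx mulr1 oppr_gt0 subr_lt0 exprn_egt1 // hdot_gt1.
have nqq : 0 < - hdot nq nq.
  by rewrite hdot_crossv2 !hdotxx mulr1 oppr_gt0 subr_lt0 exprn_egt1 // hdot_gt1.
have npq : hdot np nq = 0.
  transitivity (hdot (p i0) (q j0) * hdot (p i1) (q j1) - hdot (p i0) (q j1) * hdot (p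
    i1) (q j0)).
    by rewrite /hdot /lorentz !mxE /=; ring.
  by rewrite (minors i0 i1 j0 j1) subrr.
have np_p k : hdot np (p k) = 0.
  apply: (mulIr0 (lt0r_neq0 nqq)).
  transitivity (- (vol (p i0) (p i1) (p k) * vol (q j0) (q j1) nq)); first by rewrite
    !hdot_crossv; ring.
  rewrite vol_mul /det3.
  transitivity (- (hdot (p i0) nq * (hdot (p i1) (q j0) * hdot (p k) (q j1) - hdot (p
    i1) (q j1) * hdot (p k) (q j0))
    - hdot (p i1) nq * (hdot (p i0) (q j0) * hdot (p k) (q j1) - hdot (p i0) (q j1) *
        hdot (p k) (q j0))
    + hdot (p k) nq * (hdot (p i0) (q j0) * hdot (p i1) (q j1) - hdot (p i0) (q j1) *
        hdot (p i1) (q j0)))).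
    by ring.
  by rewrite (minors i1 k j0 j1) (minors i0 k j0 j1) (minors i0 i1 j0 j1) !subrr; ring.
have nq_q l : hdot nq (q l) = 0.
  apply: (mulIr0 (lt0r_neq0 npp)).
  transitivity (- (vol (p i0) (p i1) np * vol (q j0) (q j1) (q l))); first by rewrite
    !hdot_crossv; ring.
  rewrite vol_mul /det3.
  transitivity (- (hdot np (q j0) * (hdot (p i0) (q j1) * hdot (p i1) (q l) - hdot (p
    i0) (q l) * hdot (p i1) (q j1))
   - hdot np (q j1) * (hdot (p i0) (q j0) * hdot (p i1) (q l) - hdot (p i0) (q l) *
       hdot (p i1) (q j0))
   + hdot np (q l) * (hdot (p i0) (q j0) * hdot (p i1) (q j1) - hdot (p i0) (q j1) *
       hdot (p i1) (q j0)))).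
    by ring.
  by rewrite (minors i0 i1 j1 l) (minors i0 i1 j0 l) (minors i0 i1 j0 j1) !subrr; ring.
have unit (x : 'rV[R]_3) : 0 < - hdot x x ->
    hdot ((Num.sqrt (- hdot x x))^-1 *: x) ((Num.sqrt (- hdot x x))^-1 *: x) = - 1.
  move=> x0; rewrite hdotZl hdotZr mulrA -invfM -expr2 sqr_sqrtr ?ltW //.
  by rewrite invrN mulNr mulVf // -oppr_eq0 gt_eqF.
(* The normal of each line is the direction of the other. *)
have [|c fr] := @orthoframe_exists _ _ _ (unit _ nqq) (unit _ npp).
  by rewrite hdotZl hdotZr hdotC npq !mulr0.
have [h1 h2 h3] := frame_orthogonal_lines fr.
exists (geodesic c ((Num.sqrt (- hdot nq nq))^-1 *: nq)), (geodesic c ((Num.sqrt (-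
  hdot np np))^-1 *: np)).
split => //.
- by move=> i; apply/(geodesicP fr); rewrite hdotZr hdotC np_p mulr0.
- by move=> j; apply/(geodesicP (orthoframe_sym fr)); rewrite hdotZr hdotC nq_q mulr0.
Qed.

Lemma collinear_expand (a b c : hplane R) : a <> b -> vol a b c = 0 ->
  hval c = ((hdot c a - hdot a b * hdot c b) / (1 - hdot a b ^+ 2)) *: hval a
    + ((hdot c b - hdot a b * hdot c a) / (1 - hdot a b ^+ 2)) *: hval b.
Proof.
move=> ab v0; have h : 1 - hdot a b ^+ 2 != 0.
  by rewrite subr_eq0 eq_sym gt_eqF // exprn_egt1 // hdot_gt1.
apply: (vol_inj (vol_crossv_neq0 ab)); rewrite !hdotE ?(hdotC b a) ?hdotxx.
- by field.
- by field.
by rewrite !(hdotC _ (crossv a b)) hdot_crossvl hdot_crossvr hdot_crossv v0; ring.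
Qed.

(** On the line, p k = B p i0 + G p i1 with B, G given by C through Cramer's rule, mu being the
    determinant. The norm of a third point p i2 then determines the product h of p i0 and p i1,
    hence all products among the p's, and the heights of the q's up to sign. *)
Lemma collinear_finite (T : Type) (I : set T) m n (P : T -> 'I_m -> hplane R)
    (Q : T -> 'I_n -> hplane R) (C : 'I_m -> 'I_n -> R) (i0 i1 i2 : 'I_m) (j0 j1 : 'I_n) :
  i2 != i0 -> i2 != i1 ->
  (forall t i j, I t -> hdot (P t i) (Q t j) = C i j) ->
  (forall t, I t -> injective (P t)) ->
  C i0 j0 * C i1 j1 - C i0 j1 * C i1 j0 != 0 ->
  (forall t k, I t -> vol (P t i0) (P t i1) (P t k) = 0) ->
  (forall i k, finite_set ((fun t => hdot (P t i) (P t k)) @` I)) /\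
  (forall j l, finite_set ((fun t => hdot (Q t j) (Q t l)) @` I)).
Proof.
move=> i20 i21 PQ Pinj mu0 vol0; set mu := _ - _ in mu0.
have i01 : i0 != i1 by apply: contra mu0 => /eqP e; rewrite /mu e mulrC subrr.
pose B k := (C k j0 * C i1 j1 - C k j1 * C i1 j0) / mu.
pose G k := (C i0 j0 * C k j1 - C i0 j1 * C k j0) / mu.
have PE t k : I t -> hval (P t k) = B k *: hval (P t i0) + G k *: hval (P t i1).
  move=> It; have ne : P t i0 <> P t i1 by move=> /(Pinj _ It) e; rewrite e eqxx in i01.
  rewrite (collinear_expand ne (vol0 t k It)).
  set x := _ / _; set y := _ / _.
  have e j : C k j = x * C i0 j + y * C i1 j.
    by rewrite -!(PQ t) // (collinear_expand ne (vol0 t k It)) -/x -/y !hdotE.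
  congr (_ *: _ + _ *: _).
    by rewrite /B (e j0) (e j1) /mu; field.
  by rewrite /G (e j0) (e j1) /mu; field.
clearbody B G.
pose h := (1 - B i2 ^+ 2 - G i2 ^+ 2) / (2 * B i2 * G i2).
have hE t : I t -> hdot (P t i0) (P t i1) = h.
  move=> It.
  have norm : 1 = B i2 ^+ 2 + G i2 ^+ 2 + 2 * B i2 * G i2 * hdot (P t i0) (P t i1).
    rewrite -[LHS](hdotxx (P t i2)) (PE t i2) // !hdotE !(hdotC (P t i1) (P t i0))
      !hdotxx; ring.
  (* If B or G vanished, p i2 would be proportional to p i1 or p i0, and so equal to it. *)
  have absurd k (x : R) : k != i2 -> hval (P t i2) = x *: hval (P t k) -> False.
    move=> ki e; have x2 : x ^+ 2 = 1.
      by rewrite -(hdotxx (P t i2)) e !hdotE hdotxx; ring.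
    have x0 : 0 < x.
      rewrite -[x]mulr1 -(hdotxx (P t k)) -hdotZl -e; exact: lt_le_trans (hdot_ge1 _ _).
    have x1 : x = 1 by apply: sqr_eq_pos; rewrite // x2 expr1n.
    move: e; rewrite x1 scale1r => /hval_inj/(Pinj _ It) e.
    by rewrite e eqxx in ki.
  have B0 : B i2 != 0.
    apply/eqP => B0; apply: (absurd i1 (G i2)); first by rewrite eq_sym.
    by rewrite (PE t i2) // B0 scale0r add0r.
  have G0 : G i2 != 0.
    apply/eqP => G0; apply: (absurd i0 (B i2)); first by rewrite eq_sym.
    by rewrite (PE t i2) // G0 scale0r addr0.
  have nz : 2 * B i2 * G i2 != 0 by apply: mulf_neq0 => //; apply: mulf_neq0 => //;
    rewrite pnatr_eq0.
  apply: (mulfI nz); transitivity (1 - B i2 ^+ 2 - G i2 ^+ 2); first by move: norm; lra.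
  by rewrite /h [RHS]mulrC divfK.
split=> [i k|j l].
  apply: (@sub_finite_set _ _ [set B i * B k + G i * G k + h * (B i * G k + G i * B k)]).
    move=> _ [t It <-] /=; rewrite (PE t i) // (PE t k) // !hdotE !(hdotC (P t i1) (P t
      i0)) !hdotxx hE //.
    by ring.
  exact: finite_set1.
pose s2 j := 1 - h ^+ 2 - C i0 j ^+ 2 - C i1 j ^+ 2 + 2 * h * C i0 j * C i1 j.
pose r := Num.sqrt (s2 j * s2 l).
(* The product of q j and q l is affine in the product of their heights, whose square depends only
   on C. *)
pose f (x : R) := (x + C i0 j * C i0 l + C i1 j * C i1 l - h * (C i0 j * C i1 l + C i1
  j * C i0 l)) / (1 - h ^+ 2).
have volE t j' l' : I t -> vol (P t i0) (P t i1) (Q t j') * vol (P t i0) (P t i1) (Q t l')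
   = hdot (Q t j') (Q t l') * (1 - h ^+ 2) - C i0 j' * C i0 l' - C i1 j' * C i1 l' + h
     * (C i0 j' * C i1 l' + C i1 j' * C i0 l').
  move=> It; rewrite vol_mul /det3 !(hdotC (Q t j') (P _ _)) !PQ // !(hdotC (P t i1) (P
    t i0)) !hdotxx hE //.
  by ring.
apply: (@sub_finite_set _ _ [set f r; f (- r)]); last exact: finite_set2.
move=> _ [t It <-] /=.
have ne : P t i0 <> P t i1 by move=> /(Pinj _ It) e; rewrite e eqxx in i01.
have h1 : 1 - h ^+ 2 != 0.
  by rewrite -(hE t It) subr_eq0 eq_sym gt_eqF // exprn_egt1 // hdot_gt1.
pose s j' := vol (P t i0) (P t i1) (Q t j').
have sE j' : s j' ^+ 2 = s2 j'.
  by rewrite expr2 /s volE // hdotxx /s2; ring.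
have qE : hdot (Q t j) (Q t l) = f (s j * s l).
  by rewrite /f /s volE //; field.
have rr : (s j * s l) ^+ 2 = r ^+ 2.
  by rewrite exprMn !sE /r sqr_sqrtr // -!sE mulr_ge0 // sqr_ge0.
move/eqP: rr; rewrite eqf_sqr => /orP[] /eqP e; rewrite qE e; [by left | by right].
Qed.
End LowRank.

(** * Frameworks with distance matrix of rank three *)

Section FullRank.
Local Open Scope classical_set_scope.
Local Open Scope ring_scope.
Variables (R : realType) (m n : nat) (C : 'I_m -> 'I_n -> R).

Definition minor3 k1 k2 k3 j1 j2 j3 := det3 (C k1 j1) (C k1 j2) (C k1 j3)
  (C k2 j1) (C k2 j2) (C k2 j3) (C k3 j1) (C k3 j2) (C k3 j3).

Definition realizes (P : 'I_m -> hplane R) (Q : 'I_n -> hplane R) :=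
  forall i j, hdot (P i) (Q j) = C i j.

(** Equivalently, P l2 + P l3 - P l1 has norm 1: it is the fourth vertex of a rectangle with
    diagonal l2 l3. *)
Definition right_angled (P : 'I_m -> hplane R) l1 l2 l3 :=
  hdot (P l2) (P l3) = hdot (P l1) (P l2) + hdot (P l1) (P l3) - 1.

Lemma minor3_vol P Q k1 k2 k3 j1 j2 j3 : realizes P Q ->
  minor3 k1 k2 k3 j1 j2 j3 = vol (P k1) (P k2) (P k3) * vol (Q j1) (Q j2) (Q j3).
Proof. by move=> PQ; rewrite vol_mul !PQ. Qed.

Section Curve.
Variables (T : Type) (I : set T) (P : T -> 'I_m -> hplane R) (Q : T -> 'I_n -> hplane R).
Hypothesis PQ : forall t, I t -> realizes (P t) (Q t).

(** In one of the cases k1 k2 is the diagonal. Its product is then a function of those of the two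
    sides, so the pair of sides takes infinitely many values as well. *)
Lemma right_angled_of_infinite k1 k2 k3 j1 j2 j3 : (forall i j, 1 < C i j) ->
  minor3 k1 k2 k3 j1 j2 j3 != 0 ->
  infinite_set ((fun t => hdot (P t k1) (P t k2)) @` I) ->
  exists l1 l2 l3, minor3 l1 l2 l3 j1 j2 j3 != 0 /\ exists J : set T, [/\ J `<=` I,
    infinite_set ((fun t => (hdot (P t l1) (P t l2), hdot (P t l1) (P t l3))) @` J) &
    forall t, J t -> right_angled (P t) l1 l2 l3].
Proof.
move=> C1 d0 infa.
have [] := @rectangle_of_curve R T I (fun t => hdot (P t k1) (P t k2))
  (fun t => hdot (P t k1) (P t k3)) (fun t => hdot (P t k2) (P t k3))
  (fun t => vol (P t k1) (P t k2) (P t k3))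
  (fun t => vol (P t k1) (P t k2) (Q t j1)) (fun t => vol (P t k1) (P t k2) (Q t j2))
  (fun t => vol (P t k1) (P t k2) (Q t j3)) (C k1 j1) (C k1 j2) (C k1 j3)
  (C k2 j1) (C k2 j2) (C k2 j3) (C k3 j1) (C k3 j2) (C k3 j3) => //.
  move=> t It; have ne : P t k1 <> P t k2.
    move=> e; move: d0; rewrite (minor3_vol _ _ _ _ _ _ (PQ It)) e /vol /det3.
    by rewrite mulf_eq0 negb_or => /andP[/eqP h _]; apply: h; ring.
  have pq i j : hdot (Q t j) (P t i) = C i j by rewrite hdotC PQ.
  have p21 : hdot (P t k2) (P t k1) = hdot (P t k1) (P t k2) by rewrite hdotC.
  have p31 : hdot (P t k3) (P t k1) = hdot (P t k1) (P t k3) by rewrite hdotC.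
  have p32 : hdot (P t k3) (P t k2) = hdot (P t k2) (P t k3) by rewrite hdotC.
  split; first exact: hdot_gt1.
  - by rewrite expr2 vol_mul p21 p31 p32 !hdotxx /det3; ring.
  - by split; rewrite vol_mul /det3 p21 p31 p32 !hdotxx !(PQ It); ring.
  - by rewrite expr2 vol_mul /det3 p21 !pq !hdotxx !(PQ It) horner_discr_poly; ring.
  - by split; rewrite expr2 vol_mul /det3 p21 !pq !hdotxx !(PQ It) horner_discr_poly;
      ring.
move=> J [JI infJ rect].
have pairs (f g : T -> R) (h : R * R -> R) :
    (forall t, J t -> hdot (P t k1) (P t k2) = h (f t, g t)) ->
    infinite_set ((fun t => (f t, g t)) @` J).
  move=> fg fin; apply: infJ; apply: (@sub_finite_set _ _ (h @` ((fun t => (f t, g t))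
    @` J))).
    by move=> _ [t Jt <-]; exists (f t, g t); [exists t | rewrite fg].
  exact: finite_image.
case: rect => [h|[h|h]].
- exists k2, k1, k3; split.
    by apply: contra d0 => /eqP d0; rewrite -oppr_eq0 -d0 /minor3 /det3; apply/eqP; ring.
  exists J; split => //.
    by apply: (pairs _ _ fst) => t _ /=; rewrite hdotC.
  by move=> t /h; rewrite /right_angled (hdotC (P t k2) (P t k1)).
- exists k1, k2, k3; split => //; exists J; split => //; first exact: (pairs _ _ fst).
- exists k3, k1, k2; split.
    by apply: contra d0 => /eqP d0; rewrite -d0 /minor3 /det3; apply/eqP; ring.
  exists J; split => //.
    by apply: (pairs _ _ (fun z => z.1 + z.2 - 1)) => t /h -> /=; rewrite !(hdotC (P t
      k3)).
  by move=> t /h; rewrite /right_angled !(hdotC (P t k3)).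
Qed.
End Curve.

(** Products of q j with a half side and with the midpoint of a diagonal, as in [axes_Q]: they are
    constant along a motion although the axes move. *)
Definition halfdiff k l j : R := (C k j - C l j) / 2.
Definition halfsum k l j : R := (C k j + C l j) / 2.

(** * The axes given by three vertices of a rectangle *)

Section RectangleFrame.
Variables (P : 'I_m -> hplane R) (Q : 'I_n -> hplane R) (l1 l2 l3 : 'I_m) (j1 j2 j3 :
  'I_n).
Hypothesis PQ : realizes P Q.
Hypothesis det0 : minor3 l1 l2 l3 j1 j2 j3 != 0.
Hypothesis rect : right_angled P l1 l2 l3.

Definition axis1 : 'rV[R]_3 := (1 / 2) *: (hval (P l1) - hval (P l2)).
Definition axis2 : 'rV[R]_3 := (1 / 2) *: (hval (P l1) - hval (P l3)).
Definition center : 'rV[R]_3 := (1 / 2) *: (hval (P l2) + hval (P l3)).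
Definition sqx : R := (hdot (P l1) (P l2) - 1) / 2.
Definition sqy : R := (hdot (P l1) (P l3) - 1) / 2.

Lemma sqx_gt0 : 0 < sqx.
Proof.
rewrite /sqx divr_gt0 // subr_gt0 hdot_gt1 // => e; move: det0.
rewrite (minor3_vol _ _ _ _ _ _ PQ) e /vol /det3 mulf_eq0 negb_or => /andP[/eqP h _].
by apply: h; ring.
Qed.

Lemma sqy_gt0 : 0 < sqy.
Proof.
rewrite /sqy divr_gt0 // subr_gt0 hdot_gt1 // => e; move: det0.
rewrite (minor3_vol _ _ _ _ _ _ PQ) e /vol /det3 mulf_eq0 negb_or => /andP[/eqP h _].
by apply: h; ring.
Qed.

Lemma axes_hdot : [/\ hdot axis1 axis1 = - sqx, hdot axis2 axis2 = - sqy &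
  hdot center center = 1 + sqx + sqy] /\
  [/\ hdot axis1 axis2 = 0, hdot axis1 center = 0 & hdot axis2 center = 0].
Proof.
rewrite /axis1 /axis2 /center /sqx /sqy !hdotE !hdotxx.
rewrite !(hdotC (P l2) (P l1)) !(hdotC (P l3) (P l1)) !(hdotC (P l3) (P l2)) rect.
by split; split; field.
Qed.

Lemma axes_Q j : [/\ hdot (Q j) axis1 = halfdiff l1 l2 j, hdot (Q j) axis2 = halfdiff
  l1 l3 j &
  hdot (Q j) center = halfsum l2 l3 j].
Proof.
rewrite /axis1 /axis2 /center /halfdiff /halfsum !hdotE !(hdotC (Q j)) !PQ.
by split; field.
Qed.

Lemma center_gt0 i : 0 < hdot (P i) center.
Proof.
rewrite /center !hdotE; have := hdot_ge1 (P i) (P l2); have := hdot_ge1 (P i) (P l3); lra.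
Qed.

Lemma sqz_gt0 : 0 < 1 + sqx + sqy.
Proof. by have := sqx_gt0; have := sqy_gt0; lra. Qed.

Lemma halfsum_gt0 j : 0 < halfsum l2 l3 j.
Proof. by rewrite /halfsum -!PQ; have := hdot_ge1 (P l2) (Q j); have := hdot_ge1 (P l3)
  (Q j); lra. Qed.

Lemma axes_norm x y : hdot x y = - (hdot x axis1 * hdot y axis1 / sqx) - hdot x axis2 *
  hdot y axis2 / sqy
  + hdot x center * hdot y center / (1 + sqx + sqy).
Proof.
have [[h1 h2 h3] [h4 h5 h6]] := axes_hdot.
exact: (frame_hdot (lt0r_neq0 sqx_gt0) (lt0r_neq0 sqy_gt0) (lt0r_neq0 sqz_gt0)).
Qed.

Lemma Q_vol_neq0 : vol (Q j1) (Q j2) (Q j3) != 0.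
Proof. by move: det0; rewrite (minor3_vol _ _ _ _ _ _ PQ) mulf_eq0 negb_or => /andP[].
  Qed.

(** Three of the q's form a basis, so a relation between rows of C is a relation between vectors.
    Its coefficients are therefore the same at all times. *)
Lemma P_of_coefs i al be ga :
  (forall j, C i j = ga * halfsum l2 l3 j - al * halfdiff l1 l2 j - be * halfdiff l1 l3
    j) ->
  hval (P i) = - al *: axis1 - be *: axis2 + ga *: center.
Proof.
move=> h; have key j : hdot (P i) (Q j) = hdot (- al *: axis1 - be *: axis2 + ga *:
  center) (Q j).
  rewrite PQ h; have := axes_Q j; move: axis1 axis2 center => E1 E2 O [h1 h2 h3].
  by rewrite !hdotE !(hdotC _ (hval (Q j))) h1 h2 h3; ring.
by apply: (vol_inj Q_vol_neq0); apply: key.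
Qed.

Lemma coefs_of_P i j : C i j = hdot (P i) center / (1 + sqx + sqy) * halfsum l2 l3 j
  - hdot (P i) axis1 / sqx * halfdiff l1 l2 j - hdot (P i) axis2 / sqy * halfdiff l1 l3 j.
Proof.
have [h1 h2 h3] := axes_Q j.
by rewrite -PQ axes_norm h1 h2 h3; ring.
Qed.

(** This is the norm of q j in the axes, equal to 1, with denominators cleared. *)
Lemma Q_dixon j : halfdiff l1 l2 j ^+ 2 * sqy * (1 + sqx + sqy)
   + halfdiff l1 l3 j ^+ 2 * sqx * (1 + sqx + sqy) + sqx * sqy * (1 + sqx + sqy)
  = halfsum l2 l3 j ^+ 2 * (sqx * sqy).
Proof.
have := axes_norm (Q j) (Q j); have [-> -> ->] := axes_Q j; rewrite hdotxx => e.
have x0 := lt0r_neq0 sqx_gt0; have y0 := lt0r_neq0 sqy_gt0; have z0 := lt0r_neq0 sqz_gt0.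
have -> : sqx * sqy * (1 + sqx + sqy) = 1 * (sqx * sqy * (1 + sqx + sqy)) by rewrite
  mul1r.
rewrite [X in X * (sqx * sqy * _)]e; field; rewrite ?x0 ?y0 ?z0 //.
Qed.

(** If it vanished for one j it would vanish for all, and rows l1 and l2 of C would coincide. *)
Lemma halfdiff12_neq0 : (forall j j', halfdiff l1 l2 j ^+ 2 = halfdiff l1 l2 j' ^+ 2) ->
  forall j, halfdiff l1 l2 j != 0.
Proof.
move=> same j; apply/eqP => u0.
have C12 j' : C l1 j' = C l2 j'.
  have : halfdiff l1 l2 j' = 0 by apply/eqP; rewrite -sqrf_eq0 (same j' j) u0 expr0n.
  by rewrite /halfdiff; lra.
by move: det0; rewrite /minor3 /det3 !C12 => /eqP; apply; ring.
Qed.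

Lemma halfdiff13_neq0 : (forall j j', halfdiff l1 l3 j ^+ 2 = halfdiff l1 l3 j' ^+ 2) ->
  forall j, halfdiff l1 l3 j != 0.
Proof.
move=> same j; apply/eqP => u0.
have C13 j' : C l1 j' = C l3 j'.
  have : halfdiff l1 l3 j' = 0 by apply/eqP; rewrite -sqrf_eq0 (same j' j) u0 expr0n.
  by rewrite /halfdiff; lra.
by move: det0; rewrite /minor3 /det3 !C13 => /eqP; apply; ring.
Qed.
End RectangleFrame.

(** A property of C alone, so that it can be proved at later times and used at the start. *)
Definition dixon_matrix l1 l2 l3 :=
  (forall j j', [/\ halfdiff l1 l2 j ^+ 2 = halfdiff l1 l2 j' ^+ 2,
     halfdiff l1 l3 j ^+ 2 = halfdiff l1 l3 j' ^+ 2 & halfsum l2 l3 j ^+ 2 = halfsum l2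
       l3 j' ^+ 2]) /\
  forall i, exists al be ga, [/\ al ^+ 2 = 1, be ^+ 2 = 1, ga ^+ 2 = 1 &
    forall j, C i j = ga * halfsum l2 l3 j - al * halfdiff l1 l2 j - be * halfdiff l1
      l3 j].

(** All q's give the same curve by [dixon_curve_inj]. The coefficients of p i in the moving axes are
    constant, so its norm is a linear relation between X and Y, which [dixon_curve_not_line] makes
    trivial: the coefficients are 1 or -1. *)
Lemma dixon_matrix_of_curve (T : Type) (J : set T) (P : T -> 'I_m -> hplane R)
    (Q : T -> 'I_n -> hplane R) l1 l2 l3 j1 j2 j3 :
  (forall t, J t -> realizes (P t) (Q t)) -> minor3 l1 l2 l3 j1 j2 j3 != 0 ->
  infinite_set ((fun t => (hdot (P t l1) (P t l2), hdot (P t l1) (P t l3))) @` J) ->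
  (forall t, J t -> right_angled (P t) l1 l2 l3) -> dixon_matrix l1 l2 l3.
Proof.
move=> PQ det0 inf_ab rect.
pose X t := sqx (P t) l1 l2; pose Y t := sqy (P t) l1 l3.
have X0 t : J t -> 0 < X t by move=> Jt; apply: (sqx_gt0 (PQ t Jt) det0).
have Y0 t : J t -> 0 < Y t by move=> Jt; apply: (sqy_gt0 (PQ t Jt) det0).
have infXY : infinite_set ((fun t => (X t, Y t)) @` J).
  move=> fin; apply: inf_ab.
  apply: (@sub_finite_set _ _ ((fun z : R * R => (2 * z.1 + 1, 2 * z.2 + 1)) @` ((fun t
    => (X t, Y t)) @` J))).
    move=> _ [t Jt <-]; exists (X t, Y t); first by exists t.
    by rewrite /= /X /Y /sqx /sqy; congr pair; field.
  exact: finite_image.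
have curve j : on_dixon_curve J X Y (halfdiff l1 l2 j ^+ 2) (halfdiff l1 l3 j ^+ 2)
  (halfsum l2 l3 j ^+ 2).
  by move=> t Jt; apply: (Q_dixon (PQ t Jt) det0 (rect t Jt)).
have same j j' : [/\ halfdiff l1 l2 j ^+ 2 = halfdiff l1 l2 j' ^+ 2,
     halfdiff l1 l3 j ^+ 2 = halfdiff l1 l3 j' ^+ 2 & halfsum l2 l3 j ^+ 2 = halfsum l2
       l3 j' ^+ 2].
  by apply: (dixon_curve_inj X0 Y0 infXY (sqr_ge0 _) (sqr_ge0 _) (curve j') (curve j)).
split=> // i.
have [_ [t0 Jt0 _]] := infinite_setN0 infXY.
pose al := hdot (P t0 i) (axis1 (P t0) l1 l2) / X t0.
pose be := hdot (P t0 i) (axis2 (P t0) l1 l3) / Y t0.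
pose ga := hdot (P t0 i) (center (P t0) l2 l3) / (1 + X t0 + Y t0).
have coef j : C i j = ga * halfsum l2 l3 j - al * halfdiff l1 l2 j - be * halfdiff l1
  l3 j.
  exact: (coefs_of_P (PQ t0 Jt0) det0 (rect t0 Jt0)).
have line t : J t -> al ^+ 2 * X t + be ^+ 2 * Y t + 1 = ga ^+ 2 * (1 + X t + Y t).
  move=> Jt; have [[h1 h2 h3] [h4 h5 h6]] := axes_hdot (rect t Jt).
  have := hdotxx (P t i); rewrite (P_of_coefs (PQ t Jt) det0 coef).
  move: h1 h2 h3 h4 h5 h6; rewrite -/(X t) -/(Y t).
  move: (axis1 _ _ _) (axis2 _ _ _) (center _ _ _) => E1 E2 O h1 h2 h3 h4 h5 h6.
  rewrite !hdotE !(hdotC O) !(hdotC E2 E1) h1 h2 h3 h4 h5 h6.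
  by move=> e; rewrite -[X in _ + _ + X = _]e; ring.
have u0 : 0 < halfdiff l1 l2 j1 ^+ 2.
  by rewrite lt_def sqr_ge0 andbT sqrf_eq0 (halfdiff12_neq0 det0) // => j j'; have []
    := same j j'.
have v0 : 0 < halfdiff l1 l3 j1 ^+ 2.
  by rewrite lt_def sqr_ge0 andbT sqrf_eq0 (halfdiff13_neq0 det0) // => j j'; have []
    := same j j'.
have [e1 e2 e3] := dixon_curve_not_line X0 Y0 infXY u0 v0 (curve j1) line.
by exists al, be, ga.
Qed.

Lemma condition_D2_of_dixon_matrix (p : 'I_m -> hplane R) (q : 'I_n -> hplane R)
    l1 l2 l3 j1 j2 j3 :
  realizes p q -> minor3 l1 l2 l3 j1 j2 j3 != 0 -> right_angled p l1 l2 l3 ->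
  dixon_matrix l1 l2 l3 -> condition_D2 p q.
Proof.
move=> pq det0 rect [same coefs].
have X0 := sqx_gt0 pq det0; have Y0 := sqy_gt0 pq det0; have Z0 := sqz_gt0 pq det0.
have [[h1 h2 h3] [h4 h5 h6]] := axes_hdot rect.
set X := sqx p l1 l2 in X0 Z0 h1 h3; set Y := sqy p l1 l3 in Y0 Z0 h2 h3.
set E1 := axis1 p l1 l2 in h1 h4 h5; set E2 := axis2 p l1 l3 in h2 h4 h6.
set O := center p l2 l3 in h3 h5 h6.
set Z := 1 + X + Y in Z0 h3.
have qE' j : [/\ hdot (q j) E1 = halfdiff l1 l2 j, hdot (q j) E2 = halfdiff l1 l3 j &
    hdot (q j) O = halfsum l2 l3 j] by exact: axes_Q.
have O_gt0 i : 0 < hdot (p i) O by exact: center_gt0.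
have pE i al be ga :
    (forall j, C i j = ga * halfsum l2 l3 j - al * halfdiff l1 l2 j - be * halfdiff l1
      l3 j) ->
    hval (p i) = - al *: E1 - be *: E2 + ga *: O by move=> h; exact: (P_of_coefs pq
      det0 h).
clearbody E1 E2 O.
pose sx := Num.sqrt X; pose sy := Num.sqrt Y; pose sz := Num.sqrt Z.
have sx0 : 0 < sx by rewrite sqrtr_gt0.
have sy0 : 0 < sy by rewrite sqrtr_gt0.
have sz0 : 0 < sz by rewrite sqrtr_gt0.
have sx2 : sx ^+ 2 = X by rewrite sqr_sqrtr // ltW.
have sy2 : sy ^+ 2 = Y by rewrite sqr_sqrtr // ltW.
have sz2 : sz ^+ 2 = Z by rewrite sqr_sqrtr // ltW.
have nx : sx != 0 by rewrite gt_eqF. have ny : sy != 0 by rewrite gt_eqF.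
have nz : sz != 0 by rewrite gt_eqF.
have po : (lorentz (sz^-1 *: O) (sz^-1 *: O) == -1) && (0 < (sz^-1 *: O) 0 2%:R).
  apply: (@upper_sheet _ _ (p l2)); first by rewrite !hdotE h3 -sz2; field.
  by rewrite hdotZl mulr_gt0 ?invr_gt0 // hdotC O_gt0.
pose o := HPlane po; pose v := sx^-1 *: E1; pose w := sy^-1 *: E2.
have fr : orthoframe o v w.
  apply/orthoframeE; rewrite /o /v /w /= !hdotE h1 h2 h4 h5 h6 -sx2 -sy2.
  by split; [field | field | rewrite !mulr0 | rewrite !mulr0 | rewrite !mulr0].
have ev : E1 = sx *: v by rewrite /v scalerA divff // scale1r.
have ew : E2 = sy *: w by rewrite /w scalerA divff // scale1r.
have eo : O = sz *: hval o by rewrite /= scalerA divff // scale1r.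
have [u0 v0] : halfdiff l1 l2 j1 != 0 /\ halfdiff l1 l3 j1 != 0.
  split; first by apply: (halfdiff12_neq0 det0) => j j'; have [] := same j j'.
  by apply: (halfdiff13_neq0 det0) => j j'; have [] := same j j'.
have qE j : [/\ hdot (q j) v = halfdiff l1 l2 j / sx, hdot (q j) w = halfdiff l1 l3 j /
  sy &
    hdot (q j) o = halfsum l2 l3 j / sz].
  have [k1 k2 k3] := qE' j.
  by rewrite /v /w /o /= !hdotZr k1 k2 k3; split; rewrite mulrC.
apply: (@condition_D2_of_rectangles _ _ _ p q o v w sx sy sz
   (halfdiff l1 l2 j1 / sx) (halfdiff l1 l3 j1 / sy) (halfsum l2 l3 j1 / sz)) => //.
- by rewrite sx2 sy2 sz2.
- by rewrite mulf_neq0 ?invr_eq0.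
- by rewrite mulf_neq0 ?invr_eq0.
- by rewrite divr_gt0 // (halfsum_gt0 _ _ pq).
- by have [<- <- <-] := qE j1; exact: hplane_norm.
- move=> i; have [al [be [ga [al1 be1 ga1 coef]]]] := coefs i.
  have piE := pE _ _ _ _ coef.
  (* Only the sign of ga is determined: all p's are on the side of the center. *)
  have ga0 : 0 < ga.
    rewrite -(pmulr_lgt0 _ Z0) -h3.
    have -> : ga * hdot O O = hdot (p i) O by rewrite piE !hdotE h5 h6; ring.
    exact: O_gt0.
  have gaE : ga = 1 by apply: sqr_eq_pos; rewrite // expr1n.
  have [b1 e1] : exists b, - al = sgb R b by apply: sqr_sgb; rewrite sqrrN.
  have [b2 e2] : exists b, - be = sgb R b by apply: sqr_sgb; rewrite sqrrN.
  exists b1, b2; rewrite piE gaE scale1r -scaleNr e1 e2.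
  by rewrite /lincomb -!scalerA -ev -ew -eo.
- move=> j; have [su sv sw] := same j j1.
  have div2 (x y z : R) : y != 0 -> x ^+ 2 = y ^+ 2 -> exists b, - (x / z) = sgb R b *
    (y / z).
    move=> y0 xy; have [b e] : exists b, - (x / y) = sgb R b.
      by apply: sqr_sgb; rewrite sqrrN exprMn exprVn xy divff // expf_neq0.
    exists b; rewrite -e mulNr; congr (- _).
    by rewrite mulrA divfK.
  have [b1 e1] := div2 _ _ sx u0 su; have [b2 e2] := div2 _ _ sy v0 sv.
  exists b1, b2; rewrite [LHS](lincombE fr); have [-> -> ->] := qE j.
  by rewrite e1 e2 (sqr_eq_pos (halfsum_gt0 _ _ pq _) (halfsum_gt0 _ _ pq _) sw).
Qed.
End FullRank.

(** * Localization of a flex and conclusion *)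

Section Localization.
Local Open Scope classical_set_scope.
Local Open Scope ring_scope.
Variable R : realType.

(** Pigeonhole over shrinking neighbourhoods: otherwise each x fails for some e, and the smallest of
    these finitely many e has no x at all. *)
Lemma finite_limit (F : finType) (Pr : F -> R -> Prop) :
  (forall e, 0 < e -> exists x, Pr x e) ->
  (forall x e e', e <= e' -> Pr x e -> Pr x e') ->
  exists x, forall e, 0 < e -> Pr x e.
Proof.
move=> ex mono; apply: contrapT => /forallNP H.
have /choice[d dP] : forall x, exists e, 0 < e /\ ~ Pr x e.
  by move=> x; have /existsNP[e /not_implyP[e0 h]] := H x; exists e.
have [e e0 le_e] := finite_pos_lb (fun x => (dP x).1).
by have [x /mono h] := ex e e0; have [_ []] := dP x; exact: h.
Qed.

Lemma infinite_itv (a b : R) : a < b -> infinite_set [set x : R | a <= x <= b].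
Proof.
move=> ab /finite_set_countable/countable_lebesgue_measure0.
have -> : [set x : R | a <= x <= b] = [set` `[a, b]].
  by apply/seteqP; split => x /=; rewrite in_itv.
by rewrite lebesgue_measure_itv /= lte_fin ab => -[] /eqP; rewrite subr_eq0 gt_eqF.
Qed.

Lemma within_hdot (A : set R) (f g : R -> hplane R) :
  {within A, continuous (fun t => hval (f t))} ->
  {within A, continuous (fun t => hval (g t))} ->
  {within A, continuous (fun t => hdot (f t) (g t))}.
Proof.
by move=> cf cg t; apply: (@continuous_hdot R (subspace A)); [exact: cf | exact: cg].
Qed.

Lemma within_lin3 (A : set R) (k1 k2 k3 : R) (f g h : R -> R) :
  {within A, continuous f} -> {within A, continuous g} -> {within A, continuous h} ->
  {within A, continuous (fun t => k1 * f t + k2 * g t + k3 * h t)}.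
Proof.
by move=> cf cg ch t; apply: (@continuous_lin3 R (subspace A)); [exact: cf | exact: cg
  | exact: ch].
Qed.

Lemma within_gt (A : set R) (f : R -> R) c t0 : {within A, continuous f} -> A t0 ->
  c < f t0 -> exists2 e : R, 0 < e & forall s, A s -> `|s - t0| < e -> c < f s.
Proof.
move=> /subspace_continuousP cf At0 ft0; have /(cvgr_gt (f t0)) /(_ c ft0) := cf t0 At0.
move=> /nbhs_ballP[e /= e0 be]; exists e => // s As st.
by apply: be => //=; rewrite /ball /= distrC.
Qed.

(** A change of sign would pass through 0. This prevents a joint from jumping to its mirror
    image. *)
Lemma within_sqr_const (a b : R) (f : R -> R) : a <= b -> {within `[a, b], continuous
  f} ->
  f b ^+ 2 = f a ^+ 2 -> (forall s, a <= s <= b -> f s ^+ 2 = f a ^+ 2) -> f b = f a.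
Proof.
move=> ab cf /eqP fab same; move: fab; rewrite eqf_sqr => /orP[] /eqP // fab.
have [s] : exists2 s, s \in `[a, b] & f s = 0.
  apply: IVT => //; rewrite fab; apply/andP; split.
    by rewrite ge_min; have [h|h] := leP (f a) 0; rewrite ?h // oppr_le0 ltW // orbT.
  by rewrite le_max; have [h|h] := leP 0 (f a); rewrite ?h // oppr_ge0 ltW // orbT.
rewrite in_itv /= => /same + fs; rewrite fs expr0n /= => /esym/eqP.
by rewrite sqrf_eq0 => /eqP fa; rewrite fab fa oppr0.
Qed.

Lemma infinite_image_within (A : set R) (a s : R) (f : R -> R) : a <= s ->
  [set x | a <= x <= s] `<=` A -> {within A, continuous f} -> f s <> f a ->
  infinite_set (f @` A).
Proof.
move=> as_ sA cf fsa; pose lo := Num.min (f a) (f s); pose hi := Num.max (f a) (f s).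
have lohi : lo < hi.
  by rewrite /lo /hi; have [h|h|h] := ltgtP (f a) (f s) => //; case: fsa.
apply: (sub_infinite_set _ (infinite_itv lohi)) => v /= vlh.
have sub : [set` `[a, s]] `<=` A by move=> x /=; rewrite in_itv /=; exact: sA.
have [x] := IVT as_ (continuous_subspaceW sub cf) vlh.
by rewrite in_itv /= => ax <-; exists x => //; exact: sA.
Qed.

Definition joints m n (pt : R -> 'I_m -> hplane R) (qt : R -> 'I_n -> hplane R)
  (t : R) (x : 'I_m + 'I_n) : hplane R :=
  match x with inl i => pt t i | inr j => qt t j end.

Definition right_nbhd (t0 e : R) : set R := [set s | t0 <= s <= t0 + e /\ 0 <= s <= 1].

Section Flex.
Variables (m n : nat) (p : 'I_m -> hplane R) (q : 'I_n -> hplane R).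
Variables (pt : R -> 'I_m -> hplane R) (qt : R -> 'I_n -> hplane R).
Hypothesis fw : is_framework p q.
Hypothesis flex : is_flex p q pt qt.

Let z := joints pt qt.

Lemma flex_continuous x : {within `[0, 1], continuous (fun t => hval (z t x))}.
Proof. by have [[cp cq] _ _ _ _] := flex; case: x => x; [exact: cp | exact: cq]. Qed.

Lemma flex_hdot_continuous x y : {within `[0, 1], continuous (fun t => hdot (z t x) (z
  t y))}.
Proof. by apply: within_hdot; exact: flex_continuous. Qed.

Lemma flex_realizes t : 0 <= t <= 1 ->
  realizes (fun i j => hdot (p i) (q j)) (pt t) (qt t).
Proof. by have [_ _ _ h _] := flex; move=> t01 i j; apply/dH_hdot/h. Qed.

(** t0 is the infimum of the times at which some joint is off its initial position, since a flex may
    first stay at rest. Something moves arbitrarily soon after t0. *)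
Let last_rest : exists2 t0 : R, 0 <= t0 <= 1 & (forall x, z t0 x = z 0 x) /\
  forall e, 0 < e -> exists2 s, right_nbhd t0 e s & exists x, z s x <> z 0 x.
Proof.
have [[cp cq] [p0 q0] [t1 t101 moved1] _ _] := flex.
pose S : set R := [set s | 0 <= s <= 1 /\ exists x, z s x <> z 0 x].
have S1 : S t1.
  split=> //; case: moved1 => -[i h].
    by exists (inl i); rewrite /z /= p0.
  by exists (inr i); rewrite /z /= q0.
have lbS : lbound S 0 by move=> s [/andP[]].
have infS : has_inf S by split; [exists t1 | exists 0].
have inf_ge0 : 0 <= inf S by apply: lb_le_inf => //; exists t1.
have inf_le s : S s -> inf S <= s by apply: ge_inf; exists 0.
have t01 : 0 <= inf S <= 1.
  by rewrite inf_ge0 /=; apply: le_trans (inf_le _ S1) _; case/andP: t101.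
have rest x : z (inf S) x = z 0 x.
  apply: contrapT => ne.
  have ch : {within `[0, 1], continuous (fun t => hdot (z t x) (z 0 x))}.
    by apply: within_hdot; [exact: flex_continuous | move=> t; exact: cvg_cst].
  have [||e e0 near] := within_gt ch (t0 := inf S) (c := 1).
  - by rewrite /= in_itv.
  - exact: hdot_gt1.
  have inf0 : 0 < inf S.
    by rewrite lt_neqAle inf_ge0 andbT; apply/eqP => e00; apply: ne; rewrite -e00.
  (* A joint displaced at the infimum would by continuity be displaced at the earlier time s. *)
  pose s := Num.max 0 (inf S - e / 2).
  have sinf : s < inf S by rewrite /s gt_max inf0 /=; lra.
  have s0 : 0 <= s by rewrite /s le_max lexx.
  have s1 : 0 <= s <= 1 by rewrite s0 /=; case/andP: t01; lra.
  have se : inf S - e / 2 <= s by rewrite /s le_max lexx orbT.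
  have /inf_le : S s.
    split=> //; exists x => szx; have := near s.
    rewrite szx hdotxx ltxx /= in_itv /= s1 => /(_ isT) h.
    by suff /h : `|s - inf S| < e by []; rewrite ltr0_norm ?subr_lt0 //; lra.
  by rewrite leNgt sinf.
exists (inf S) => //; split => // e e0.
have [s Ss lts] := inf_adherent e0 infS; exists s; last by case: Ss.
by split; [rewrite inf_le //= ltW | case: Ss].
Qed.

(** If all mutual products were constant, each joint would keep its products with the two joints at
    rest. Only a reflection in the line through these would be left, and [within_sqr_const] excludes
    it. *)
Lemma flex_local : exists2 t0 : R, 0 <= t0 <= 1 & (forall x, z t0 x = z 0 x) /\
  forall e, 0 < e -> exists x y s, right_nbhd t0 e s /\
    hdot (z s x) (z s y) <> hdot (z t0 x) (z t0 y).
Proof.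
have [t0 t001 [rest moves]] := last_rest; exists t0 => //; split => // e e0.
apply: contrapT => H.
have same x y s : right_nbhd t0 e s -> hdot (z s x) (z s y) = hdot (z t0 x) (z t0 y).
  by move=> hs; apply: contrapT => h; apply: H; exists x, y, s.
have [_ [p0 q0] _ _ [i0 [j0 fixed]]] := flex.
have [s [/andP[t0s ste] s01] [x]] := moves e e0; apply; rewrite -rest.
pose f1 := p i0; pose f2 := q j0.
have ne : f1 <> f2 by exact: fw.
have near t : t0 <= t <= s -> right_nbhd t0 e t.
  by move=> /andP[h1 h2]; move: t001 s01 => /andP[? ?] /andP[? ?]; split; apply/andP;
    split; lra.
have f1E t : t0 <= t <= s -> z t (inl i0) = f1 by move=> /near[_ /fixed[]].
have f2E t : t0 <= t <= s -> z t (inr j0) = f2 by move=> /near[_ /fixed[]].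
have t0t0 : t0 <= t0 <= s by rewrite lexx.
have ts : t0 <= s <= s by rewrite t0s lexx.
have h1 t : t0 <= t <= s -> hdot (z t x) f1 = hdot (z t0 x) f1.
  by move=> ht; rewrite -{1}(f1E t ht) -(f1E t0 t0t0); apply/same/near.
have h2 t : t0 <= t <= s -> hdot (z t x) f2 = hdot (z t0 x) f2.
  by move=> ht; rewrite -{1}(f2E t ht) -(f2E t0 t0t0); apply/same/near.
have vol2 t : t0 <= t <= s -> vol f1 f2 (z t x) ^+ 2 = vol f1 f2 (z t0 x) ^+ 2.
  by move=> ht; rewrite !expr2 !vol_mul !(hdotC _ (z _ _)) !hdotxx h1 ?h2.
have volE : vol f1 f2 (z s x) = vol f1 f2 (z t0 x).
  apply: (within_sqr_const t0s (f := fun t => vol f1 f2 (z t x))) => //; last exact: vol2.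
  have sub : [set` `[t0, s]] `<=` [set` `[0, 1]].
    move=> t /=; rewrite !in_itv /= => /andP[? ?].
    by move: t001 s01 => /andP[? ?] /andP[? ?]; apply/andP; split; lra.
  have cz := continuous_subspaceW sub (flex_continuous (x := x)).
  move=> t; apply: (@continuous_vol R (subspace `[t0, s])); [exact: cvg_cst | exact:
    cvg_cst | exact: cz].
apply: hval_inj; apply: (vol_inj (vol_crossv_neq0 ne)); rewrite ?h1 ?h2 //.
by rewrite !(hdotC _ (crossv _ _)) !hdot_crossv volE.
Qed.

End Flex.
End Localization.

(** * Necessity of the two conditions *)

Section Necessity.
Local Open Scope classical_set_scope.
Local Open Scope ring_scope.
Variables (R : realType) (m n : nat) (p : 'I_m -> hplane R) (q : 'I_n -> hplane R).
Variables (pt : R -> 'I_m -> hplane R) (qt : R -> 'I_n -> hplane R).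
Hypotheses (m_gt2 : (2 < m)%N) (n_gt2 : (2 < n)%N).
Hypothesis pq : non_overlapping p q.
Hypothesis flex : is_flex p q pt qt.

Let C i j := hdot (p i) (q j).
Let z := joints pt qt.

Variable t0 : R.
Hypothesis t001 : 0 <= t0 <= 1.
Hypothesis rest : forall x, z t0 x = z 0 x.
Hypothesis moves : forall e, 0 < e -> exists x y s, right_nbhd t0 e s /\
    hdot (z s x) (z s y) <> hdot (z t0 x) (z t0 y).

Let pt0 i : pt t0 i = p i.
Proof. by have := rest (inl i); rewrite /z /= => ->; have [_ [-> _]] := flex. Qed.
Let qt0 j : qt t0 j = q j.
Proof. by have := rest (inr j); rewrite /z /= => ->; have [_ [_ ->]] := flex. Qed.

Let real e t : right_nbhd t0 e t -> realizes C (pt t) (qt t).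
Proof. by move=> [_]; apply: flex_realizes. Qed.

Let infinite_nbhd e x y s : right_nbhd t0 e s ->
  hdot (z s x) (z s y) <> hdot (z t0 x) (z t0 y) ->
  infinite_set ((fun t => hdot (z t x) (z t y)) @` right_nbhd t0 e).
Proof.
move=> [/andP[ts st] s01] ne.
apply: (infinite_image_within (a := t0) (s := s)) => //.
- by move=> t /= /andP[? ?]; move: t001 s01 => /andP[? ?] /andP[? ?]; split;
    apply/andP; split; lra.
apply: continuous_subspaceW (flex_hdot_continuous flex (x := x) (y := y)).
by move=> t [_ /=]; rewrite in_itv.
Qed.

Lemma flex_full_rank k1 k2 k3 j1 j2 j3 :
  minor3 C k1 k2 k3 j1 j2 j3 != 0 -> condition_D2 p q.
Proof.
move=> d0; have [pinj qinj fw] := pq.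
have C1 i j : 1 < C i j by apply: hdot_gt1; exact: fw.
pose Pr (l : 'I_m * 'I_m * 'I_m) e :=
  minor3 C l.1.1 l.1.2 l.2 j1 j2 j3 != 0 /\ exists J : set R, [/\ J `<=` right_nbhd t0 e,
    infinite_set ((fun t => (hdot (pt t l.1.1) (pt t l.1.2), hdot (pt t l.1.1) (pt t
      l.2))) @` J) &
    forall t, J t -> right_angled (pt t) l.1.1 l.1.2 l.2].
have [l Prl] : exists l, forall e, 0 < e -> Pr l e.
  apply: finite_limit => [e e0|l e e' ee' [h [J [J1 J2 J3]]]]; last first.
    split=> //; exists J; split=> // t /J1[/andP[h1 h2] h3]; split=> //.
    by rewrite h1 (le_trans h2) // lerD2l.
  have rot (l1 l2 l3 : 'I_m) s : minor3 C l1 l2 l3 j1 j2 j3 != 0 -> right_nbhd t0 e s ->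
      hdot (pt s l1) (pt s l2) <> hdot (pt t0 l1) (pt t0 l2) -> exists l, Pr l e.
    move=> dl hs ne; have inf := infinite_nbhd hs (x := inl l1) (y := inl l2) ne.
    have [l1' [l2' [l3' h]]] := right_angled_of_infinite (fun t => @real e t) C1 dl inf.
    by exists (l1', l2', l3').
  have [x [y [s [hs ne]]]] := moves e0.
  have d231 : minor3 C k2 k3 k1 j1 j2 j3 != 0.
    by apply: contra d0 => /eqP d0; rewrite -d0 /minor3 /det3; apply/eqP; ring.
  have d132 : minor3 C k1 k3 k2 j1 j2 j3 != 0.
    by apply: contra d0 => /eqP d0; rewrite -oppr_eq0 -d0 /minor3 /det3; apply/eqP; ring.
  (* One of the three distances among p k1, p k2, p k3 changes: otherwise [eq_gram] carries
     constancy to the q's, and from them to all the p's. *)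
  have [e12|/eqP ne12] := eqVneq (hdot (pt s k1) (pt s k2)) (hdot (pt t0 k1) (pt t0
    k2)); last exact: rot d0 hs ne12.
  have [e13|/eqP ne13] := eqVneq (hdot (pt s k1) (pt s k3)) (hdot (pt t0 k1) (pt t0
    k3)); last exact: rot d132 hs ne13.
  have [e23|/eqP ne23] := eqVneq (hdot (pt s k2) (pt s k3)) (hdot (pt t0 k2) (pt t0
    k3)); last exact: rot d231 hs ne23.
  exfalso; apply: ne.
  have hs0 : right_nbhd t0 e t0 by split=> //; rewrite lexx /=; lra.
  have rs := real hs; have r0 := real hs0.
  have := d0; rewrite (minor3_vol _ _ _ _ _ _ rs) mulf_eq0 negb_or => /andP[vp vq].
  have qq j l : hdot (qt s j) (qt s l) = hdot (qt t0 j) (qt t0 l).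
    by apply: (eq_gram (u1' := pt t0 k1) (u2' := pt t0 k2) (u3' := pt t0 k3)
      (v' := qt t0 j) (w' := qt t0 l) vp); rewrite ?hdotxx ?rs ?r0.
  have pp i k : hdot (pt s i) (pt s k) = hdot (pt t0 i) (pt t0 k).
    by apply: (eq_gram (u1' := qt t0 j1) (u2' := qt t0 j2) (u3' := qt t0 j3)
      (v' := pt t0 i) (w' := pt t0 k) vq);
      rewrite ?hdotxx ?qq // ?(hdotC (qt s _)) ?(hdotC (qt t0 _)) ?rs ?r0.
  case: x y => [i|j] [k|l] /=; rewrite ?pp ?qq //.
    by rewrite (real hs) (real hs0).
  by rewrite hdotC (real hs) hdotC (real hs0).
have [dl [J [J1 J2 J3]]] := Prl 1 ltr01.
have dix : dixon_matrix C l.1.1 l.1.2 l.2.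
  by apply: (dixon_matrix_of_curve _ dl J2 J3) => t /J1; apply: real.
(* The same triple l is right-angled at times arbitrarily close to t0, hence at t0 by continuity; k
   = 1 and k = -1 give the two inequalities. *)
have rect0 : right_angled p l.1.1 l.1.2 l.2.
  have t0in : [set` `[0, 1]] t0 by rewrite /= in_itv.
  have not_gt (k : R) : ~ k * (-1) < k * hdot (p l.1.2) (p l.2) + (- k) * hdot (p
    l.1.1) (p l.1.2) + (- k) * hdot (p l.1.1) (p l.2).
    rewrite -!pt0.
    have ch x y := flex_hdot_continuous flex (x := inl x) (y := inl y).
    have cf : {within `[0, 1], continuous (fun t => k * hdot (pt t l.1.2) (pt t l.2) +
      (- k) * hdot (pt t l.1.1) (pt t l.1.2) + (- k) * hdot (pt t l.1.1) (pt t l.2))}.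
      by apply: within_lin3; exact: ch.
    move=> /(within_gt cf t0in)[e e0 near].
    have [_ [J' [J'1 J'2 J'3]]] := Prl (e / 2) (divr_gt0 e0 (ltr0n _ 2)).
    have [_ [s Js _]] := infinite_setN0 J'2.
    have [/andP[h1 h2] h3] := J'1 s Js.
    have := near s; rewrite /= in_itv /= h3 (J'3 s Js) => /(_ isT) h.
    suff /h : `|s - t0| < e by lra.
    by rewrite ger0_norm ?subr_ge0 //; lra.
  have := not_gt 1; have := not_gt (-1); rewrite /right_angled => /negP; rewrite -leNgt
    => h1.
  by move=> /negP; rewrite -leNgt => h2; lra.
by apply: (condition_D2_of_dixon_matrix _ dl rect0 dix) => // i j.
Qed.

Lemma flex_rank_neq2 i0 i1 j0 j1 :
  (forall k1 k2 k3 l1 l2 l3, minor3 C k1 k2 k3 l1 l2 l3 = 0) ->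
  C i0 j0 * C i1 j1 = C i0 j1 * C i1 j0.
Proof.
move=> minor0; apply/eqP; rewrite -subr_eq0; apply: contrapT => /negP mu0.
have [pinj qinj fw] := pq.
have third k (a b : 'I_k) : (2 < k)%N -> exists2 c, c != a & c != b.
  move=> k3; have : ~~ ('I_k \subset pred2 a b).
    apply/negP => /subset_leq_card; rewrite card_ord card2 leqNgt => /negP; apply.
    by apply: leq_ltn_trans k3; rewrite ltnS leq_b1.
  by move=> /subsetPn[c _]; rewrite inE negb_or => /andP[? ?]; exists c.
have [i2 i20 i21] := third _ i0 i1 m_gt2.
have [j2 j20 j21] := third _ j0 j1 n_gt2.
have t0in : [set` `[0, 1]] t0 by rewrite /= in_itv.
have z0inj x y : x <> y -> z t0 x <> z t0 y.
  case: x y => [i|j] [k|l] /= ne; rewrite ?pt0 ?qt0 //.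
  - by move=> /pinj e; apply: ne; rewrite e.
  - by move=> /esym; exact: fw.
  - by move=> /qinj e; apply: ne; rewrite e.
(* [collinear_finite] needs distinct joints, which a motion does not guarantee: they are distinct at
   t0, hence on a common neighbourhood. *)
have near_xy (xy : ('I_m + 'I_n) * ('I_m + 'I_n)) : exists e, 0 < e /\
    forall s, 0 <= s <= 1 -> `|s - t0| < e -> xy.1 <> xy.2 -> z s xy.1 <> z s xy.2.
  have [e|/eqP ne] := eqVneq xy.1 xy.2; first by exists 1; split=> // s _ _; rewrite e.
  have [|e e0 h] := within_gt (c := 1) (flex_hdot_continuous flex (x := xy.1) (y :=
    xy.2)) t0in.
    by apply: hdot_gt1; exact: z0inj.
  exists e; split=> // s s01 st _ e'; have := h s; rewrite /= in_itv /= s01 => /(_ isT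
    st).
  by rewrite -/z e' hdotxx ltxx.
have [d dP] := choice near_xy.
have [e e0 le_e] := finite_pos_lb (fun xy => (dP xy).1).
have e20 : 0 < e / 2 by rewrite divr_gt0.
have zinj s x y : right_nbhd t0 (e / 2) s -> x <> y -> z s x <> z s y.
  move=> [/andP[h1 h2] h3]; apply: ((dP (x, y)).2 s h3).
  by apply: lt_le_trans (le_e (x, y)); rewrite ger0_norm ?subr_ge0 //; lra.
have ptinj s : right_nbhd t0 (e / 2) s -> injective (pt s).
  move=> hs a b ab; apply: contrapT => ne; apply: (@zinj s (inl a) (inl b)) => //.
  by case.
have qtinj s : right_nbhd t0 (e / 2) s -> injective (qt s).
  move=> hs a b ab; apply: contrapT => ne; apply: (@zinj s (inr a) (inr b)) => //.
  by case.
pose I := right_nbhd t0 (e / 2).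
pose Ip : set R := [set s | forall k, vol (pt s i0) (pt s i1) (pt s k) = 0].
pose Iq : set R := [set s | forall k, vol (qt s j0) (qt s j1) (qt s k) = 0].
(* Every product of a volume of p's and a volume of q's is a minor of C, hence 0: as soon as one p k
   is off the line of p i0 and p i1, all the q's are collinear. *)
have cover s : I s -> Ip s \/ Iq s.
  move=> hs; have [|/existsNP[k /eqP vk]] := pselect (Ip s); [by left | right => l].
  apply: (mulIr0 vk); rewrite -(minor3_vol _ _ _ _ _ _ (real hs)); exact: minor0.
have [Fp1 Fp2] : (forall i k, finite_set ((fun t => hdot (pt t i) (pt t k)) @` (I `&`
  Ip))) /\
    (forall j l, finite_set ((fun t => hdot (qt t j) (qt t l)) @` (I `&` Ip))).
  apply: (collinear_finite i20 i21 _ _ mu0).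
  - by move=> t i j [It _]; exact: (real It).
  - by move=> t [It _]; exact: ptinj.
  - by move=> t k [_]; apply.
have [Fq1 Fq2] : (forall i k, finite_set ((fun t => hdot (qt t i) (qt t k)) @` (I `&`
  Iq))) /\
    (forall j l, finite_set ((fun t => hdot (pt t j) (pt t l)) @` (I `&` Iq))).
  apply: (@collinear_finite R R (I `&` Iq) n m qt pt (fun j i => C i j) j0 j1 j2 i0 i1
    j20 j21).
  - by move=> t i j [It _]; rewrite hdotC; exact: (real It).
  - by move=> t [It _]; exact: qtinj.
  - by rewrite [C i1 j0 * _]mulrC.
  - by move=> t k [_]; apply.
have [x [y [s [hs ne]]]] := moves e20.
have hs0 : right_nbhd t0 (e / 2) t0 by split=> //; rewrite lexx /=; lra.
(* A product that changes takes infinitely many values, whereas only finitely many are possible on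
   each of [Ip] and [Iq]. *)
have inf := infinite_nbhd hs ne.
case: x y ne inf => [i|j] [k|l] /= ne inf.
- by have [h|h] := infinite_image_split inf cover; apply: h.
- by apply: ne; rewrite (real hs) (real hs0).
- by apply: ne; rewrite hdotC (real hs) hdotC (real hs0).
- by have [h|h] := infinite_image_split inf cover; apply: h.
Qed.
End Necessity.

Section Classification.
Local Open Scope classical_set_scope.
Local Open Scope ring_scope.
Variable R : realType.

Lemma flexible_D1_or_D2 m n (p : 'I_m -> hplane R) (q : 'I_n -> hplane R) :
  (2 < m)%N -> (2 < n)%N -> non_overlapping p q -> flexible p q ->
  condition_D1 p q \/ condition_D2 p q.
Proof.
move=> m3 n3 pq [pt [qt flex]]; have [pinj qinj fw] := pq.
have [t0 t001 [rest moves]] := flex_local fw flex.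
pose C i j := hdot (p i) (q j).
have [minor0|] := pselect (forall k1 k2 k3 l1 l2 l3, minor3 C k1 k2 k3 l1 l2 l3 = 0).
  left; apply: (@condition_D1_of_minors _ _ _ p q (Ordinal (ltnW (ltnW m3)))
    (Ordinal (ltnW m3)) (Ordinal (ltnW (ltnW n3))) (Ordinal (ltnW n3))).
  - by move=> /pinj.
  - by move=> /qinj.
  - by move=> i k j l; exact: (flex_rank_neq2 m3 n3 pq flex t001 rest moves i k j l
      minor0).
move=> /existsNP[k1 /existsNP[k2 /existsNP[k3 /existsNP[l1 /existsNP[l2 /existsNP[l3
  /eqP d0]]]]]].
by right; apply: (flex_full_rank pq flex t001 rest moves d0).
Qed.
End Classification.

Theorem theorem2 (R : realType) (m n : nat)
    (p : 'I_m -> hplane R) (q : 'I_n -> hplane R) :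
  3 <= minn m n ->
  is_framework p q ->
  non_overlapping p q ->
  (flexible p q <-> condition_D1 p q \/ condition_D2 p q).
Proof.
rewrite leq_min => /andP[m3 n3] fw pq; split; first exact: flexible_D1_or_D2.
by case; [apply: flexible_D1 => //; exact: ltnW | exact: flexible_D2].
Qed.
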